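(* Fix constants $a>0$ and $g>0$. Suppose $\rho_0$ is not identically zero and is smooth, bounded, nonnegative and even on $\mathbb{T}$, with $\rho_0(0)=0$ and $\rho_0'\ge 0$ on $[0,\pi)$. Let $\rho$ denote the corresponding unique local-in-time solution on $\mathbb{T}$ of \[ \partial_t \rho + u\,\partial_x \rho = 0,\qquad u = g\,H_a\rho,\qquad \rho(\cdot,0)=\rho_0 . \] Then there exists a finite time $0<T_*<\infty$ such that $\rho$ is nonnegative, bounded and smooth for all $0\le t<T_*$, while \[ \lim_{t\to T_*}\int_0^t \|\partial_x\rho(\cdot,s)\|_{L^\infty}\,ds = \infty . \] In particular, $\rho(\cdot,t)$ cannot remain in $C^\infty(\mathbb{T})$ for all time.
   Context: $\mathbb{T}=[-\pi,\pi)$ denotes the circle; functions on $\mathbb{T}$ are identified with $2\pi$-periodic functions on $\mathbb{R}$, and $C^\infty(\mathbb{T})$ denotes smooth $2\pi$-periodic functions (bounded, with all derivatives bounded). For $a>0$, $H_a f(x) := \mathrm{P.V.}\int_{\mathbb{R}} f(x-y)K_a(y)\,dy$ with $K_a(y) := \frac{a^2}{\pi y(y^2+a^2)}$, applied to the periodic extension of $f$. For smooth initial data this problem has a unique local-in-time smooth solution. *)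

(* Defs.v *)
From Stdlib Require Import Reals List.
From Coquelicot Require Import Coquelicot.
Open Scope R_scope.

(** Convention: a space-time function is [f : R -> R -> R], read [f t x]. *)

Definition periodic2pi (f : R -> R) : Prop := forall x, f (x + 2 * PI) = f x.

Definition smooth_per (f : R -> R) : Prop :=
  periodic2pi f /\
  (forall n x, ex_derive_n f n x) /\
  (forall n, exists M, forall x, Rabs (Derive_n f n x) <= M).

Definition bounded_fun (f : R -> R) : Prop := exists M, forall x, Rabs (f x) <= M.

Definition Ka (a y : R) : R := a ^ 2 / (PI * y * (y ^ 2 + a ^ 2)).

Definition Ha_trunc (a : R) (f : R -> R) (x eps : R) : R :=
  RInt_gen (fun y => f (x - y) * Ka a y) (Rbar_locally m_infty) (at_point (- eps))
  + RInt_gen (fun y => f (x - y) * Ka a y) (at_point eps) (Rbar_locally p_infty).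

Definition is_Ha (a : R) (f : R -> R) (x v : R) : Prop :=
  (forall eps, 0 < eps ->
     ex_RInt_gen (fun y => f (x - y) * Ka a y) (Rbar_locally m_infty) (at_point (- eps)) /\
     ex_RInt_gen (fun y => f (x - y) * Ka a y) (at_point eps) (Rbar_locally p_infty)) /\
  filterlim (Ha_trunc a f x) (at_right 0) (locally v).

Definition pdx (f : R -> R -> R) : R -> R -> R := fun t x => Derive (fun y => f t y) x.
Definition pdt (f : R -> R -> R) : R -> R -> R := fun t x => Derive (fun s => f s x) t.

Fixpoint pd (w : list bool) (f : R -> R -> R) : R -> R -> R :=
  match w with
  | nil => f
  | b :: w' => (if b then pdt else pdx) (pd w' f)
  end.

Definition uncurry2 (f : R -> R -> R) : R * R -> R := fun p => f (fst p) (snd p).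

(** Classical smooth solution on [0,T) x T of
    rho_t + u rho_x = 0, u = g H_a rho, rho(.,0) = rho0:
    - C^infty jointly in (t,x) on (0,T) x R,
    - all x-derivatives jointly continuous on [0,T) x R (up to t = 0),
    - 2pi-periodic in x, initial datum rho0, equation pointwise for 0 < t < T. *)
Definition classical_solution (a g : R) (rho0 : R -> R) (T : R) (rho : R -> R -> R) : Prop :=
  (forall x, rho 0 x = rho0 x) /\
  (forall t, 0 <= t < T -> periodic2pi (rho t)) /\
  (forall w t x, 0 < t < T ->
     ex_derive (fun s => pd w rho s x) t /\
     ex_derive (fun y => pd w rho t y) x /\
     continuous (uncurry2 (pd w rho)) (t, x)) /\
  (forall n t x, 0 <= t < T ->
     filterlim (uncurry2 (Nat.iter n pdx rho))
       (within (fun p : R * R => 0 <= fst p) (locally (t, x)))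
       (locally (Nat.iter n pdx rho t x))) /\
  (forall t x, 0 < t < T ->
     exists v, is_Ha a (rho t) x v /\ pdt rho t x + (g * v) * pdx rho t x = 0).

Definition Linf (f : R -> R) : R := real (Lub_Rbar (fun y => exists x, y = Rabs (f x))).

(* Main.v *)
(** Write [rho(t,x) = sum_k c_k(t) (cos kx - 1)].  Since [H_a] sends [cos kx] to
    [symbol a k * sin kx] with a bounded symbol, the equation is the quadratic system
    [c' = transport c c].  A solution is the limit, along a free ultrafilter on [nat], of explicit
    Euler schemes for the Galerkin truncations; the cancellation behind the transport structure
    bounds one step of every Sobolev energy in terms of the [H^2] energy, so the limit is smooth
    on every time interval on which the [H^2] energies of the schemes stay bounded.

    Even data increasing on [[0,pi]] stay so, by a minimum principle for the slope.  Then
    [- H_a rho x >= const * (rho x - rho ((1 - mu) x))], and the singular mass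
    [J = int rho(s^2) / s^2 ds] satisfies [J' >= const * J^2]; hence the lifespan is finite.  If
    [int |rho_x|_oo] stayed bounded up to its end, the logarithmic bound of [u_x] by [|rho_x|_oo]
    and the [H^2] energy would keep that energy bounded, and the solution could be continued. *)

Require Import Defs.
From Stdlib Require Import Reals ZArith Lra Lia ClassicalEpsilon.
From mathcomp Require filter.
From Coquelicot Require Import Coquelicot.
Open Scope R_scope.

(** * Calculus of real functions *)

(* Coquelicot states the next rules for [plus], [scal], ... of an arbitrary module; with the
   operations of [R] they apply to a goal without naming the functions involved. *)
Section RealLimits.
Context {T : Type} {F : (T -> Prop) -> Prop} {FF : Filter F}.

Lemma filterlim_Rplus (f h : T -> R) (l l' : R) : filterlim f F (locally l) ->
  filterlim h F (locally l') -> filterlim (fun z => f z + h z) F (locally (l + l')).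
Proof. intros Hf Hh. eapply filterlim_comp_2; [exact Hf|exact Hh|]. apply (filterlim_plus l l').
Qed.

Lemma filterlim_Rmult (f h : T -> R) (l l' : R) : filterlim f F (locally l) ->
  filterlim h F (locally l') -> filterlim (fun z => f z * h z) F (locally (l * l')).
Proof. intros Hf Hh. eapply filterlim_comp_2; [exact Hf|exact Hh|]. apply (filterlim_mult l l').
Qed.

Lemma filterlim_Ropp (f : T -> R) (l : R) : filterlim f F (locally l) ->
  filterlim (fun z => - f z) F (locally (- l)).
Proof. intros Hf. eapply filterlim_comp; [exact Hf|]. apply (filterlim_opp l). Qed.

Lemma filterlim_Rminus (f h : T -> R) (l l' : R) : filterlim f F (locally l) ->
  filterlim h F (locally l') -> filterlim (fun z => f z - h z) F (locally (l - l')).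
Proof. intros Hf Hh. apply filterlim_Rplus; [exact Hf|]. now apply filterlim_Ropp. Qed.

Lemma filterlim_Rabs (f : T -> R) (l : R) : filterlim f F (locally l) ->
  filterlim (fun z => Rabs (f z)) F (locally (Rabs l)).
Proof. intros Hf. eapply filterlim_comp; [exact Hf|]. apply (filterlim_norm l). Qed.

Lemma filterlim_Rconst (l : R) : filterlim (fun _ : T => l) F (locally l).
Proof. apply filterlim_const. Qed.

Lemma filterlim_R_eps (f : T -> R) (l : R) :
  filterlim f F (locally l) <-> forall eps, 0 < eps -> F (fun z => Rabs (f z - l) < eps).
Proof.
  rewrite (filterlim_locally f l). split.
  - intros H eps He. exact (H (mkposreal _ He)).
  - intros H eps. exact (H eps (cond_pos eps)).
Qed.
End RealLimits.

Lemma filterlim_Rle {T : Type} {F : (T -> Prop) -> Prop} {FF : ProperFilter F}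
  (f h : T -> R) (l l' : R) : F (fun z => f z <= h z) ->
  filterlim f F (locally l) -> filterlim h F (locally l') -> l <= l'.
Proof.
  intros Hle Hf Hh. rewrite filterlim_R_eps in Hf, Hh.
  apply le_epsilon. intros eps He. assert (He2 : 0 < eps / 2) by lra.
  destruct (filter_ex _ (filter_and _ _ Hle (filter_and _ _ (Hf _ He2) (Hh _ He2))))
    as [z [Hz [Hfz Hhz]]].
  apply Rabs_def2 in Hfz. apply Rabs_def2 in Hhz. lra.
Qed.

Section RealContinuity.
Context {T : UniformSpace}.
Implicit Types (f h : T -> R) (x : T).

Lemma continuous_Rplus f h x :
  continuous f x -> continuous h x -> continuous (fun y => f y + h y) x.
Proof. apply filterlim_Rplus. Qed.

Lemma continuous_Rminus f h x :
  continuous f x -> continuous h x -> continuous (fun y => f y - h y) x.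
Proof. apply filterlim_Rminus. Qed.

Lemma continuous_Rmult f h x :
  continuous f x -> continuous h x -> continuous (fun y => f y * h y) x.
Proof. apply filterlim_Rmult. Qed.

Lemma continuous_Rscal c f x : continuous f x -> continuous (fun y => c * f y) x.
Proof. apply continuous_Rmult, continuous_const. Qed.
End RealContinuity.

Lemma continuous_of_ex_derive (f : R -> R) x : ex_derive f x -> continuous f x.
Proof. apply (ex_derive_continuous f x). Qed.

Lemma continuous_of_is_derive (f : R -> R) (x l : R) : is_derive f x l -> continuous f x.
Proof. intros H. apply continuous_of_ex_derive. now exists l. Qed.

Lemma continuous_shift (f : R -> R) x y :
  (forall z, continuous f z) -> continuous (fun y => f (x + y)) y.
Proof.
  intros Hf. apply (continuous_comp (fun y => x + y) f); [|apply Hf].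
  apply continuous_of_ex_derive. auto_derive; auto.
Qed.

Lemma continuous_shift_reflect (f : R -> R) x y :
  (forall z, continuous f z) -> continuous (fun y => f (x - y)) y.
Proof.
  intros Hf. apply (continuous_comp (fun y => x - y) f); [|apply Hf].
  apply continuous_of_ex_derive. auto_derive; auto.
Qed.

Lemma continuous_of_lipschitz (f : R -> R) (t d A : R) : 0 < d ->
  (forall s, Rabs (s - t) < d -> Rabs (f s - f t) <= A * Rabs (s - t)) -> continuous f t.
Proof.
  intros Hd Hf. apply filterlim_R_eps. intros eps He.
  assert (HA : 0 < Rabs A + 1) by (pose proof (Rabs_pos A); lra).
  assert (Hr : 0 < Rmin d (eps / (Rabs A + 1))).
  { apply Rmin_pos; [exact Hd|now apply Rdiv_lt_0_compat]. }
  exists (mkposreal _ Hr). intros s Hs. change (Rabs (s - t) < Rmin d (eps / (Rabs A + 1))) in Hs.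
  apply Rle_lt_trans with (A * Rabs (s - t)).
  { apply Hf. eapply Rlt_le_trans; [exact Hs|apply Rmin_l]. }
  assert (Hlt : Rabs (s - t) < eps / (Rabs A + 1))
    by (eapply Rlt_le_trans; [exact Hs|apply Rmin_r]).
  apply Rmult_lt_compat_r with (r := Rabs A + 1) in Hlt; [|lra].
  replace (eps / (Rabs A + 1) * (Rabs A + 1)) with eps in Hlt by (field; lra).
  pose proof (Rle_abs A). pose proof (Rabs_pos (s - t)). nra.
Qed.

Lemma is_derive_Rplus (f h : R -> R) (x l l' : R) : is_derive f x l -> is_derive h x l' ->
  is_derive (fun y => f y + h y) x (l + l').
Proof. apply (is_derive_plus f h). Qed.

Lemma is_derive_Rminus (f h : R -> R) (x l l' : R) : is_derive f x l -> is_derive h x l' ->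
  is_derive (fun y => f y - h y) x (l - l').
Proof. apply (is_derive_minus f h). Qed.

Lemma is_derive_Ropp (f : R -> R) (x l : R) : is_derive f x l -> is_derive (fun y => - f y) x (- l).
Proof. apply (is_derive_opp f). Qed.

Lemma is_derive_Rmult (f h : R -> R) (x l l' : R) : is_derive f x l -> is_derive h x l' ->
  is_derive (fun y => f y * h y) x (l * h x + f x * l').
Proof. intros Hf Hh. apply (is_derive_mult f h); auto. intros; apply Rmult_comm. Qed.

Lemma is_derive_Rconst (c x : R) : is_derive (fun _ => c) x 0.
Proof. apply (is_derive_const c). Qed.

Lemma is_derive_minus_const (f : R -> R) (x l b : R) :
  is_derive f x l -> is_derive (fun y => f y - b) x l.
Proof.
  intros H. replace l with (l - 0) by ring.
  apply is_derive_Rminus; [exact H|apply is_derive_Rconst].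
Qed.

Lemma le_of_nonneg_derive (f f' : R -> R) a b : a <= b ->
  (forall x, a <= x <= b -> is_derive f x (f' x)) ->
  (forall x, a <= x <= b -> 0 <= f' x) -> f a <= f b.
Proof.
  intros Hab Hd Hf.
  destruct (MVT_gen f a b f') as [c [Hc Hfc]].
  - intros x Hx. rewrite Rmin_left, Rmax_right in Hx by lra. apply Hd; lra.
  - intros x Hx. rewrite Rmin_left, Rmax_right in Hx by lra.
    apply continuity_pt_filterlim, (continuous_of_is_derive f x (f' x)), Hd; lra.
  - rewrite Rmin_left, Rmax_right in Hc by lra. specialize (Hf c Hc). nra.
Qed.

Lemma increment_le_of_derive_le (f f' h h' : R -> R) a b : a <= b ->
  (forall x, a <= x <= b -> is_derive f x (f' x)) ->
  (forall x, a <= x <= b -> is_derive h x (h' x)) ->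
  (forall x, a <= x <= b -> Rabs (f' x) <= h' x) ->
  Rabs (f b - f a) <= h b - h a.
Proof.
  intros Hab Hf Hh Hle. apply Rabs_le. split.
  - assert (h a + f a <= h b + f b); [|lra].
    apply (le_of_nonneg_derive (fun x => h x + f x) (fun x => h' x + f' x)); auto.
    + intros x Hx. apply is_derive_Rplus; auto.
    + intros x Hx. specialize (Hle x Hx). apply Rabs_le_between in Hle. lra.
  - assert (h a - f a <= h b - f b); [|lra].
    apply (le_of_nonneg_derive (fun x => h x - f x) (fun x => h' x - f' x)); auto.
    + intros x Hx. apply is_derive_Rminus; auto.
    + intros x Hx. specialize (Hle x Hx). apply Rabs_le_between in Hle. lra.
Qed.

Lemma constant_of_derive_0 (f : R -> R) : (forall x, is_derive f x 0) -> forall x y, f x = f y.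
Proof.
  intros Hf. assert (Hle : forall x y, x <= y -> f x = f y).
  { intros x y Hxy.
    pose proof (increment_le_of_derive_le f (fun _ => 0) (fun _ => 0) (fun _ => 0) x y Hxy) as H.
    cbv beta in H. rewrite Rminus_diag in H. apply Rminus_diag_uniq_sym. apply Rabs_eq_0.
    apply Rle_antisym; [apply H|apply Rabs_pos]; auto.
    - intros; apply is_derive_Rconst.
    - intros; rewrite Rabs_R0; lra. }
  intros x y. destruct (Rle_dec x y); [auto|symmetry; apply Hle; lra].
Qed.

Lemma exists_lt_left_of_derive_pos (f : R -> R) (t d : R) :
  is_derive f t d -> 0 < d -> 0 < t -> exists s, 0 < s < t /\ f s < f t.
Proof.
  intros Hd Hpos Ht. apply is_derive_Reals in Hd.
  destruct (Hd (d / 2) ltac:(lra)) as [de Hde]. pose proof (cond_pos de).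
  pose (h := - Rmin (de / 2) (t / 2)).
  assert (Hh : 0 < - h /\ - h <= de / 2 /\ - h <= t / 2).
  { unfold h. rewrite Ropp_involutive.
    repeat split; [apply Rmin_pos; lra|apply Rmin_l|apply Rmin_r]. }
  specialize (Hde h ltac:(lra) ltac:(rewrite Rabs_left; lra)). apply Rabs_def2 in Hde.
  exists (t + h). split; [lra|].
  assert (Hneg : (f (t + h) - f t) / h * h < 0) by nra.
  replace ((f (t + h) - f t) / h * h) with (f (t + h) - f t) in Hneg by (field; lra). lra.
Qed.

Lemma is_derive_diff_quotient (f : R -> R) (t l : R) :
  is_derive f t l <->
  filterlim (fun z => (f (t + z) - f t) / z) (within (fun z => z <> 0) (locally 0)) (locally l).
Proof.
  assert (FF : Filter (within (fun z : R => z <> 0) (locally 0)))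
    by apply within_filter, locally_filter.
  rewrite is_derive_Reals, filterlim_R_eps. split.
  - intros Hd eps He. destruct (Hd eps He) as [de Hde]. exists de. intros z Hz Hz0.
    change (Rabs (z - 0) < de) in Hz. rewrite Rminus_0_r in Hz. auto.
  - intros Hl eps He. destruct (Hl eps He) as [de Hde]. exists de. intros z Hz0 Hz.
    apply Hde; [|exact Hz0]. change (Rabs (z - 0) < de). now rewrite Rminus_0_r.
Qed.

Lemma diff_quotient_le (f f' : R -> R) (t z M : R) : z <> 0 ->
  (forall x, Rabs (x - t) <= Rabs z -> is_derive f x (f' x)) ->
  (forall x, Rabs (x - t) <= Rabs z -> Rabs (f' x) <= M) ->
  Rabs ((f (t + z) - f t) / z) <= M.
Proof.
  intros Hz Hd HM.
  destruct (MVT_cor4 f f' t (Rabs z) Hd (t + z)) as [c [Hc Hct]].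
  { replace (t + z - t) with z by ring. lra. }
  replace (t + z - t) with z in Hc, Hct by ring.
  rewrite Hc. replace (f' c * z / z) with (f' c) by (field; auto). auto.
Qed.

Section RealIntegrals.
Implicit Types (f h : R -> R) (a b c l : R).

Lemma is_RInt_Rplus f h a b (l l' : R) : is_RInt f a b l -> is_RInt h a b l' ->
  is_RInt (fun x => f x + h x) a b (l + l').
Proof. apply (is_RInt_plus f h). Qed.

Lemma is_RInt_Rminus f h a b (l l' : R) : is_RInt f a b l -> is_RInt h a b l' ->
  is_RInt (fun x => f x - h x) a b (l - l').
Proof. apply (is_RInt_minus f h). Qed.

Lemma is_RInt_Rscal k f a b l : is_RInt f a b l -> is_RInt (fun x => k * f x) a b (k * l).
Proof. apply (is_RInt_scal f a b k). Qed.

Lemma is_RInt_0 a b : is_RInt (fun _ => 0) a b 0.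
Proof.
  pose proof (is_RInt_const a b (0 : R)) as H.
  change (scal (b - a) (0 : R)) with ((b - a) * 0) in H.
  now rewrite Rmult_0_r in H.
Qed.

Lemma is_RInt_reflect f p a b l : is_RInt f (p - b) (p - a) l -> is_RInt (fun x => f (p - x)) a b l.
Proof.
  intros H. apply (is_RInt_swap f) in H.
  replace (p - a) with (-1 * a + p) in H by ring. replace (p - b) with (-1 * b + p) in H by ring.
  apply is_RInt_comp_lin in H. apply (is_RInt_Rscal (-1)) in H.
  replace l with (-1 * opp l) by (change (-1 * - l = l); ring).
  eapply is_RInt_ext; [|exact H]. intros x _.
  change (-1 * (-1 * f (-1 * x + p)) = f (p - x)).
  replace (-1 * x + p) with (p - x) by ring. ring.
Qed.

Lemma RInt_self f a : RInt f a a = 0.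
Proof. apply (RInt_point a f). Qed.

Lemma RInt_Chasles_R f a b c : ex_RInt f a b -> ex_RInt f b c ->
  RInt f a b + RInt f b c = RInt f a c.
Proof. apply (RInt_Chasles f a b c). Qed.

Lemma is_RInt_of_ex f a b : ex_RInt f a b -> is_RInt f a b (RInt f a b).
Proof. apply (RInt_correct f). Qed.

Lemma ex_RInt_continuous_on f a b :
  (forall x, Rmin a b <= x <= Rmax a b -> continuous f x) -> ex_RInt f a b.
Proof. apply (@ex_RInt_continuous R_CompleteNormedModule). Qed.

Lemma ex_RInt_of_continuous f a b : (forall x, continuous f x) -> ex_RInt f a b.
Proof. intros Hf. apply ex_RInt_continuous_on. auto. Qed.

Lemma is_RInt_of_continuous f a b : (forall x, continuous f x) -> is_RInt f a b (RInt f a b).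
Proof. intros Hf. now apply is_RInt_of_ex, ex_RInt_of_continuous. Qed.

Lemma is_derive_RInt_of_continuous f a x :
  (forall y, continuous f y) -> is_derive (fun z => RInt f a z) x (f x).
Proof.
  intros Hf. apply (is_derive_RInt f (fun z => RInt f a z) a x); auto.
  apply filter_forall. intros z. now apply is_RInt_of_continuous.
Qed.

Lemma is_RInt_Rabs_le f a b l M : a <= b -> is_RInt f a b l ->
  (forall x, a <= x <= b -> Rabs (f x) <= M) -> Rabs l <= (b - a) * M.
Proof. intros Hab Hl HM. now apply (norm_RInt_le_const f a b). Qed.

Lemma RInt_nonneg f a b : a <= b -> ex_RInt f a b ->
  (forall x, a <= x <= b -> 0 <= f x) -> 0 <= RInt f a b.
Proof. intros Hab Hf Hpos. apply RInt_ge_0; auto. intros; apply Hpos; lra. Qed.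

Lemma RInt_ge_const f a b m : a <= b -> ex_RInt f a b ->
  (forall x, a <= x <= b -> m <= f x) -> (b - a) * m <= RInt f a b.
Proof.
  intros Hab Hf Hm. pose proof (RInt_le (fun _ => m) f a b Hab) as H.
  rewrite RInt_const in H. apply H; auto.
  - apply ex_RInt_const.
  - intros; apply Hm; lra.
Qed.

Lemma RInt_ge_on_subinterval f a b s t m : a <= s -> s <= t -> t <= b ->
  (forall x, a <= x <= b -> continuous f x) -> (forall x, a <= x <= b -> 0 <= f x) ->
  (forall x, s <= x <= t -> m <= f x) -> (t - s) * m <= RInt f a b.
Proof.
  intros Has Hst Htb Hc Hpos Hm.
  assert (Hex : forall u v, a <= u -> u <= v -> v <= b -> ex_RInt f u v).
  { intros u v Hu Huv Hv. apply ex_RInt_continuous_on. intros z Hz.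
    rewrite Rmin_left, Rmax_right in Hz by lra. apply Hc; lra. }
  rewrite <- (RInt_Chasles_R f a s b), <- (RInt_Chasles_R f s t b) by (apply Hex; lra).
  pose proof (RInt_nonneg f a s Has ltac:(apply Hex; lra) ltac:(intros; apply Hpos; lra)).
  pose proof (RInt_nonneg f t b Htb ltac:(apply Hex; lra) ltac:(intros; apply Hpos; lra)).
  pose proof (RInt_ge_const f s t m Hst ltac:(apply Hex; lra) Hm). lra.
Qed.
End RealIntegrals.

Lemma filterlim_at_left_p_infty (f : R -> R) a b : a < b ->
  (forall x y, a <= x <= y -> y < b -> f x <= f y) ->
  (forall K, exists x, a <= x < b /\ K < f x) ->
  filterlim f (at_left b) (Rbar_locally p_infty).
Proof.
  intros Hab Hmono Hunb P [K HK]. destruct (Hunb K) as [x [Hx HKx]].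
  assert (Hd : 0 < b - x) by lra. exists (mkposreal _ Hd). intros y Hy Hyb.
  change (Rabs (y - b) < b - x) in Hy. apply Rabs_def2 in Hy.
  apply HK. apply Rlt_le_trans with (f x); auto. apply Hmono; lra.
Qed.

Lemma Rinv_self_le x : 1 <= x -> 0 < / x <= x.
Proof.
  intros Hx. split; [apply Rinv_0_lt_compat; lra|].
  apply Rle_trans with 1; [|exact Hx]. rewrite <- Rinv_1. apply Rinv_le_contravar; lra.
Qed.

Lemma pow_add_le x d n : 0 <= x -> 0 <= d -> (x + d) ^ n <= 2 ^ n * (x ^ n + d ^ n).
Proof.
  intros Hx Hd.
  assert (Hp : forall z, 0 <= z -> 0 <= z ^ n) by (intros; now apply pow_le).
  destruct (Rle_dec x d).
  - apply Rle_trans with ((2 * d) ^ n); [apply pow_incr; lra|]. rewrite Rpow_mult_distr.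
    apply Rmult_le_compat_l; [apply Hp; lra|]. pose proof (Hp x Hx). lra.
  - apply Rle_trans with ((2 * x) ^ n); [apply pow_incr; lra|]. rewrite Rpow_mult_distr.
    apply Rmult_le_compat_l; [apply Hp; lra|]. pose proof (Hp d Hd). lra.
Qed.

Lemma exp_le x y : x <= y -> exp x <= exp y.
Proof. intros [H| ->]; [left; now apply exp_increasing|apply Rle_refl]. Qed.

Lemma Rabs_cos_le x : Rabs (cos x) <= 1.
Proof. apply Rabs_le, COS_bound. Qed.

Lemma Rabs_sin_le x : Rabs (sin x) <= 1.
Proof. apply Rabs_le, SIN_bound. Qed.

Lemma Rabs_cos_minus_1_le x : Rabs (cos x - 1) <= 2.
Proof. apply Rabs_le. pose proof (COS_bound x). lra. Qed.

Lemma Rabs_sin_le_id x : 0 <= x -> Rabs (sin x) <= x.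
Proof.
  intros Hx.
  pose proof (increment_le_of_derive_le sin cos (fun y => y) (fun _ => 1) 0 x Hx) as H.
  rewrite sin_0, !Rminus_0_r in H. apply H; intros.
  - apply is_derive_sin.
  - apply (is_derive_id x0).
  - apply Rabs_cos_le.
Qed.

Lemma sin_INR_mult_PI k : sin (INR k * PI) = 0.
Proof. apply sin_eq_0_1. exists (Z.of_nat k). now rewrite <- INR_IZR_INZ. Qed.

Lemma PI_gt_3 : 3 < PI.
Proof. pose proof PI2_3_2. lra. Qed.

Lemma PI_inv_lt : 0 < / PI < / 3.
Proof.
  pose proof PI_gt_3. split; [apply Rinv_0_lt_compat; lra|apply Rinv_lt_contravar; lra].
Qed.

Definition step_count (h t : R) : nat := Z.to_nat (Int_part (t / h)).

Lemma step_count_spec h t : 0 < h -> 0 <= t ->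
  INR (step_count h t) * h <= t < (INR (step_count h t) + 1) * h.
Proof.
  intros Hh Ht. unfold step_count. destruct (base_Int_part (t / h)) as [Hle Hlt].
  assert (Hpos : (0 <= Int_part (t / h))%Z).
  { assert (0 <= t / h) by (apply Rdiv_le_0_compat; auto).
    assert (Hm1 : -1 < IZR (Int_part (t / h))) by lra. apply lt_IZR in Hm1. lia. }
  rewrite INR_IZR_INZ, Z2Nat.id by auto.
  replace t with (t / h * h) at 2 3 by (field; lra). split.
  - apply Rmult_le_compat_r; lra.
  - apply Rmult_lt_compat_r; lra.
Qed.

Lemma step_count_nonpos h t : 0 < h -> t <= 0 -> step_count h t = O.
Proof.
  intros Hh Ht. unfold step_count. destruct (base_Int_part (t / h)) as [Hle _].
  assert (Hneg : t / h <= 0).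
  { assert (0 < / h) by (apply Rinv_0_lt_compat; auto). unfold Rdiv; nra. }
  assert (Hz : IZR (Int_part (t / h)) <= 0) by lra. apply le_IZR in Hz.
  destruct (Int_part (t / h)); auto. lia.
Qed.

Lemma le_step_count h t n : 0 < h -> 0 <= t -> INR n * h <= t -> (n <= step_count h t)%nat.
Proof.
  intros Hh Ht Hn. destruct (step_count_spec h t Hh Ht).
  assert (Hlt : INR n < INR (S (step_count h t))).
  { rewrite S_INR. apply Rmult_lt_reg_r with h; lra. }
  apply INR_lt in Hlt. lia.
Qed.

Lemma step_count_le h t t' : 0 < h -> 0 <= t -> t <= t' -> (step_count h t <= step_count h t')%nat.
Proof.
  intros Hh Ht Htt. apply le_step_count; auto; [lra|]. destruct (step_count_spec h t Hh Ht); lra.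
Qed.

(** * Partial sums and dominated series *)

Fixpoint psum (f : nat -> R) (n : nat) : R :=
  match n with O => 0 | S m => psum f m + f m end.

Lemma psum_S f n : psum f (S n) = psum f n + f n.
Proof. reflexivity. Qed.

Lemma psum_ext f h n : (forall k, (k < n)%nat -> f k = h k) -> psum f n = psum h n.
Proof.
  induction n; simpl; intros H; auto.
  rewrite IHn; [rewrite H; auto|]. intros; apply H; lia.
Qed.

Lemma psum_plus f h n : psum (fun k => f k + h k) n = psum f n + psum h n.
Proof. induction n; simpl; [ring|]. rewrite IHn; ring. Qed.

Lemma psum_minus f h n : psum (fun k => f k - h k) n = psum f n - psum h n.
Proof. induction n; simpl; [ring|]. rewrite IHn; ring. Qed.

Lemma psum_scal c f n : psum (fun k => c * f k) n = c * psum f n.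
Proof. induction n; simpl; [ring|]. rewrite IHn; ring. Qed.

Lemma psum_le f h n : (forall k, (k < n)%nat -> f k <= h k) -> psum f n <= psum h n.
Proof.
  induction n; simpl; intros H; [lra|].
  apply Rplus_le_compat; [apply IHn; intros; apply H; lia|apply H; lia].
Qed.

Lemma psum_const c n : psum (fun _ => c) n = INR n * c.
Proof. induction n; [simpl; ring|]. rewrite S_INR; simpl; rewrite IHn; ring. Qed.

Lemma psum_0 f n : (forall k, (k < n)%nat -> f k = 0) -> psum f n = 0.
Proof. intros H. rewrite (psum_ext f (fun _ => 0)), psum_const by exact H. ring. Qed.

Lemma psum_nonneg f n : (forall k, (k < n)%nat -> 0 <= f k) -> 0 <= psum f n.
Proof. intros H. rewrite <- (psum_0 (fun _ => 0) n) by auto. now apply psum_le. Qed.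

Lemma psum_Rabs f n : Rabs (psum f n) <= psum (fun k => Rabs (f k)) n.
Proof.
  induction n; simpl; [rewrite Rabs_R0; lra|].
  eapply Rle_trans; [apply Rabs_triang|]. lra.
Qed.

Lemma psum_split f n m : psum f (n + m) = psum f n + psum (fun k => f (n + k)%nat) m.
Proof.
  induction m; simpl.
  - rewrite Nat.add_0_r; ring.
  - rewrite Nat.add_succ_r; simpl. rewrite IHm; ring.
Qed.

Lemma psum_le_psum f n m : (n <= m)%nat -> (forall k, (k < m)%nat -> 0 <= f k) ->
  psum f n <= psum f m.
Proof.
  intros Hnm H. replace m with (n + (m - n))%nat by lia. rewrite psum_split.
  assert (0 <= psum (fun k => f (n + k)%nat) (m - n)); [|lra].
  apply psum_nonneg; intros; apply H; lia.
Qed.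

Lemma psum_ge_term f n k : (k < n)%nat -> (forall i, (i < n)%nat -> 0 <= f i) -> f k <= psum f n.
Proof.
  intros Hk H. apply Rle_trans with (psum f (S k)); [|now apply psum_le_psum].
  rewrite psum_S. assert (0 <= psum f k); [|lra]. apply psum_nonneg; intros; apply H; lia.
Qed.

Lemma psum_swap (f : nat -> nat -> R) n m :
  psum (fun i => psum (fun j => f i j) m) n = psum (fun j => psum (fun i => f i j) n) m.
Proof.
  induction n; simpl.
  - symmetry; now apply psum_0.
  - rewrite IHn, psum_plus; reflexivity.
Qed.

Lemma psum_head f n : psum f (S n) = f O + psum (fun k => f (S k)) n.
Proof.
  induction n; [simpl; ring|]. rewrite psum_S, IHn. simpl. ring.
Qed.

Lemma psum_rev f n : psum (fun k => f (n - k)%nat) n = psum (fun k => f (S k)) n.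
Proof.
  induction n; [reflexivity|].
  rewrite psum_head, Nat.sub_0_r. simpl (psum (fun k => f (S k)) (S n)).
  rewrite <- IHn, Rplus_comm. reflexivity.
Qed.

Lemma psum_indicator j x n : (j < n)%nat -> psum (fun k => if Nat.eq_dec k j then x else 0) n = x.
Proof.
  intros Hj. induction Hj as [|n Hj IH]; rewrite psum_S.
  - rewrite psum_0; [destruct (Nat.eq_dec j j); [ring|lia]|].
    intros k Hk. destruct (Nat.eq_dec k j); [lia|auto].
  - rewrite IH. destruct (Nat.eq_dec n j); [lia|ring].
Qed.

Lemma sum_n_psum f n : sum_n f n = psum f (S n).
Proof.
  induction n.
  - rewrite sum_O; simpl. symmetry; apply Rplus_0_l.
  - rewrite sum_Sn, IHn; reflexivity.
Qed.

Lemma is_series_psum f (l : R) : is_series f l <-> is_lim_seq (psum f) l.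
Proof.
  split; intros H.
  - apply is_lim_seq_incr_1. apply is_lim_seq_ext with (sum_n f); [|exact H].
    intros; apply sum_n_psum.
  - apply is_lim_seq_incr_1 in H. apply (is_lim_seq_ext _ (sum_n f)) in H; [exact H|].
    intros; symmetry; apply sum_n_psum.
Qed.

Lemma is_series_finite f n : (forall k, (n <= k)%nat -> f k = 0) -> is_series f (psum f n).
Proof.
  intros H. apply is_series_psum.
  apply is_lim_seq_ext_loc with (fun _ => psum f n); [|apply is_lim_seq_const].
  exists n. intros i Hi. replace i with (n + (i - n))%nat by lia.
  rewrite psum_split, (psum_0 (fun k => f (n + k)%nat)); [ring|]. intros; apply H; lia.
Qed.

Lemma ex_series_Rscal c (f : nat -> R) : ex_series f -> ex_series (fun k => c * f k).
Proof. apply (ex_series_scal_l c f). Qed.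

Lemma Series_split a n : ex_series a -> Series a = psum a n + Series (fun k => a (n + k)%nat).
Proof.
  intros H. induction n; simpl.
  - rewrite Rplus_0_l. apply Series_ext; auto.
  - rewrite IHn, (Series_incr_1 (fun k => a (n + k)%nat)).
    + rewrite Nat.add_0_r, Rplus_assoc. do 2 f_equal. apply Series_ext. intros k; f_equal; lia.
    + now apply ex_series_incr_n.
Qed.

Lemma ex_series_dominated (a A : nat -> R) :
  ex_series A -> (forall k, Rabs (a k) <= A k) -> ex_series a.
Proof. intros HA H. now apply (ex_series_le a A). Qed.

Lemma Rabs_Series_le (a A : nat -> R) : ex_series A -> (forall k, Rabs (a k) <= A k) ->
  Rabs (Series a) <= Series A.
Proof.
  intros HA H. eapply Rle_trans.
  - apply Series_Rabs. apply (ex_series_dominated _ A); auto. intros; now rewrite Rabs_Rabsolu.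
  - apply Series_le; auto. intros k; split; [apply Rabs_pos|auto].
Qed.

Lemma Series_tail_le (a A : nat -> R) n : ex_series A -> (forall k, Rabs (a k) <= A k) ->
  Rabs (Series a - psum a n) <= Series A - psum A n.
Proof.
  intros HA H. assert (Ha : ex_series a) by now apply ex_series_dominated with A.
  rewrite (Series_split a n Ha), (Series_split A n HA).
  replace (psum a n + _ - psum a n) with (Series (fun k => a (n + k)%nat)) by ring.
  replace (psum A n + _ - psum A n) with (Series (fun k => A (n + k)%nat)) by ring.
  apply Rabs_Series_le; auto. now apply (ex_series_incr_n A n).
Qed.

Lemma Series_tail_small A eps : ex_series A -> 0 < eps ->
  exists n0, forall n, (n0 <= n)%nat -> Series A - psum A n < eps.
Proof.
  intros HA He. assert (H := proj1 (is_series_psum _ _) (Series_correct _ HA)).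
  apply is_lim_seq_spec in H. destruct (H (mkposreal _ He)) as [n Hn].
  exists n. intros m Hm. specialize (Hn m Hm). simpl in Hn. apply Rabs_def2 in Hn. lra.
Qed.

Lemma psum_le_Series A n : ex_series A -> (forall k, 0 <= A k) -> psum A n <= Series A.
Proof.
  intros HA H. pose proof (Series_tail_le (fun k => A k) A n HA) as Ht.
  pose proof (Rabs_pos (Series (fun k => A k) - psum (fun k => A k) n)).
  assert (0 <= Series A - psum A n); [|lra].
  eapply Rle_trans; [|apply Ht]; auto. intros; rewrite Rabs_pos_eq; auto; lra.
Qed.

Lemma Series_nonneg A : ex_series A -> (forall k, 0 <= A k) -> 0 <= Series A.
Proof. apply (psum_le_Series A 0). Qed.

Lemma Series_psum_swap (f : nat -> nat -> R) n : (forall j, ex_series (f j)) ->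
  is_series (fun k => psum (fun j => f j k) n) (psum (fun j => Series (f j)) n).
Proof.
  intros H. induction n; simpl.
  - apply (is_series_finite (fun _ => 0) 0). auto.
  - apply (is_series_plus _ (f n)); [exact IHn|]. now apply Series_correct.
Qed.

Lemma filterlim_psum {T} (F : (T -> Prop) -> Prop) {FF : Filter F} (h : T -> nat -> R)
  (l : nat -> R) n : (forall k, filterlim (fun z => h z k) F (locally (l k))) ->
  filterlim (fun z => psum (h z) n) F (locally (psum l n)).
Proof.
  intros H. induction n; simpl; [apply filterlim_Rconst|]. now apply filterlim_Rplus.
Qed.

(* Tannery's theorem along an arbitrary filter: continuity, differentiation and passage to
   ultralimits under a series sign are all instances of it. *)
Lemma filterlim_Series {T} (F : (T -> Prop) -> Prop) {FF : Filter F}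
  (h : T -> nat -> R) (l A : nat -> R) :
  ex_series A -> F (fun z => forall k, Rabs (h z k) <= A k) ->
  (forall k, Rabs (l k) <= A k) ->
  (forall k, filterlim (fun z => h z k) F (locally (l k))) ->
  filterlim (fun z => Series (h z)) F (locally (Series l)).
Proof.
  intros HA Hh Hl Hlim. apply filterlim_R_eps. intros eps He.
  destruct (Series_tail_small A (eps / 3) HA) as [n Hn]; [lra|].
  specialize (Hn n (le_n n)).
  pose proof (filterlim_psum F h l n Hlim) as Hpsum. rewrite filterlim_R_eps in Hpsum.
  assert (He3 : 0 < eps / 3) by lra.
  generalize (filter_and _ _ Hh (Hpsum _ He3)). apply filter_imp. intros z [Hz Hzn].
  pose proof (Series_tail_le (h z) A n HA Hz).
  pose proof (Series_tail_le l A n HA Hl).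
  replace (Series (h z) - Series l) with
    ((Series (h z) - psum (h z) n) + (psum (h z) n - psum l n) - (Series l - psum l n)) by ring.
  eapply Rle_lt_trans; [apply Rabs_triang|]. rewrite Rabs_Ropp.
  eapply Rle_lt_trans; [apply Rplus_le_compat_r, Rabs_triang|]. lra.
Qed.

Lemma Series_swap (f : nat -> nat -> R) (A B : nat -> R) : ex_series A -> ex_series B ->
  (forall j, 0 <= A j) -> (forall k, 0 <= B k) -> (forall j k, Rabs (f j k) <= A j * B k) ->
  Series (fun k => Series (fun j => f j k)) = Series (fun j => Series (f j)).
Proof.
  intros HA HB HA0 HB0 Hf.
  assert (Hrow : forall j, ex_series (f j)).
  { intros j. apply ex_series_dominated with (fun k => A j * B k); auto.
    now apply ex_series_Rscal. }
  assert (HAk : forall k, ex_series (fun j => A j * B k))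
    by (intros; now apply (ex_series_scal_r (B k) A)).
  assert (Hrows : is_lim_seq (psum (fun j => Series (f j)))
    (Series (fun k => Series (fun j => f j k)))).
  { apply is_lim_seq_ext with (fun n => Series (fun k => psum (fun j => f j k) n)).
    { intros n. now apply is_series_unique, Series_psum_swap. }
    apply (filterlim_Series eventually _ _ (fun k => Series A * B k)).
    - now apply ex_series_Rscal.
    - exists O. intros n _ k. eapply Rle_trans; [apply psum_Rabs|].
      apply Rle_trans with (psum (fun j => B k * A j) n).
      + apply psum_le. intros j _. rewrite Rmult_comm. auto.
      + rewrite psum_scal, Rmult_comm. apply Rmult_le_compat_r; auto. now apply psum_le_Series.
    - intros k. rewrite <- Series_scal_r. now apply Rabs_Series_le.
    - intros k. apply is_series_psum, Series_correct.
      apply ex_series_dominated with (fun j => A j * B k); auto. }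
  symmetry. now apply is_series_unique, is_series_psum.
Qed.

Lemma is_derive_Series (f f' : R -> nat -> R) (A : nat -> R) (t d : R) :
  0 < d -> ex_series A ->
  (forall s k, Rabs (s - t) < d -> is_derive (fun s => f s k) s (f' s k)) ->
  (forall s k, Rabs (s - t) < d -> Rabs (f' s k) <= A k) ->
  (forall s, Rabs (s - t) < d -> ex_series (f s)) ->
  is_derive (fun s => Series (f s)) t (Series (f' t)).
Proof.
  intros Hd HA Hder Hb Hex. apply is_derive_diff_quotient.
  assert (FF : Filter (within (fun z : R => z <> 0) (locally 0)))
    by apply within_filter, locally_filter.
  assert (Ht : Rabs (t - t) < d) by now rewrite Rminus_diag, Rabs_R0.
  assert (Hnear : locally 0 (fun z => Rabs z < d)).
  { exists (mkposreal _ Hd). intros z Hz. change (Rabs (z - 0) < d) in Hz.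
    now rewrite Rminus_0_r in Hz. }
  apply filterlim_ext_loc with (fun z => Series (fun k => (f (t + z) k - f t k) / z)).
  - unfold within. revert Hnear. apply filter_imp. intros z Hz _.
    rewrite <- Series_minus; [|apply Hex; now rewrite Rplus_minus_l|now apply Hex].
    unfold Rdiv. now rewrite <- Series_scal_r.
  - apply (filterlim_Series _ (fun z k => (f (t + z) k - f t k) / z) (f' t) A); auto.
    + unfold within. revert Hnear. apply filter_imp. intros z Hz Hz0 k.
      apply (diff_quotient_le (fun s => f s k) (fun s => f' s k)); auto;
        intros x Hx; [apply Hder|apply Hb]; lra.
    + intros k. apply (is_derive_diff_quotient (fun s => f s k)). now apply Hder.
Qed.

Lemma is_RInt_psum (f : nat -> R -> R) a b n : (forall k, ex_RInt (f k) a b) ->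
  is_RInt (fun x => psum (fun k => f k x) n) a b (psum (fun k => RInt (f k) a b) n).
Proof.
  intros H. induction n; simpl; [apply is_RInt_0|].
  apply is_RInt_Rplus; [exact IHn|now apply is_RInt_of_ex].
Qed.

Lemma is_RInt_Series (f : nat -> R -> R) (A : nat -> R) a b :
  a <= b -> ex_series A ->
  (forall k, ex_RInt (f k) a b) ->
  (forall k x, a <= x <= b -> Rabs (f k x) <= A k) ->
  is_RInt (fun x => Series (fun k => f k x)) a b (Series (fun k => RInt (f k) a b)).
Proof.
  intros Hab HA Hex Hb.
  (* [filterlim_RInt] needs uniform convergence on the whole line. *)
  pose (clip x := Rmax a (Rmin x b)).
  assert (Hclip : forall x, a <= clip x <= b).
  { intros x; unfold clip, Rmax, Rmin. destruct (Rle_dec x b); destruct (Rle_dec a _); lra. }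
  assert (Hid : forall x, Rmin a b < x < Rmax a b -> clip x = x).
  { intros x Hx. rewrite Rmin_left, Rmax_right in Hx by exact Hab.
    unfold clip, Rmax, Rmin. destruct (Rle_dec x b); destruct (Rle_dec a _); lra. }
  destruct (filterlim_RInt (fun n x => psum (fun k => f k (clip x)) n) a b eventually _
     (fun x => Series (fun k => f k (clip x))) (fun n => psum (fun k => RInt (f k) a b) n))
    as [l [Hl HI]].
  - intros n. eapply is_RInt_ext; [|apply is_RInt_psum; auto].
    intros x Hx. apply psum_ext; intros; now rewrite Hid.
  - apply filterlim_locally. intros eps.
    destruct (Series_tail_small A eps HA (cond_pos eps)) as [n0 Hn0].
    exists n0. intros n Hn x.
    change (Rabs (psum (fun k => f k (clip x)) n - Series (fun k => f k (clip x))) < eps).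
    rewrite Rabs_minus_sym. eapply Rle_lt_trans; [|apply (Hn0 n Hn)].
    apply Series_tail_le; auto.
  - rewrite (is_series_unique _ _ (proj2 (is_series_psum _ _) Hl)).
    eapply is_RInt_ext; [|apply HI]. intros x Hx. apply Series_ext; intros; now rewrite Hid.
Qed.

(** * Rapidly decreasing sequences *)

Definition bracket (k : nat) : R := INR k + 1.

(* A summable majorant of [/ bracket k ^ 2] whose partial sums telescope. *)
Definition weight (k : nat) : R := 2 / (bracket k * (bracket k + 1)).

Lemma bracket_ge_1 k : 1 <= bracket k.
Proof. unfold bracket. pose proof (pos_INR k); lra. Qed.

Lemma INR_le_bracket k : 0 <= INR k <= bracket k.
Proof. unfold bracket; pose proof (pos_INR k); lra. Qed.

Lemma bracket_pow_ge_1 s k : 1 <= bracket k ^ s.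
Proof. apply pow_R1_Rle, bracket_ge_1. Qed.

Lemma is_lim_seq_inv_shift nu : is_lim_seq (fun n => / (nu + INR n)) 0.
Proof.
  apply (is_lim_seq_inv (fun n => nu + INR n) p_infty); [|discriminate].
  apply (is_lim_seq_plus (fun _ => nu) INR nu p_infty);
    [apply is_lim_seq_const|apply is_lim_seq_INR|reflexivity].
Qed.

Lemma is_lim_seq_inv_bracket : is_lim_seq (fun n => / bracket n) 0.
Proof.
  apply is_lim_seq_ext with (fun n => / (1 + INR n)); [|apply is_lim_seq_inv_shift].
  intros n. unfold bracket. now rewrite Rplus_comm.
Qed.

Lemma is_series_telescope nu : 0 < nu ->
  is_series (fun k => / ((nu + INR k) * (nu + INR k + 1))) (/ nu).
Proof.
  intros Hnu. apply is_series_psum.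
  apply is_lim_seq_ext with (fun n => / nu - / (nu + INR n)).
  - induction n.
    + simpl. rewrite Rplus_0_r. ring.
    + rewrite psum_S, <- IHn, S_INR. pose proof (pos_INR n). field. lra.
  - replace (Finite (/ nu)) with (Finite (/ nu - 0)) by (f_equal; ring).
    apply is_lim_seq_minus'; [apply is_lim_seq_const|apply is_lim_seq_inv_shift].
Qed.

Lemma is_series_weight A : is_series (fun k => A * weight k) (2 * A).
Proof.
  assert (E : forall k, 2 * A * / ((1 + INR k) * (1 + INR k + 1)) = A * weight k).
  { intros k. unfold weight, bracket. rewrite (Rplus_comm 1). unfold Rdiv. ring. }
  replace (2 * A) with (2 * A * / 1) by field.
  apply (is_series_ext _ _ _ E), (is_series_scal_l (2 * A) _ (/ 1)), is_series_telescope. lra.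
Qed.

Lemma ex_series_weight A : ex_series (fun k => A * weight k).
Proof. exists (2 * A). apply is_series_weight. Qed.

Lemma Series_weight A : Series (fun k => A * weight k) = 2 * A.
Proof. apply is_series_unique, is_series_weight. Qed.

Lemma weight_pos k : 0 < weight k.
Proof. unfold weight. pose proof (bracket_ge_1 k). apply Rdiv_lt_0_compat; nra. Qed.

Lemma psum_weight_le A n : 0 <= A -> psum (fun k => A * weight k) n <= 2 * A.
Proof.
  intros HA. rewrite <- Series_weight. apply psum_le_Series; [apply ex_series_weight|].
  intros k; pose proof (weight_pos k); nra.
Qed.

Lemma inv_bracket_sq_le_weight k : / bracket k ^ 2 <= weight k.
Proof.
  unfold weight. pose proof (bracket_ge_1 k).
  apply Rmult_le_reg_r with (bracket k ^ 2 * (bracket k + 1)); [nra|].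
  field_simplify; nra.
Qed.

Lemma le_weight x A k : bracket k ^ 2 * x <= A -> 0 <= A -> x <= A * weight k.
Proof.
  intros Hx HA. assert (Hq : 0 < bracket k ^ 2) by (pose proof (bracket_ge_1 k); nra).
  apply Rle_trans with (A * / bracket k ^ 2).
  - apply Rmult_le_reg_r with (bracket k ^ 2); [exact Hq|].
    rewrite Rmult_assoc, Rinv_l by lra. lra.
  - apply Rmult_le_compat_l; [exact HA|apply inv_bracket_sq_le_weight].
Qed.

Definition decay (s : nat) (A : R) (c : nat -> R) : Prop :=
  forall k, bracket k ^ s * Rabs (c k) <= A.
Definition rapid (c : nat -> R) : Prop := forall s, exists A, decay s A c.

Lemma bracket_pow_Rabs_nonneg s (c : nat -> R) k : 0 <= bracket k ^ s * Rabs (c k).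
Proof.
  apply Rmult_le_pos; [pose proof (bracket_pow_ge_1 s k); lra|apply Rabs_pos].
Qed.

Lemma decay_nonneg s A c : decay s A c -> 0 <= A.
Proof. intros H. eapply Rle_trans; [|apply (H O)]. apply bracket_pow_Rabs_nonneg. Qed.

Lemma decay_le s s' A A' c : (s' <= s)%nat -> A <= A' -> decay s A c -> decay s' A' c.
Proof.
  intros Hs HA H k. eapply Rle_trans; [|exact HA]. eapply Rle_trans; [|apply (H k)].
  apply Rmult_le_compat_r; [apply Rabs_pos|]. apply Rle_pow; auto. apply bracket_ge_1.
Qed.

Lemma decay_Rabs_le s A c k : decay s A c -> Rabs (c k) <= A.
Proof.
  intros H. rewrite <- (Rmult_1_l (Rabs (c k))).
  apply (decay_le s 0 A A c); auto; [lia|lra].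
Qed.

Lemma decay_weight s A c : decay (s + 2) A c ->
  forall k, bracket k ^ s * Rabs (c k) <= A * weight k.
Proof.
  intros H k. apply le_weight; [|eapply decay_nonneg; eauto].
  specialize (H k). rewrite pow_add in H. lra.
Qed.

Lemma decay_2_weight A c : decay 2 A c -> forall k, Rabs (c k) <= A * weight k.
Proof. intros H k. rewrite <- (Rmult_1_l (Rabs (c k))). now apply (decay_weight 0). Qed.

Lemma decay_2_ex_series A c : decay 2 A c -> ex_series c.
Proof.
  intros H. apply ex_series_dominated with (fun k => A * weight k); [apply ex_series_weight|].
  now apply decay_2_weight.
Qed.

Lemma decay_2_Series_le A c : decay 2 A c -> Rabs (Series c) <= 2 * A.
Proof.
  intros H. rewrite <- Series_weight. apply Rabs_Series_le; [apply ex_series_weight|].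
  now apply decay_2_weight.
Qed.

Lemma rapid_ex_series c : rapid c -> ex_series c.
Proof. intros H. destruct (H 2%nat) as [A HA]. now apply decay_2_ex_series with A. Qed.

Lemma decay_ext s A c d : (forall k, c k = d k) -> decay s A c -> decay s A d.
Proof. intros E H k. rewrite <- E. apply H. Qed.

Lemma decay_plus s A A' c d : decay s A c -> decay s A' d -> decay s (A + A') (fun k => c k + d k).
Proof.
  intros H H' k. specialize (H k); specialize (H' k). pose proof (bracket_pow_ge_1 s k).
  pose proof (Rabs_triang (c k) (d k)).
  apply Rle_trans with (bracket k ^ s * (Rabs (c k) + Rabs (d k))); [|lra].
  apply Rmult_le_compat_l; lra.
Qed.

Lemma decay_mult s A M e c : (forall k, Rabs (e k) <= M) -> decay s A c ->
  decay s (M * A) (fun k => e k * c k).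
Proof.
  intros He Hc k. rewrite Rabs_mult.
  replace (bracket k ^ s * (Rabs (e k) * Rabs (c k))) with
    (Rabs (e k) * (bracket k ^ s * Rabs (c k))) by ring.
  apply Rmult_le_compat; auto; [apply Rabs_pos|apply bracket_pow_Rabs_nonneg].
Qed.

Lemma decay_mult_r s A M e c : (forall k, Rabs (e k) <= M) -> decay s A c ->
  decay s (M * A) (fun k => c k * e k).
Proof.
  intros He Hc. apply decay_ext with (fun k => e k * c k); [intros; ring|]. now apply decay_mult.
Qed.

Lemma decay_mult_le_1 s A e c : (forall k, Rabs (e k) <= 1) -> decay s A c ->
  decay s A (fun k => c k * e k).
Proof. intros He Hc. rewrite <- (Rmult_1_l A). now apply decay_mult_r. Qed.

Lemma decay_scal s A e c : decay s A c -> decay s (Rabs e * A) (fun k => e * c k).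
Proof. intros H. apply decay_mult; auto. intros; lra. Qed.

Lemma decay_INR_mult s A c : decay (S s) A c -> decay s A (fun k => INR k * c k).
Proof.
  intros H k. eapply Rle_trans; [|apply (H k)]. pose proof (INR_le_bracket k).
  rewrite Rabs_mult, (Rabs_pos_eq (INR k)) by lra. simpl pow.
  replace (bracket k ^ s * (INR k * Rabs (c k))) with
    (INR k * (bracket k ^ s * Rabs (c k))) by ring.
  rewrite Rmult_assoc. apply Rmult_le_compat_r; [apply bracket_pow_Rabs_nonneg|lra].
Qed.

Lemma decay_INR_pow_mult s n A c : decay (n + s) A c -> decay s A (fun k => INR k ^ n * c k).
Proof.
  revert s. induction n; intros s H.
  - apply decay_ext with c; [intros; simpl; ring|exact H].
  - apply decay_ext with (fun k => INR k * (INR k ^ n * c k)); [intros; simpl; ring|].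
    apply decay_INR_mult, IHn. now rewrite Nat.add_succ_r.
Qed.

Lemma rapid_INR_mult c : rapid c -> rapid (fun k => INR k * c k).
Proof. intros H s. destruct (H (S s)) as [A HA]. exists A. now apply decay_INR_mult. Qed.

Lemma rapid_INR_pow_mult n c : rapid c -> rapid (fun k => INR k ^ n * c k).
Proof. intros H s. destruct (H (n + s)%nat) as [A HA]. exists A. now apply decay_INR_pow_mult. Qed.

Lemma rapid_mult e c M : (forall k, Rabs (e k) <= M) -> rapid c -> rapid (fun k => e k * c k).
Proof. intros He H s. destruct (H s) as [A HA]. exists (M * A). now apply decay_mult. Qed.

Lemma is_RInt_Series_decay (a : nat -> R) (e : nat -> R -> R) (l : nat -> R) A M s t :
  s <= t -> decay 2 A a -> (forall k x, s <= x <= t -> Rabs (e k x) <= M) ->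
  (forall k, is_RInt (e k) s t (l k)) ->
  is_RInt (fun x => Series (fun k => a k * e k x)) s t (Series (fun k => a k * l k)).
Proof.
  intros Hst Ha He Hl.
  assert (Hterm : forall k, is_RInt (fun x => a k * e k x) s t (a k * l k))
    by (intros; now apply is_RInt_Rscal).
  rewrite (Series_ext _ (fun k => RInt (fun x => a k * e k x) s t))
    by (intros; symmetry; apply is_RInt_unique, Hterm).
  apply is_RInt_Series with (fun k => A * M * weight k); auto.
  - apply ex_series_weight.
  - intros k. eexists. apply Hterm.
  - intros k x Hx. rewrite Rabs_mult. pose proof (decay_2_weight A a Ha k).
    replace (A * M * weight k) with (A * weight k * M) by ring.
    apply Rmult_le_compat; auto using Rabs_pos.
Qed.

(** * Energy estimate for one Euler step *)

Definition ndist (k j : nat) : nat := ((j - k) + (k - j))%nat.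

Lemma ndist_sym k j : ndist k j = ndist j k.
Proof. unfold ndist; lia. Qed.

Lemma INR_ndist k j : INR (ndist k j) = Rabs (INR j - INR k).
Proof.
  unfold ndist. destruct (Nat.le_gt_cases k j) as [H|H].
  - replace (j - k + (k - j))%nat with (j - k)%nat by lia.
    rewrite minus_INR by auto. apply le_INR in H. rewrite Rabs_pos_eq; lra.
  - replace (j - k + (k - j))%nat with (k - j)%nat by lia.
    rewrite minus_INR by lia. apply lt_INR in H. rewrite Rabs_left; lra.
Qed.

Lemma INR_le_ndist k j : INR k <= INR j + INR (ndist k j).
Proof. unfold ndist. rewrite <- plus_INR. apply le_INR. lia. Qed.

Lemma psum_ndist_le x N k : (k < N)%nat -> (forall i, 0 <= x i) ->
  psum (fun j => x (ndist k j)) N <= 2 * psum x N.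
Proof.
  intros Hk Hx. replace N with (k + (N - k))%nat at 1 by lia. rewrite psum_split.
  assert (Hbelow : psum (fun j => x (ndist k j)) k <= psum x N).
  { rewrite (psum_ext _ (fun j => x (k - j)%nat)) by (intros; unfold ndist; f_equal; lia).
    rewrite psum_rev. apply Rle_trans with (psum x (S k)).
    - rewrite psum_head. pose proof (Hx O). lra.
    - now apply psum_le_psum. }
  assert (Habove : psum (fun j => x (ndist k (k + j))) (N - k) <= psum x N).
  { rewrite (psum_ext _ x) by (intros; unfold ndist; f_equal; lia).
    apply psum_le_psum; auto; lia. }
  lra.
Qed.

Lemma psum_shift_le x N j : (forall i, 0 <= x i) -> (forall i, (N <= i)%nat -> x i = 0) ->
  psum (fun k => x (j + k)%nat) N <= psum x N.
Proof.
  intros Hx Hzero. pose proof (psum_split x j N) as Hsplit.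
  rewrite Nat.add_comm, psum_split in Hsplit.
  rewrite (psum_0 (fun k => x (N + k)%nat)) in Hsplit by (intros; apply Hzero; lia).
  assert (0 <= psum x j) by (apply psum_nonneg; auto). lra.
Qed.

Lemma Rmult_le_half_sum_sq x y : x * y <= / 2 * (x ^ 2 + y ^ 2).
Proof. pose proof (pow2_ge_0 (x - y)). lra. Qed.

Section Young.
Variables (N : nat) (al be : nat -> R).
Hypothesis be_nonneg : forall i, 0 <= be i.

Let E := psum (fun k => al k ^ 2) N.
Let W := psum be N.

Lemma psum_bilinear_le (l : nat -> nat -> nat) (C : R) :
  (forall k, (k < N)%nat -> psum (fun j => al (l k j) ^ 2) N <= C * E) ->
  psum (fun k => psum (fun j => be k * (al (l k j) * al j)) N) N <= / 2 * (C + 1) * W * E.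
Proof.
  intros H. apply Rle_trans with (psum (fun k => / 2 * (C + 1) * E * be k) N).
  - apply psum_le. intros k Hk. rewrite psum_scal, (Rmult_comm _ (be k)).
    apply Rmult_le_compat_l; auto.
    apply Rle_trans with (psum (fun j => / 2 * (al (l k j) ^ 2 + al j ^ 2)) N).
    + apply psum_le. intros; apply Rmult_le_half_sum_sq.
    + rewrite psum_scal, psum_plus. specialize (H k Hk). fold E. lra.
  - rewrite psum_scal. fold W. right; ring.
Qed.

Lemma psum_bilinear_ndist_le :
  psum (fun k => psum (fun j => be k * (al (ndist k j) * al j)) N) N <= 3 / 2 * W * E.
Proof.
  replace (3 / 2) with (/ 2 * (2 + 1)) by field. apply psum_bilinear_le.
  intros k Hk. apply (psum_ndist_le (fun i => al i ^ 2)); auto. intros; apply pow2_ge_0.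
Qed.

Lemma psum_bilinear_add_le : (forall i, (N <= i)%nat -> al i = 0) ->
  psum (fun k => psum (fun j => be k * (al (k + j)%nat * al j)) N) N <= W * E.
Proof.
  intros alN. replace (W * E) with (/ 2 * (1 + 1) * W * E) by field. apply psum_bilinear_le.
  intros k Hk. rewrite Rmult_1_l. apply (psum_shift_le (fun i => al i ^ 2)).
  - intros; apply pow2_ge_0.
  - intros i Hi. rewrite alN; auto. ring.
Qed.

Lemma psum_convolution_le :
  psum (fun k => psum (fun j => be (ndist k j) * (al k * al j)) N) N <= 2 * W * E.
Proof.
  assert (Hsq : psum (fun k => psum (fun j => / 2 * (be (ndist k j) * al k ^ 2)) N) N <= W * E).
  { apply Rle_trans with (psum (fun k => W * al k ^ 2) N).
    - apply psum_le. intros k Hk. rewrite psum_scal.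
      rewrite (psum_ext _ (fun j => al k ^ 2 * be (ndist k j))) by (intros; ring).
      rewrite psum_scal.
      pose proof (psum_ndist_le be N k Hk be_nonneg) as Hd. fold W in Hd.
      pose proof (pow2_ge_0 (al k)). nra.
    - rewrite psum_scal. fold E. lra. }
  apply Rle_trans with (psum (fun k => psum (fun j => / 2 * (be (ndist k j) * al k ^ 2)
    + / 2 * (be (ndist k j) * al j ^ 2)) N) N).
  - apply psum_le; intros; apply psum_le; intros j Hj.
    pose proof (Rmult_le_half_sum_sq (al k) (al j)). pose proof (be_nonneg (ndist k j)). nra.
  - rewrite (psum_ext _ (fun k => psum (fun j => / 2 * (be (ndist k j) * al k ^ 2)) N
      + psum (fun j => / 2 * (be (ndist k j) * al j ^ 2)) N)) by (intros; apply psum_plus).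
    rewrite psum_plus, (psum_swap (fun k j => / 2 * (be (ndist k j) * al j ^ 2))).
    rewrite (psum_ext (fun j => psum (fun i => / 2 * (be (ndist i j) * al j ^ 2)) N)
      (fun k => psum (fun j => / 2 * (be (ndist k j) * al k ^ 2)) N)); [lra|].
    intros; apply psum_ext; intros. now rewrite ndist_sym.
Qed.
End Young.

Lemma psum_antisym (f P : nat -> nat -> R) N : (forall k j, P j k = - P k j) ->
  psum (fun k => psum (fun j => f k j * P k j) N) N =
  / 2 * psum (fun k => psum (fun j => (f k j - f j k) * P k j) N) N.
Proof.
  intros HP. set (S := psum (fun k => psum (fun j => f k j * P k j) N) N).
  assert (Hneg : psum (fun k => psum (fun j => f j k * P k j) N) N = - S).
  { rewrite psum_swap. replace (- S) with (-1 * S) by ring. unfold S. rewrite <- psum_scal.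
    apply psum_ext; intros k _. rewrite <- psum_scal.
    apply psum_ext; intros j _. rewrite (HP k j). ring. }
  rewrite (psum_ext _ (fun k => psum (fun j => f k j * P k j) N - psum (fun j => f j k * P k j) N)).
  - rewrite psum_minus, Hneg. fold S. field.
  - intros k _. rewrite <- psum_minus. apply psum_ext; intros; ring.
Qed.

Lemma pow_succ_diff_le x y n : 0 <= x <= y -> y ^ S n - x ^ S n <= INR (S n) * (y - x) * y ^ n.
Proof.
  intros H. induction n; [simpl; lra|].
  rewrite S_INR.
  replace (y ^ S (S n) - x ^ S (S n)) with (x * (y ^ S n - x ^ S n) + (y - x) * y ^ S n)
    by (simpl; ring).
  assert (Hyn : 0 <= y ^ n) by (apply pow_le; lra). pose proof (pos_INR (S n)).
  assert (x * (y ^ S n - x ^ S n) <= x * (INR (S n) * (y - x) * y ^ n))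
    by (apply Rmult_le_compat_l; lra).
  assert (x * (INR (S n) * (y - x) * y ^ n) <= y * (INR (S n) * (y - x) * y ^ n)).
  { apply Rmult_le_compat_r; [|lra]. repeat apply Rmult_le_pos; lra. }
  simpl pow in *. lra.
Qed.

Definition commutator_const (r : nat) : R := INR (S (2 * r)) * 2 ^ r.

Lemma commutator_const_nonneg r : 0 <= commutator_const r.
Proof. apply Rmult_le_pos; [apply pos_INR|apply pow_le; lra]. Qed.

Lemma commutator_le_ordered x y r : 0 <= x <= y ->
  0 <= y ^ (2 * S r) * x - x ^ (2 * S r) * y <=
  commutator_const r * ((y - x) * (x ^ S r * y ^ S r) + (y - x) ^ S r * (x * y ^ S r)).
Proof.
  intros H.
  replace (y ^ (2 * S r) * x - x ^ (2 * S r) * y) with (x * y * (y ^ S (2 * r) - x ^ S (2 * r))).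
  2: { replace (2 * S r)%nat with (S (S (2 * r))) by lia. simpl. ring. }
  assert (Hmean := pow_succ_diff_le x y (2 * r) H).
  assert (Hbin := pow_add_le x (y - x) r ltac:(lra) ltac:(lra)).
  replace (x + (y - x)) with y in Hbin by ring.
  assert (0 <= y ^ r) by (apply pow_le; lra).
  assert (0 <= INR (S (2 * r))) by apply pos_INR.
  assert (0 <= x * y) by nra.
  assert (x ^ S (2 * r) <= y ^ S (2 * r)) by (apply pow_incr; lra).
  split; [nra|].
  apply Rle_trans with (x * y * (INR (S (2 * r)) * (y - x) * y ^ (2 * r))).
  { now apply Rmult_le_compat_l. }
  replace (x * y * (INR (S (2 * r)) * (y - x) * y ^ (2 * r))) with
    ((x * y * INR (S (2 * r)) * (y - x) * y ^ r) * y ^ r).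
  2: { replace (2 * r)%nat with (r + r)%nat by lia. rewrite pow_add. ring. }
  apply Rle_trans with
    ((x * y * INR (S (2 * r)) * (y - x) * y ^ r) * (2 ^ r * (x ^ r + (y - x) ^ r))).
  { apply Rmult_le_compat_l; auto. repeat apply Rmult_le_pos; auto; lra. }
  right. unfold commutator_const. simpl pow. ring.
Qed.

Lemma commutator_le x y r : 0 <= x -> 0 <= y ->
  Rabs (x ^ (2 * S r) * y - y ^ (2 * S r) * x) <=
  commutator_const r * (Rabs (y - x) * (x ^ S r * y ^ S r) + Rabs (y - x) ^ S r * (x * y ^ S r)
            + Rabs (y - x) ^ S r * (x ^ S r * y)).
Proof.
  intros Hx Hy. pose proof (commutator_const_nonneg r) as HC.
  assert (Hp : forall z, 0 <= z -> 0 <= z ^ S r) by (intros; apply pow_le; auto).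
  destruct (Rle_dec x y) as [Hxy|Hxy].
  - rewrite (Rabs_pos_eq (y - x)) by lra.
    destruct (commutator_le_ordered x y r ltac:(lra)) as [Hpos Hle]. rewrite Rabs_left1 by lra.
    assert (0 <= (y - x) ^ S r * (x ^ S r * y)).
    { apply Rmult_le_pos; [apply Hp; lra|]. apply Rmult_le_pos; auto. }
    nra.
  - rewrite (Rabs_left1 (y - x)) by lra. replace (- (y - x)) with (x - y) by ring.
    destruct (commutator_le_ordered y x r ltac:(lra)) as [Hpos Hle]. rewrite Rabs_right by lra.
    assert (0 <= (x - y) ^ S r * (x * y ^ S r)).
    { apply Rmult_le_pos; [apply Hp; lra|]. apply Rmult_le_pos; auto. }
    nra.
Qed.

Definition moment (s : nat) (c : nat -> R) (k : nat) : R := INR k ^ s * Rabs (c k).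
Definition energy (N s : nat) (c : nat -> R) : R := psum (fun k => moment s c k ^ 2) N.
Definition supported (N : nat) (c : nat -> R) : Prop :=
  c O = 0 /\ forall k, (N <= k)%nat -> c k = 0.

Lemma moment_nonneg s c k : 0 <= moment s c k.
Proof. apply Rmult_le_pos; [apply pow_le, pos_INR|apply Rabs_pos]. Qed.

Lemma moment_0 c k : moment 0 c k = Rabs (c k).
Proof. unfold moment. simpl. ring. Qed.

Lemma moment_supported s N c k : supported N c -> (N <= k)%nat -> moment s c k = 0.
Proof. intros [_ H] Hk. unfold moment. rewrite H, Rabs_R0; auto; ring. Qed.

Lemma moment_le_moment s s' c k : c O = 0 -> (s <= s')%nat -> moment s c k <= moment s' c k.
Proof.
  intros Hc0 Hs. unfold moment. destruct k as [|k].
  - rewrite Hc0, Rabs_R0. lra.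
  - apply Rmult_le_compat_r; [apply Rabs_pos|]. apply Rle_pow; auto.
    rewrite S_INR. pose proof (pos_INR k). lra.
Qed.

Lemma energy_nonneg N s c : 0 <= energy N s c.
Proof. apply psum_nonneg; intros; apply pow2_ge_0. Qed.

Lemma moment_le_sqrt_energy N s c k : supported N c -> moment s c k <= sqrt (energy N s c).
Proof.
  intros Hc. destruct (Nat.lt_ge_cases k N) as [Hk|Hk].
  - rewrite <- (sqrt_pow2 (moment s c k)) by apply moment_nonneg. apply sqrt_le_1_alt.
    apply (psum_ge_term (fun k => moment s c k ^ 2)); auto. intros; apply pow2_ge_0.
  - rewrite (moment_supported s N c k); auto. apply sqrt_pos.
Qed.

Lemma psum_moment_1_le N c : c O = 0 -> psum (moment 1 c) N <= 4 * (1 + energy N 2 c).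
Proof.
  intros Hc0. apply Rle_trans with (psum (fun k => / 2 * (4 * weight k + moment 2 c k ^ 2)) N).
  - apply psum_le; intros k _. unfold moment. pose proof (weight_pos k).
    destruct k as [|k]; [rewrite Hc0, Rabs_R0; simpl INR; nra|].
    set (x := INR (S k)). set (y := Rabs (c (S k))).
    assert (Hx : 1 <= x) by (unfold x; rewrite S_INR; pose proof (pos_INR k); lra).
    assert (Hinv : / x ^ 2 <= 4 * weight (S k)).
    { pose proof (inv_bracket_sq_le_weight (S k)) as Hw. unfold bracket in Hw. fold x in Hw.
      apply Rle_trans with (4 * / (x + 1) ^ 2); [|lra].
      apply Rmult_le_reg_r with (x ^ 2 * (x + 1) ^ 2); [nra|].
      replace (/ x ^ 2 * (x ^ 2 * (x + 1) ^ 2)) with ((x + 1) ^ 2) by (field; lra).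
      replace (4 * / (x + 1) ^ 2 * (x ^ 2 * (x + 1) ^ 2)) with (4 * x ^ 2) by (field; lra). nra. }
    pose proof (pow2_ge_0 (/ x - x ^ 2 * y)) as Hsq.
    replace ((/ x - x ^ 2 * y) ^ 2) with (/ x ^ 2 + (x ^ 2 * y) ^ 2 - 2 * (x ^ 1 * y)) in Hsq
      by (field; lra).
    lra.
  - rewrite psum_scal, psum_plus. fold (energy N 2 c). pose proof (psum_weight_le 4 N ltac:(lra)).
    pose proof (energy_nonneg N 2 c). lra.
Qed.

Lemma decay_of_energy N s c E : supported N c -> energy N s c <= E -> decay s (2 ^ s * sqrt E) c.
Proof.
  intros Hc HE k. apply Rle_trans with (2 ^ s * moment s c k).
  - unfold moment. rewrite <- Rmult_assoc, <- Rpow_mult_distr. destruct k as [|k].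
    + rewrite (proj1 Hc), Rabs_R0. lra.
    + apply Rmult_le_compat_r; [apply Rabs_pos|]. apply pow_incr. unfold bracket. rewrite S_INR.
      pose proof (pos_INR k). lra.
  - apply Rmult_le_compat_l; [apply pow_le; lra|].
    eapply Rle_trans; [now apply (moment_le_sqrt_energy N)|]. now apply sqrt_le_1_alt.
Qed.

Section TransportModes.
Variables (g : R) (m : nat -> R).
Hypothesis g_pos : 0 < g.
Hypothesis m_le : forall k, Rabs (m k) <= 2.

(* With [u = sum m_i d_i sin ix] and [rho = sum c_j cos jx], the [cos kx]-mode of [u * rho_x] is
   [- / 2 * sum_j j c_j (mode_kernel d k j)].  The part [mode_kernel_anti] is antisymmetric in
   [k] and [j], which is what removes the top order term from the energies. *)
Definition mode_kernel_anti (d : nat -> R) (k j : nat) : R :=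
  if le_dec k j then m (j - k) * d (j - k)%nat else - (m (k - j) * d (k - j)%nat).
Definition mode_kernel (d : nat -> R) (k j : nat) : R :=
  m (j + k) * d (j + k)%nat + mode_kernel_anti d k j.

Definition transport_trunc (N : nat) (c d : nat -> R) (k : nat) : R :=
  if andb (Nat.leb 1 k) (Nat.ltb k N)
  then g / 2 * psum (fun j => INR j * c j * mode_kernel d k j) N else 0.

Lemma Rabs_multiplier_le d i : Rabs (m i * d i) <= 2 * Rabs (d i).
Proof. rewrite Rabs_mult. apply Rmult_le_compat_r; [apply Rabs_pos|auto]. Qed.

Lemma mode_kernel_anti_le d k j : Rabs (mode_kernel_anti d k j) <= 2 * Rabs (d (ndist k j)).
Proof.
  unfold mode_kernel_anti. destruct (le_dec k j).
  - replace (ndist k j) with (j - k)%nat by (unfold ndist; lia). apply Rabs_multiplier_le.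
  - rewrite Rabs_Ropp. replace (ndist k j) with (k - j)%nat by (unfold ndist; lia).
    apply Rabs_multiplier_le.
Qed.

Lemma mode_kernel_le d k j :
  Rabs (mode_kernel d k j) <= 2 * (Rabs (d (j + k)%nat) + Rabs (d (ndist k j))).
Proof.
  unfold mode_kernel. eapply Rle_trans; [apply Rabs_triang|].
  pose proof (Rabs_multiplier_le d (j + k)). pose proof (mode_kernel_anti_le d k j). lra.
Qed.

Lemma mode_kernel_antisym d k j : d O = 0 -> mode_kernel_anti d j k = - mode_kernel_anti d k j.
Proof.
  intros Hd0. unfold mode_kernel_anti. destruct (le_dec k j), (le_dec j k); try lia; try ring.
  replace (k - j)%nat with O by lia. replace (j - k)%nat with O by lia. rewrite Hd0; ring.
Qed.

Lemma mode_kernel_minus c d k j :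
  mode_kernel (fun i => c i - d i) k j = mode_kernel c k j - mode_kernel d k j.
Proof. unfold mode_kernel, mode_kernel_anti. destruct (le_dec k j); ring. Qed.

Lemma transport_trunc_supported N c d : supported N (transport_trunc N c d).
Proof.
  split; [reflexivity|]. intros k Hk. unfold transport_trunc.
  rewrite (proj2 (Nat.ltb_ge k N) Hk), Bool.andb_false_r. reflexivity.
Qed.

Lemma transport_trunc_eq N c d k : (1 <= k < N)%nat ->
  transport_trunc N c d k = g / 2 * psum (fun j => INR j * c j * mode_kernel d k j) N.
Proof.
  intros [Hk1 HN]. unfold transport_trunc. apply Nat.leb_le in Hk1. apply Nat.ltb_lt in HN.
  now rewrite Hk1, HN.
Qed.

Lemma transport_trunc_Rabs_le N c d k :
  Rabs (transport_trunc N c d k) <=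
  g / 2 * psum (fun j => Rabs (INR j * c j * mode_kernel d k j)) N.
Proof.
  unfold transport_trunc. destruct (andb _ _).
  - rewrite Rabs_mult, (Rabs_pos_eq (g / 2)) by lra.
    apply Rmult_le_compat_l; [lra|apply psum_Rabs].
  - rewrite Rabs_R0. apply Rmult_le_pos; [lra|]. apply psum_nonneg; intros; apply Rabs_pos.
Qed.

Lemma transport_trunc_minus N c c' k :
  transport_trunc N c' c' k - transport_trunc N c c k =
  transport_trunc N (fun i => c' i - c i) c' k + transport_trunc N c (fun i => c' i - c i) k.
Proof.
  unfold transport_trunc. destruct (andb _ _); [|ring].
  rewrite <- Rmult_minus_distr_l, <- Rmult_plus_distr_l, <- psum_minus, <- psum_plus. f_equal.
  apply psum_ext; intros. rewrite mode_kernel_minus. ring.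
Qed.

Section OneStep.
Variables (N : nat) (c : nat -> R).
Hypothesis c_supported : supported N c.

Let W := psum (moment 1 c) N.
Let pair (s k j : nat) := INR k ^ (2 * s) * INR j * (c k * c j).

Lemma energy_pairing_split s :
  psum (fun k => INR k ^ (2 * s) * c k * transport_trunc N c c k) N =
  g / 2 * (psum (fun k => psum (fun j => pair s k j * (m (j + k) * c (j + k)%nat)) N) N
     + psum (fun k => psum (fun j => pair s k j * mode_kernel_anti c k j) N) N).
Proof.
  rewrite <- psum_plus, <- psum_scal. apply psum_ext. intros k Hk. rewrite <- psum_plus.
  destruct k as [|k].
  - rewrite (psum_0 (fun j => _ + _)), (proj1 c_supported); [ring|].
    intros. unfold pair. rewrite (proj1 c_supported). ring.
  - rewrite transport_trunc_eq by lia.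
    rewrite (psum_ext (fun j => pair s (S k) j * _ + _)
      (fun j => INR (S k) ^ (2 * s) * c (S k) * (INR j * c j * mode_kernel c (S k) j)))
      by (intros; unfold pair, mode_kernel; ring).
    rewrite psum_scal. ring.
Qed.

Lemma Rabs_pair s k j : Rabs (pair s k j) = INR k ^ s * moment 1 c j * moment s c k.
Proof.
  unfold pair, moment. rewrite !Rabs_mult.
  rewrite (Rabs_pos_eq (INR k ^ _)), (Rabs_pos_eq (INR j)) by (try apply pow_le; apply pos_INR).
  replace (2 * s)%nat with (s + s)%nat by lia. rewrite pow_add. ring.
Qed.

Lemma pairing_add_le s :
  Rabs (psum (fun k => psum (fun j => pair s k j * (m (j + k) * c (j + k)%nat)) N) N)
  <= 2 * (W * energy N s c).
Proof.
  pose proof (psum_bilinear_add_le N (moment s c) (moment 1 c) (moment_nonneg 1 c)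
    (fun i => moment_supported s N c i c_supported)) as HY.
  fold W in HY. fold (energy N s c) in HY. rewrite psum_swap in HY.
  eapply Rle_trans; [|apply Rmult_le_compat_l; [lra|exact HY]].
  rewrite <- psum_scal. eapply Rle_trans; [apply psum_Rabs|]. apply psum_le; intros k _.
  rewrite <- psum_scal. eapply Rle_trans; [apply psum_Rabs|]. apply psum_le; intros j _.
  rewrite Rabs_mult, Rabs_pair.
  pose proof (moment_nonneg 1 c j) as Hj. pose proof (moment_nonneg s c k) as Hk.
  assert (Hks : 0 <= INR k ^ s) by apply pow_le, pos_INR.
  apply Rle_trans with (INR k ^ s * moment 1 c j * moment s c k * (2 * Rabs (c (j + k)%nat))).
  { apply Rmult_le_compat_l; [|apply Rabs_multiplier_le].
    apply Rmult_le_pos; [now apply Rmult_le_pos|exact Hk]. }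
  assert (Hle : INR k ^ s <= INR (j + k) ^ s).
  { apply pow_incr. split; [apply pos_INR|]. apply le_INR. lia. }
  assert (Hprod : 0 <= moment 1 c j * moment s c k * Rabs (c (j + k)%nat)).
  { apply Rmult_le_pos; [now apply Rmult_le_pos|apply Rabs_pos]. }
  unfold moment at 4. nra.
Qed.

Lemma pairing_anti_le r :
  Rabs (psum (fun k => psum (fun j => pair (S r) k j * mode_kernel_anti c k j) N) N)
  <= 5 * commutator_const r * (W * energy N (S r) c).
Proof.
  set (al := moment (S r) c). set (be := moment 1 c). set (C := commutator_const r).
  rewrite psum_antisym by (intros; apply mode_kernel_antisym, (proj1 c_supported)).
  pose proof (psum_convolution_le N al be (moment_nonneg 1 c)) as Hconv.
  pose proof (psum_bilinear_ndist_le N al be (moment_nonneg 1 c)) as Hdist.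
  change (psum (fun k => al k ^ 2) N) with (energy N (S r) c) in Hconv, Hdist.
  change (psum be N) with W in Hconv, Hdist.
  pose proof (commutator_const_nonneg r) as HC. fold C in HC.
  rewrite Rabs_mult, Rabs_pos_eq by lra.
  apply Rle_trans with (/ 2 * psum (fun k => psum (fun j => 2 * C *
    (be (ndist k j) * (al k * al j) + be k * (al (ndist k j) * al j)
     + be j * (al (ndist j k) * al k))) N) N).
  - apply Rmult_le_compat_l; [lra|]. eapply Rle_trans; [apply psum_Rabs|].
    apply psum_le; intros k _.
    eapply Rle_trans; [apply psum_Rabs|]. apply psum_le; intros j _. rewrite Rabs_mult.
    replace (pair (S r) k j - pair (S r) j k) with
      ((INR k ^ (2 * S r) * INR j - INR j ^ (2 * S r) * INR k) * (c k * c j))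
        by (unfold pair; ring).
    pose proof (commutator_le (INR k) (INR j) r (pos_INR k) (pos_INR j)) as Hcom.
    rewrite <- INR_ndist in Hcom. rewrite Rabs_mult. eapply Rle_trans.
    { apply Rmult_le_compat; [apply Rmult_le_pos; apply Rabs_pos|apply Rabs_pos| |
        apply mode_kernel_anti_le].
      apply Rmult_le_compat_r; [apply Rabs_pos|exact Hcom]. }
    rewrite Rabs_mult, (ndist_sym j k). unfold al, be, C, moment. right. ring.
  - rewrite (psum_ext _ (fun k => 2 * C * (psum (fun j => be (ndist k j) * (al k * al j)) N
      + psum (fun j => be k * (al (ndist k j) * al j)) N
      + psum (fun j => be j * (al (ndist j k) * al k)) N)))
      by (intros; rewrite psum_scal, !psum_plus; reflexivity).
    rewrite psum_scal, !psum_plus, (psum_swap (fun k j => be j * (al (ndist j k) * al k))).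
    rewrite (Rmult_comm 5), (Rmult_assoc C), <- Rmult_assoc.
    replace (/ 2 * (2 * C)) with C by field. apply Rmult_le_compat_l; lra.
Qed.

Lemma energy_pairing_le r :
  Rabs (psum (fun k => INR k ^ (2 * S r) * c k * transport_trunc N c c k) N)
  <= g / 2 * (2 + 5 * commutator_const r) * W * energy N (S r) c.
Proof.
  rewrite energy_pairing_split, Rabs_mult, (Rabs_pos_eq (g / 2)) by lra.
  rewrite !Rmult_assoc. apply Rmult_le_compat_l; [lra|].
  eapply Rle_trans; [apply Rabs_triang|].
  pose proof (pairing_add_le (S r)). pose proof (pairing_anti_le r). lra.
Qed.

Let root (s : nat) := sqrt (energy N s c).

Lemma moment_le_root s k : 0 <= moment s c k <= root s.
Proof. split; [apply moment_nonneg|now apply moment_le_sqrt_energy]. Qed.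

Lemma low_moment_le_root s k : (s <= 2)%nat -> 0 <= moment s c k <= root 2.
Proof.
  intros Hs. split; [apply moment_nonneg|]. apply Rle_trans with (moment 2 c k).
  - apply moment_le_moment; [apply (proj1 c_supported)|exact Hs].
  - apply moment_le_root.
Qed.

Lemma moment_add_term_le s k j :
  moment 1 c j * (INR k ^ s * Rabs (c (j + k)%nat)) <= root s * root 2.
Proof.
  assert (Hadd : INR k ^ s * Rabs (c (j + k)%nat) <= moment s c (j + k)).
  { apply Rmult_le_compat_r; [apply Rabs_pos|]. apply pow_incr. split; [apply pos_INR|].
    apply le_INR. lia. }
  pose proof (moment_le_root s (j + k)). pose proof (low_moment_le_root 1 j ltac:(lia)).
  rewrite (Rmult_comm (root s)). apply Rmult_le_compat; try lra.
  apply Rmult_le_pos; [apply pow_le, pos_INR|apply Rabs_pos].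
Qed.

Lemma moment_ndist_term_le s k j : (j < N)%nat ->
  moment 1 c j * (INR k ^ s * Rabs (c (ndist k j)))
  <= 2 ^ s * (INR N * (root s * root 2) + root s * root 2).
Proof.
  intros Hj. pose proof (low_moment_le_root 1 j ltac:(lia)) as Hbj.
  pose proof (low_moment_le_root 0 (ndist k j) ltac:(lia)) as Hcd. rewrite moment_0 in Hcd.
  assert (Hdist : INR k ^ s <= 2 ^ s * (INR j ^ s + INR (ndist k j) ^ s)).
  { eapply Rle_trans; [|apply pow_add_le; apply pos_INR].
    apply pow_incr. split; [apply pos_INR|apply INR_le_ndist]. }
  apply Rle_trans with
    (moment 1 c j * (2 ^ s * (INR j ^ s + INR (ndist k j) ^ s) * Rabs (c (ndist k j)))).
  { apply Rmult_le_compat_l; [lra|]. apply Rmult_le_compat_r; [apply Rabs_pos|exact Hdist]. }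
  replace (moment 1 c j * (2 ^ s * (INR j ^ s + INR (ndist k j) ^ s) * Rabs (c (ndist k j))))
    with (2 ^ s * (INR j * (moment s c j * Rabs (c (ndist k j)))
                   + moment s c (ndist k j) * moment 1 c j)) by (unfold moment; ring).
  pose proof (moment_le_root s j). pose proof (moment_le_root s (ndist k j)).
  assert (HjN : 0 <= INR j <= INR N) by (split; [apply pos_INR|apply le_INR; lia]).
  apply Rmult_le_compat_l; [apply pow_le; lra|]. apply Rplus_le_compat.
  - apply Rmult_le_compat; try lra; [nra|]. apply Rmult_le_compat; lra.
  - apply Rmult_le_compat; lra.
Qed.

Lemma moment_transport_term_le s k j : (j < N)%nat ->
  INR k ^ s * Rabs (INR j * c j * mode_kernel c k j)
  <= 8 * 2 ^ s * INR N * (root s * root 2).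
Proof.
  intros Hj. pose proof (moment_add_term_le s k j) as Hadd.
  pose proof (moment_ndist_term_le s k j Hj) as Hdist.
  assert (Hef : 0 <= root s * root 2) by (apply Rmult_le_pos; apply sqrt_pos).
  assert (HN : 1 <= INR N) by (change 1 with (INR 1); apply le_INR; lia).
  assert (H2s : 1 <= 2 ^ s) by (apply pow_R1_Rle; lra).
  apply Rle_trans with (2 * (moment 1 c j * (INR k ^ s * Rabs (c (j + k)%nat))
    + moment 1 c j * (INR k ^ s * Rabs (c (ndist k j))))).
  - rewrite !Rabs_mult, (Rabs_pos_eq (INR j)) by apply pos_INR.
    replace (INR j * Rabs (c j)) with (moment 1 c j) by (unfold moment; ring).
    apply Rle_trans with (INR k ^ s * (moment 1 c j *
      (2 * (Rabs (c (j + k)%nat) + Rabs (c (ndist k j)))))); [|right; ring].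
    apply Rmult_le_compat_l; [apply pow_le, pos_INR|].
    apply Rmult_le_compat_l; [apply moment_nonneg|apply mode_kernel_le].
  - set (B := root s * root 2) in *. assert (B <= INR N * B) by nra.
    assert (INR N * B <= 2 ^ s * (INR N * B)) by nra.
    assert (2 ^ s * B <= 2 ^ s * (INR N * B)) by (apply Rmult_le_compat_l; lra).
    nra.
Qed.

Lemma moment_transport_trunc_le s k :
  moment s (transport_trunc N c c) k
  <= 4 * g * 2 ^ s * INR N ^ 2 * (root s * root 2).
Proof.
  set (B := root s * root 2).
  destruct (Nat.lt_ge_cases k N) as [Hk|Hk].
  - assert (Hsum : INR k ^ s * psum (fun j => Rabs (INR j * c j * mode_kernel c k j)) N
      <= INR N * (8 * 2 ^ s * INR N * B)).
    { rewrite <- psum_scal, <- psum_const. apply psum_le; intros j Hj.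
      now apply moment_transport_term_le. }
    assert (Hk0 : 0 <= INR k ^ s) by apply pow_le, pos_INR.
    unfold moment. eapply Rle_trans.
    { apply Rmult_le_compat_l; [exact Hk0|apply transport_trunc_Rabs_le]. }
    nra.
  - rewrite (moment_supported s N); auto; [|apply transport_trunc_supported].
    assert (0 <= 2 ^ s) by (apply pow_le; lra).
    repeat apply Rmult_le_pos; try apply sqrt_pos; try apply pos_INR; lra.
Qed.

(* This step size absorbs the derivative lost by the quadratic term of an Euler step on [N]
   modes. *)
Definition time_step : R := / bracket N ^ 5.

Lemma time_step_pos : 0 < time_step.
Proof. apply Rinv_0_lt_compat. pose proof (bracket_pow_ge_1 5 N). lra. Qed.

Lemma time_step_energy_transport_le s :
  time_step * energy N s (transport_trunc N c c)
  <= 16 * g ^ 2 * 4 ^ s * (energy N s c * energy N 2 c).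
Proof.
  pose proof time_step_pos as Hh. set (E := energy N s c). set (D := energy N 2 c).
  assert (HE : 0 <= E) by apply energy_nonneg. assert (HD : 0 <= D) by apply energy_nonneg.
  assert (0 <= 4 ^ s) by (apply pow_le; lra).
  apply Rle_trans with
    (time_step * psum (fun _ => (4 * g * 2 ^ s * INR N ^ 2 * (sqrt E * sqrt D)) ^ 2) N).
  { apply Rmult_le_compat_l; [lra|]. apply psum_le; intros k _. apply pow_incr.
    split; [apply moment_nonneg|apply moment_transport_trunc_le]. }
  rewrite psum_const.
  replace ((4 * g * 2 ^ s * INR N ^ 2 * (sqrt E * sqrt D)) ^ 2) with
    (16 * g ^ 2 * (2 ^ s) ^ 2 * INR N ^ 4 * (sqrt E ^ 2 * sqrt D ^ 2)) by ring.
  rewrite !pow2_sqrt by auto. rewrite <- pow_mult, Nat.mul_comm, pow_mult.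
  replace (2 ^ 2) with 4 by ring.
  replace (time_step * (INR N * (16 * g ^ 2 * 4 ^ s * INR N ^ 4 * (E * D)))) with
    ((time_step * INR N ^ 5) * (16 * g ^ 2 * 4 ^ s * (E * D))) by ring.
  rewrite <- (Rmult_1_l (16 * g ^ 2 * 4 ^ s * (E * D))) at 2. apply Rmult_le_compat_r.
  - repeat apply Rmult_le_pos; auto; lra.
  - unfold time_step. pose proof (bracket_pow_ge_1 5 N).
    apply Rmult_le_reg_l with (bracket N ^ 5); [lra|]. rewrite <- Rmult_assoc, Rinv_r by lra.
    rewrite Rmult_1_l, Rmult_1_r. apply pow_incr, INR_le_bracket.
Qed.

Definition energy_rate (r : nat) : R :=
  g * (2 + 5 * commutator_const r) * 4 + 16 * g ^ 2 * 4 ^ S r.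

Lemma energy_rate_nonneg r : 0 <= energy_rate r.
Proof.
  unfold energy_rate. pose proof (commutator_const_nonneg r).
  assert (0 <= 4 ^ S r) by (apply pow_le; lra). nra.
Qed.

Lemma energy_step_eq s h (F : nat -> R) :
  energy N s (fun k => c k + h * F k) =
  energy N s c + h * (2 * psum (fun k => INR k ^ (2 * s) * c k * F k) N) + h * (h * energy N s F).
Proof.
  unfold energy. rewrite <- !psum_scal, <- !psum_plus. apply psum_ext. intros k _. unfold moment.
  rewrite !Rpow_mult_distr, !pow2_abs, <- !pow_mult.
  replace (s * 2)%nat with (2 * s)%nat by lia. ring.
Qed.

Lemma energy_step_le r :
  energy N (S r) (fun k => c k + time_step * transport_trunc N c c k)
  <= energy N (S r) c * (1 + time_step * (energy_rate r * (1 + energy N 2 c))).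
Proof.
  rewrite energy_step_eq.
  pose proof (time_step_energy_transport_le (S r)) as Hquad.
  pose proof (energy_pairing_le r) as Hlin. apply Rabs_le_between in Hlin as [_ Hlin].
  pose proof (psum_moment_1_le N c (proj1 c_supported)) as HW. fold W in HW.
  pose proof time_step_pos as Hh. pose proof (commutator_const_nonneg r) as HC.
  pose proof (energy_nonneg N (S r) c) as HE. pose proof (energy_nonneg N 2 c) as HD.
  set (h := time_step) in *. set (E := energy N (S r) c) in *. set (D := energy N 2 c) in *.
  set (P := psum (fun k => _ * transport_trunc N c c k) N) in *.
  set (Q := energy N (S r) (transport_trunc N c c)) in *.
  assert (HWE : g / 2 * (2 + 5 * commutator_const r) * W * E
    <= g / 2 * (2 + 5 * commutator_const r) * (4 * (1 + D)) * E).
  { apply Rmult_le_compat_r; auto. apply Rmult_le_compat_l; auto. apply Rmult_le_pos; lra. }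
  assert (Hrate : 2 * P + h * Q <= energy_rate r * (1 + D) * E).
  { assert (0 <= 16 * g ^ 2 * 4 ^ S r * E).
    { repeat apply Rmult_le_pos; auto; try lra; apply pow_le; lra. }
    unfold energy_rate. lra. }
  apply Rmult_le_compat_l with (r := h) in Hrate; lra.
Qed.
End OneStep.
End TransportModes.

(** * Mode systems *)

Definition transport (g : R) (m c d : nat -> R) (k : nat) : R :=
  match k with
  | O => 0
  | S _ => g / 2 * Series (fun j => INR j * c j * mode_kernel m d k j)
  end.

Definition unif_rapid (Tm : R) (a : R -> nat -> R) : Prop :=
  forall T, T < Tm -> forall s, exists A, forall t, t <= T -> decay s A (a t).

(* [rho t x = sum_k c t k (cos kx - 1)] solves [rho_t + u rho_x = 0] on [0, Tm), where [u / g]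
   is the Fourier multiplier [cos kx -> m k sin kx] applied to [rho].  Times [t <= 0] carry the
   initial datum, so that no one-sided limits are needed at [t = 0]. *)
Record mode_solution (g : R) (m : nat -> R) (Tm : R) (c : R -> nat -> R) : Prop := {
  modes_unif_rapid : unif_rapid Tm c;
  modes_zero : forall t, t < Tm -> c t O = 0;
  modes_ode : forall t k, 0 < t < Tm ->
    is_derive (fun s => c s k) t (transport g m (c t) (c t) k);
  modes_lipschitz : forall T, T < Tm -> forall s, exists A, 0 <= A /\
    forall t t', t <= T -> t' <= T -> decay s (A * Rabs (t' - t)) (fun k => c t' k - c t k)
}.

Section TransportDecay.
Variables (g : R) (m : nat -> R).
Hypothesis g_pos : 0 < g.
Hypothesis m_le : forall k, Rabs (m k) <= 2.

Lemma decay_transport_term s A A' c d k j : decay (s + 3) A c -> decay s A' d ->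
  bracket k ^ s * Rabs (INR j * c j * mode_kernel m d k j) <= 8 * 2 ^ s * (A * A') * weight j.
Proof.
  intros Hc Hd. set (b := Rabs (INR j * c j)).
  assert (Hbs : bracket j ^ s * b <= A * weight j).
  { apply (decay_weight s A (fun j => INR j * c j)), decay_INR_mult.
    now replace (S (s + 2)) with (s + 3)%nat by lia. }
  assert (Hb : 0 <= b) by apply Rabs_pos.
  assert (Hbw : b <= A * weight j) by (pose proof (bracket_pow_ge_1 s j); nra).
  assert (0 <= 2 ^ s) by (apply pow_le; lra).
  assert (Hmode : forall l, bracket k <= bracket j + bracket l ->
    bracket k ^ s * (b * Rabs (d l)) <= 2 ^ s * (2 * (A * A' * weight j))).
  { intros l Hl. assert (Hk : bracket k ^ s <= 2 ^ s * (bracket j ^ s + bracket l ^ s)).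
    { pose proof (bracket_ge_1 j). pose proof (bracket_ge_1 l). pose proof (bracket_ge_1 k).
      eapply Rle_trans; [|apply pow_add_le; lra]. apply pow_incr; lra. }
    specialize (Hd l) as Hdl. pose proof (decay_Rabs_le _ _ _ l Hd) as Hd0.
    pose proof (Rabs_pos (d l)). pose proof (bracket_pow_Rabs_nonneg s d l).
    apply Rle_trans with (2 ^ s * (bracket j ^ s + bracket l ^ s) * (b * Rabs (d l))).
    { apply Rmult_le_compat_r; [now apply Rmult_le_pos|auto]. }
    rewrite Rmult_assoc. apply Rmult_le_compat_l; auto.
    assert ((bracket j ^ s * b) * Rabs (d l) <= (A * weight j) * A').
    { apply Rmult_le_compat; auto. pose proof (bracket_pow_ge_1 s j). nra. }
    assert (b * (bracket l ^ s * Rabs (d l)) <= (A * weight j) * A')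
      by (apply Rmult_le_compat; auto).
    lra. }
  rewrite Rabs_mult. fold b.
  apply Rle_trans with (bracket k ^ s * (b * (2 * (Rabs (d (j + k)%nat) + Rabs (d (ndist k j)))))).
  - apply Rmult_le_compat_l; [pose proof (bracket_pow_ge_1 s k); lra|].
    apply Rmult_le_compat_l; [exact Hb|now apply mode_kernel_le].
  - pose proof (INR_le_ndist k j) as Hkj. pose proof (pos_INR j).
    pose proof (Hmode (j + k)%nat ltac:(unfold bracket; rewrite plus_INR; lra)).
    pose proof (Hmode (ndist k j) ltac:(unfold bracket; lra)). lra.
Qed.

Lemma ex_series_transport A A' c d k : decay 3 A c -> decay 0 A' d ->
  ex_series (fun j => INR j * c j * mode_kernel m d k j).
Proof.
  intros Hc Hd. apply ex_series_dominated with (fun j => 8 * 2 ^ 0 * (A * A') * weight j).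
  - apply ex_series_weight.
  - intros j. rewrite <- (Rmult_1_l (Rabs _)). now apply (decay_transport_term 0).
Qed.

Lemma decay_transport_trunc N s A A' c d : decay (s + 3) A c -> decay s A' d ->
  decay s (8 * 2 ^ s * g * (A * A')) (transport_trunc g m N c d).
Proof.
  intros Hc Hd k. pose proof (decay_nonneg _ _ _ Hc). pose proof (decay_nonneg _ _ _ Hd).
  assert (HC : 0 <= 8 * 2 ^ s * (A * A')).
  { assert (0 <= 2 ^ s) by (apply pow_le; lra). assert (0 <= A * A') by nra. nra. }
  pose proof (bracket_pow_ge_1 s k).
  assert (Hsum : bracket k ^ s * psum (fun j => Rabs (INR j * c j * mode_kernel m d k j)) N
    <= 2 * (8 * 2 ^ s * (A * A'))).
  { eapply Rle_trans; [|apply (psum_weight_le _ N HC)].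
    rewrite <- psum_scal. apply psum_le. intros; now apply decay_transport_term. }
  eapply Rle_trans; [apply Rmult_le_compat_l; [lra|now apply transport_trunc_Rabs_le]|].
  nra.
Qed.

Lemma decay_transport s A A' c d : decay (s + 3) A c -> decay s A' d ->
  decay s (8 * 2 ^ s * g * (A * A')) (transport g m c d).
Proof.
  intros Hc Hd k. pose proof (decay_nonneg _ _ _ Hc). pose proof (decay_nonneg _ _ _ Hd).
  assert (HC : 0 <= 8 * 2 ^ s * g * (A * A')).
  { assert (0 <= 2 ^ s) by (apply pow_le; lra). assert (0 <= A * A') by nra.
    repeat apply Rmult_le_pos; auto; lra. }
  pose proof (bracket_pow_ge_1 s k).
  destruct k as [|k]; unfold transport; [rewrite Rabs_R0; lra|].
  assert (Hser : Rabs (Series (fun j => bracket (S k) ^ s *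
    (INR j * c j * mode_kernel m d (S k) j))) <= 2 * (8 * 2 ^ s * (A * A'))).
  { rewrite <- Series_weight. apply Rabs_Series_le; [apply ex_series_weight|].
    intros j. rewrite Rabs_mult, Rabs_pos_eq by lra. now apply decay_transport_term. }
  rewrite Series_scal_l, Rabs_mult, Rabs_pos_eq in Hser by lra.
  rewrite Rabs_mult, (Rabs_pos_eq (g / 2)) by lra. nra.
Qed.

Lemma rapid_transport c : rapid c -> rapid (transport g m c c).
Proof.
  intros Hc s. destruct (Hc (s + 3)%nat) as [A HA]. exists (8 * 2 ^ s * g * (A * A)).
  apply decay_transport; auto. apply (decay_le (s + 3) s A A); auto; [lia|lra].
Qed.

Lemma unif_rapid_transport Tm a b : unif_rapid Tm a -> unif_rapid Tm b ->
  unif_rapid Tm (fun t => transport g m (a t) (b t)).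
Proof.
  intros Ha Hb T HT s. destruct (Ha T HT (s + 3)%nat) as [A HA]. destruct (Hb T HT s) as [B HB].
  exists (8 * 2 ^ s * g * (A * B)). intros t Ht. apply decay_transport; auto.
Qed.

Lemma transport_trunc_eq_transport N c k : supported N c -> (1 <= k < N)%nat ->
  transport_trunc g m N c c k = transport g m c c k.
Proof.
  intros Hc Hk. rewrite transport_trunc_eq by auto. destruct k; [lia|]. unfold transport. f_equal.
  symmetry. apply is_series_unique, is_series_finite. intros j Hj. rewrite (proj2 Hc) by lia. ring.
Qed.
End TransportDecay.

Lemma unif_rapid_at Tm a t : unif_rapid Tm a -> t < Tm -> rapid (a t).
Proof. intros Ha Ht s. destruct (Ha t Ht s) as [A HA]. exists A. apply HA; lra. Qed.

Lemma unif_rapid_near Tm a t s : unif_rapid Tm a -> t < Tm ->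
  exists d A, 0 < d /\ forall t', Rabs (t' - t) < d -> t' < Tm /\ decay s A (a t').
Proof.
  intros Ha Ht. destruct (Ha ((t + Tm) / 2) ltac:(lra) s) as [A HA].
  exists ((Tm - t) / 2), A. split; [lra|]. intros t' Ht'. apply Rabs_def2 in Ht'.
  split; [lra|]. apply HA; lra.
Qed.

Lemma unif_rapid_plus Tm a b : unif_rapid Tm a -> unif_rapid Tm b ->
  unif_rapid Tm (fun t k => a t k + b t k).
Proof.
  intros Ha Hb T HT s. destruct (Ha T HT s) as [A HA]. destruct (Hb T HT s) as [B HB].
  exists (A + B). intros t Ht. apply decay_plus; auto.
Qed.

Lemma unif_rapid_INR_mult Tm a : unif_rapid Tm a -> unif_rapid Tm (fun t k => INR k * a t k).
Proof.
  intros Ha T HT s. destruct (Ha T HT (S s)) as [A HA]. exists A.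
  intros t Ht. apply decay_INR_mult; auto.
Qed.

(** * Ultralimit of the Galerkin schemes *)

Record free_ultra (U : (nat -> Prop) -> Prop) : Prop := {
  free_ultra_proper : ProperFilter U;
  free_ultra_large : forall n, U (fun N => (n <= N)%nat);
  free_ultra_dichotomy : forall P, U P \/ U (fun N => ~ P N)
}.

Lemma free_ultra_exists : exists U, free_ultra U.
Proof.
  assert (FE : @filter.ProperFilter nat eventually).
  { constructor.
    - intros [n Hn]. exact (Hn n (le_n n)).
    - constructor.
      + exists 0%nat. intros; exact Logic.I.
      + intros P Q HP HQ. exact (filter_and _ _ HP HQ).
      + intros P Q HPQ [n Hn]. exists n. intros k Hk. apply HPQ. auto. }
  destruct (filter.ultraFilterLemma FE) as [U [HU HEU]].
  destruct (filter.ultra_proper (F:=U)) as [P0 [PT PI PS]].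
  exists U. split; [split; [|split]| |].
  - intros P HP. apply NNPP. intros Hn. apply P0.
    apply (PS P). 2: exact HP. intros x Hx. apply Hn. exists x. exact Hx.
  - exact PT.
  - intros P Q HP HQ. exact (PI P Q HP HQ).
  - intros P Q HPQ HP. exact (PS P Q HPQ HP).
  - intros n. apply HEU. exists n. auto.
  - intros P. destruct (filter.in_ultra_setVsetC (F:=U) P) as [H|H]; auto.
Qed.

Definition ultralim (U : (nat -> Prop) -> Prop) (x : nat -> R) : R :=
  real (Lub_Rbar (fun y => U (fun N => y <= x N))).

Lemma ultralim_correct U x M : free_ultra U -> U (fun N => Rabs (x N) <= M) ->
  filterlim x U (locally (ultralim U x)).
Proof.
  intros HU HM. pose proof (free_ultra_proper U HU) as UF.
  unfold ultralim. set (S := fun y => U (fun N => y <= x N)).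
  destruct (Lub_Rbar_correct S) as [Hub Hlub].
  assert (Hlow : S (- M)).
  { unfold S. revert HM. apply filter_imp. intros N HN. apply Rabs_le_between in HN. lra. }
  assert (Hup : Rbar_le (Lub_Rbar S) M).
  { apply Hlub. intros y Hy. destruct (filter_ex _ (filter_and _ _ Hy HM)) as [N [HyN HN]].
    apply Rabs_le_between in HN. simpl. lra. }
  specialize (Hub (- M) Hlow) as Hge.
  destruct (Lub_Rbar S) as [l| |]; simpl in *; try contradiction.
  apply filterlim_R_eps. intros eps He.
  assert (Hbelow : U (fun N => l - eps / 2 <= x N)).
  { apply NNPP. intros Hn. assert (Hl : Rbar_le l (l - eps / 2)); [|simpl in Hl; lra].
    apply (Hlub (Finite (l - eps / 2))). intros y Hy. simpl. apply Rnot_lt_le. intros Hlt.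
    apply Hn. revert Hy. unfold S. apply filter_imp. intros; lra. }
  assert (Habove : U (fun N => ~ (l + eps / 2 <= x N))).
  { destruct (free_ultra_dichotomy U HU (fun N => l + eps / 2 <= x N)) as [H|H]; auto.
    specialize (Hub (l + eps / 2) H). simpl in Hub. lra. }
  generalize (filter_and _ _ Hbelow Habove). apply filter_imp. intros N [Hlo Hhi].
  apply Rabs_def1; lra.
Qed.

Lemma Rinv_riccati_step e e' z : 0 <= e -> 0 <= e' -> 0 <= z -> e' <= e * (1 + z * (1 + e)) ->
  / (1 + e) - z <= / (1 + e').
Proof.
  intros He He' Hz Hstep. assert (Hpos : 0 < 1 + z * (1 + e)) by nra.
  apply Rle_trans with (/ ((1 + e) * (1 + z * (1 + e)))); [|apply Rinv_le_contravar; nra].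
  apply Rmult_le_reg_r with ((1 + e) * (1 + z * (1 + e))); [nra|].
  rewrite Rinv_l by nra.
  replace ((/ (1 + e) - z) * ((1 + e) * (1 + z * (1 + e)))) with
    ((1 - z * (1 + e)) * (1 + z * (1 + e))) by (field; lra).
  pose proof (pow2_ge_0 (z * (1 + e))). nra.
Qed.

Lemma is_derive_of_taylor (f f' : R -> R) (t T A : R) : 0 < t < T -> 0 <= A ->
  (forall s s', 0 <= s -> s <= s' -> s' <= T ->
    Rabs (f s' - f s - (s' - s) * f' s) <= A * (s' - s) ^ 2 /\
    Rabs (f' s' - f' s) <= A * (s' - s)) ->
  is_derive f t (f' t).
Proof.
  intros Ht HA Htaylor. apply is_derive_Reals. intros eps He.
  assert (Hd : 0 < Rmin (Rmin t (T - t)) (eps / (2 * A + 1))).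
  { repeat apply Rmin_pos; try lra. apply Rdiv_lt_0_compat; lra. }
  exists (mkposreal _ Hd). intros h Hh0 Hh. simpl in Hh.
  pose proof (Rmin_l (Rmin t (T - t)) (eps / (2 * A + 1))).
  pose proof (Rmin_r (Rmin t (T - t)) (eps / (2 * A + 1))) as Hr.
  pose proof (Rmin_l t (T - t)). pose proof (Rmin_r t (T - t)).
  assert (Hsmall : Rabs h * (2 * A + 1) < eps).
  { apply Rlt_le_trans with (eps / (2 * A + 1) * (2 * A + 1)).
    - apply Rmult_lt_compat_r; lra.
    - right; field; lra. }
  assert (Hhp : 0 < Rabs h) by (apply Rabs_pos_lt; auto).
  assert (Hht : Rabs h < Rmin t (T - t)) by lra.
  assert (Hrange : - Rmin t (T - t) < h < Rmin t (T - t)) by (apply Rabs_def2 in Hht; lra).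
  assert (Hquad : Rabs (f (t + h) - f t - h * f' t) <= 2 * A * Rabs h ^ 2).
  { rewrite pow2_abs. destruct (Rle_dec 0 h).
    - destruct (Htaylor t (t + h) ltac:(lra) ltac:(lra) ltac:(lra)) as [Hf _].
      replace (t + h - t) with h in Hf by ring. pose proof (pow2_ge_0 h). nra.
    - destruct (Htaylor (t + h) t ltac:(lra) ltac:(lra) ltac:(lra)) as [Hf Hf'].
      replace (t - (t + h)) with (- h) in Hf, Hf' by ring.
      replace (f (t + h) - f t - h * f' t) with
        (- (f t - f (t + h) - - h * f' (t + h)) - h * (f' t - f' (t + h))) by ring.
      eapply Rle_trans; [apply Rabs_triang|]. rewrite !Rabs_Ropp, Rabs_mult, (Rabs_left h) by lra.
      assert (- h * Rabs (f' t - f' (t + h)) <= - h * (A * - h)) by (apply Rmult_le_compat_l; lra).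
      lra. }
  replace ((f (t + h) - f t) / h - f' t) with ((f (t + h) - f t - h * f' t) / h) by (field; auto).
  unfold Rdiv. rewrite Rabs_mult, Rabs_inv.
  apply Rmult_lt_reg_r with (Rabs h); auto. rewrite Rmult_assoc, Rinv_l by lra. rewrite Rmult_1_r.
  eapply Rle_lt_trans; [exact Hquad|]. nra.
Qed.

Lemma moment_sq_le_weight s A c k : decay (S s) A c -> moment s c k ^ 2 <= A ^ 2 * weight k.
Proof.
  intros H. apply le_weight; [|apply pow2_ge_0]. rewrite <- Rpow_mult_distr. apply pow_incr.
  pose proof (moment_nonneg s c k). pose proof (bracket_ge_1 k). split; [nra|].
  eapply Rle_trans; [|apply (H k)]. simpl pow. rewrite Rmult_assoc. apply Rmult_le_compat_l; [lra|].
  apply Rmult_le_compat_r; [apply Rabs_pos|]. apply pow_incr, INR_le_bracket.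
Qed.

Section Scheme.
Variables (g : R) (m c0 : nat -> R) (U : (nat -> Prop) -> Prop).
Hypothesis g_pos : 0 < g.
Hypothesis m_le : forall k, Rabs (m k) <= 2.
Hypothesis c0_0 : c0 O = 0.
Hypothesis c0_rapid : rapid c0.
Hypothesis U_free : free_ultra U.

Local Instance U_proper : ProperFilter U := free_ultra_proper U U_free.

Definition trunc_data (N k : nat) : R := if lt_dec k N then c0 k else 0.

Fixpoint euler (N n : nat) : nat -> R :=
  match n with
  | O => trunc_data N
  | S n' => fun k => euler N n' k + time_step N * transport_trunc g m N (euler N n') (euler N n') k
  end.

Lemma euler_supported N n : supported N (euler N n).
Proof.
  induction n as [|n [IH0 IHN]].
  - split; simpl; unfold trunc_data.
    + destruct (lt_dec 0 N); auto.
    + intros k Hk. destruct (lt_dec k N); auto; lia.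
  - destruct (transport_trunc_supported g m N (euler N n) (euler N n)) as [Hzero HN].
    split; simpl.
    + rewrite IH0, Hzero; ring.
    + intros k Hk. rewrite IHN, HN; auto; ring.
Qed.

Definition energy_bounded (T : R) : Prop :=
  exists M, U (fun N => forall n, INR n * time_step N <= T -> energy N 2 (euler N n) <= M).

Lemma energy_bounded_le T T' : T' <= T -> energy_bounded T -> energy_bounded T'.
Proof.
  intros H [M HM]. exists M. revert HM. apply filter_imp. intros N HN n Hn. apply HN; lra.
Qed.

Lemma trunc_data_energy_le s : exists A, forall N, energy N s (trunc_data N) <= A.
Proof.
  destruct (c0_rapid (S s)) as [A HA]. exists (2 * A ^ 2). intros N.
  eapply Rle_trans; [|apply (psum_weight_le (A ^ 2) N), pow2_ge_0].
  apply psum_le; intros k Hk. rewrite <- (moment_sq_le_weight s A c0 k HA).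
  unfold moment, trunc_data. destruct (lt_dec k N); [lra|lia].
Qed.

Lemma euler_energy_step_le N r n :
  energy N (S r) (euler N (S n)) <=
  energy N (S r) (euler N n) * (1 + time_step N * (energy_rate g r * (1 + energy N 2 (euler N n)))).
Proof. apply energy_step_le; auto. apply euler_supported. Qed.

Lemma euler_energy_le N r T M : 0 <= M ->
  (forall n, INR n * time_step N <= T -> energy N 2 (euler N n) <= M) ->
  forall n, INR n * time_step N <= T -> energy N (S r) (euler N n) <=
    energy N (S r) (trunc_data N) * exp (energy_rate g r * (1 + M) * (INR n * time_step N)).
Proof.
  intros HM0 HM n. induction n; intros Hn.
  - simpl. rewrite Rmult_0_l, Rmult_0_r, exp_0. lra.
  - pose proof (time_step_pos N) as Hh. rewrite S_INR in *.
    specialize (IHn ltac:(nra)). specialize (HM n ltac:(nra)).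
    eapply Rle_trans; [apply euler_energy_step_le|].
    pose proof (energy_rate_nonneg g g_pos r) as HK.
    pose proof (energy_nonneg N (S r) (euler N n)). pose proof (energy_nonneg N 2 (euler N n)).
    replace (energy_rate g r * (1 + M) * ((INR n + 1) * time_step N)) with
      (energy_rate g r * (1 + M) * (INR n * time_step N)
       + time_step N * (energy_rate g r * (1 + M))) by ring.
    rewrite exp_plus, <- (Rmult_assoc (energy N (S r) (trunc_data N))). apply Rmult_le_compat; auto.
    + assert (0 <= time_step N * (energy_rate g r * (1 + energy N 2 (euler N n)))) by
        (apply Rmult_le_pos; [lra|apply Rmult_le_pos; lra]). lra.
    + eapply Rle_trans; [|apply exp_ineq1_le]. apply Rplus_le_compat_l.
      apply Rmult_le_compat_l; [lra|]. apply Rmult_le_compat_l; lra.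
Qed.

Lemma euler_decay T : energy_bounded T -> forall s, exists A,
  U (fun N => forall n, INR n * time_step N <= T -> decay s A (euler N n)).
Proof.
  intros [M HM] s. destruct (trunc_data_energy_le (S s)) as [E0 HE0].
  set (G := exp (energy_rate g s * (1 + Rmax M 0) * Rmax T 0)).
  exists (2 ^ S s * sqrt (E0 * G)).
  revert HM. apply filter_imp. intros N HN n Hn.
  apply decay_le with (S s) (2 ^ S s * sqrt (E0 * G)); [lia|lra|].
  apply decay_of_energy with N; [apply euler_supported|].
  pose proof (Rmax_r M 0). pose proof (energy_rate_nonneg g g_pos s).
  eapply Rle_trans.
  - apply (euler_energy_le N s T (Rmax M 0)); auto.
    intros n' Hn'. eapply Rle_trans; [apply HN; auto|apply Rmax_l].
  - apply Rmult_le_compat; [apply energy_nonneg|left; apply exp_pos|apply HE0|].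
    apply exp_le. apply Rmult_le_compat_l; [apply Rmult_le_pos; lra|].
    eapply Rle_trans; [exact Hn|apply Rmax_l].
Qed.

Lemma euler_lipschitz N T s A : (forall n, INR n * time_step N <= T ->
    decay (s + 3) A (euler N n)) ->
  forall i n, INR (n + i) * time_step N <= T ->
  decay s (8 * 2 ^ s * g * (A * A) * (INR i * time_step N))
    (fun k => euler N (n + i) k - euler N n k).
Proof.
  intros HA i n. pose proof (time_step_pos N) as Hh. induction i; intros Hn.
  - rewrite Nat.add_0_r. intros k. rewrite Rminus_diag, Rabs_R0. simpl. lra.
  - rewrite Nat.add_succ_r, S_INR in Hn.
    specialize (IHi ltac:(nra)). specialize (HA (n + i)%nat ltac:(nra)).
    pose proof (decay_transport_trunc g m g_pos m_le N s A A _ _ HA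
      (decay_le (s + 3) s A A _ ltac:(lia) (Rle_refl A) HA)) as Hstep.
    apply (decay_scal _ _ (time_step N)) in Hstep. rewrite Rabs_pos_eq in Hstep by lra.
    pose proof (decay_plus _ _ _ _ _ IHi Hstep) as H.
    replace (8 * 2 ^ s * g * (A * A) * (INR (S i) * time_step N)) with
      (8 * 2 ^ s * g * (A * A) * (INR i * time_step N) + time_step N * (8 * 2 ^ s * g * (A * A)))
      by (rewrite S_INR; ring).
    eapply decay_ext; [|exact H]. intros k. rewrite Nat.add_succ_r. simpl. ring.
Qed.

Lemma euler_transport_lipschitz N T A : 0 <= A ->
  (forall n, INR n * time_step N <= T -> decay 6 A (euler N n)) ->
  forall i n k, INR (n + i) * time_step N <= T ->
  Rabs (transport_trunc g m N (euler N (n + i)) (euler N (n + i)) k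
        - transport_trunc g m N (euler N n) (euler N n) k)
   <= 1024 * g ^ 2 * A ^ 3 * (INR i * time_step N).
Proof.
  intros HA0 HA i n k Hn. pose proof (time_step_pos N) as Hh.
  assert (Hn' : INR n * time_step N <= T).
  { rewrite plus_INR in Hn. pose proof (pos_INR i). nra. }
  pose proof (euler_lipschitz N T 3 A HA i n Hn) as Hdiff.
  rewrite transport_trunc_minus. eapply Rle_trans; [apply Rabs_triang|].
  assert (Hlow : forall s n', (s <= 6)%nat -> INR n' * time_step N <= T -> decay s A (euler N n')).
  { intros s n' Hs Hn2. apply (decay_le 6 s A A); auto. lra. }
  pose proof (decay_transport_trunc g m g_pos m_le N 0 _ _ _ _ Hdiff
    (Hlow 0%nat _ ltac:(lia) Hn)) as Hleft.
  pose proof (decay_transport_trunc g m g_pos m_le N 0 _ _ _ _ (Hlow 3%nat _ ltac:(lia) Hn')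
    (decay_le 3 0 _ _ _ ltac:(lia) (Rle_refl _) Hdiff)) as Hright.
  apply (decay_Rabs_le _ _ _ k) in Hleft. apply (decay_Rabs_le _ _ _ k) in Hright.
  eapply Rle_trans; [apply Rplus_le_compat; [exact Hleft|exact Hright]|]. right; ring.
Qed.

Lemma euler_taylor N T A : 0 <= A ->
  (forall n, INR n * time_step N <= T -> decay 6 A (euler N n)) ->
  forall i n k, INR (n + i) * time_step N <= T ->
  Rabs (euler N (n + i) k - euler N n k
        - INR i * time_step N * transport_trunc g m N (euler N n) (euler N n) k)
   <= 1024 * g ^ 2 * A ^ 3 * (INR i * time_step N) ^ 2.
Proof.
  intros HA0 HA i n k. pose proof (time_step_pos N) as Hh. set (h := time_step N) in *.
  induction i; intros Hn.
  - rewrite Nat.add_0_r, Rmult_0_l, !Rminus_diag, Rmult_0_l, Rminus_0_r, Rabs_R0. simpl. lra.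
  - assert (Hni : INR (n + i) * h <= T) by (rewrite Nat.add_succ_r, S_INR in Hn; nra).
    specialize (IHi Hni). pose proof (euler_transport_lipschitz N T A HA0 HA i n k Hni) as HF.
    fold h in HF. rewrite Nat.add_succ_r, S_INR. simpl euler. fold h.
    set (x := euler N (n + i) k) in *. set (y := euler N n k) in *.
    set (f := transport_trunc g m N (euler N n) (euler N n) k) in *.
    set (f' := transport_trunc g m N (euler N (n + i)) (euler N (n + i)) k) in *.
    set (C := 1024 * g ^ 2 * A ^ 3) in *.
    assert (HC : 0 <= C).
    { apply Rmult_le_pos; [apply Rmult_le_pos; [lra|apply pow2_ge_0]|now apply pow_le]. }
    replace (x + h * f' - y - (INR i + 1) * h * f) with ((x - y - INR i * h * f) + h * (f' - f))
      by ring.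
    eapply Rle_trans; [apply Rabs_triang|]. rewrite Rabs_mult, (Rabs_pos_eq h) by lra.
    pose proof (pos_INR i).
    assert (h * Rabs (f' - f) <= h * (C * (INR i * h))) by (apply Rmult_le_compat_l; lra).
    assert (C * ((INR i * h) ^ 2 + h * (INR i * h)) <= C * ((INR i + 1) * h) ^ 2).
    { apply Rmult_le_compat_l; auto. nra. }
    lra.
Qed.

Definition approx (N : nat) (t : R) : nat -> R := euler N (step_count (time_step N) t).
Definition limit_modes (t : R) (k : nat) : R := ultralim U (fun N => approx N t k).

Lemma approx_time_le N T t : 0 <= T -> t <= T ->
  INR (step_count (time_step N) t) * time_step N <= T.
Proof.
  intros HT Ht. pose proof (time_step_pos N) as Hh. destruct (Rle_dec t 0).
  - rewrite step_count_nonpos; auto. simpl. lra.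
  - destruct (step_count_spec (time_step N) t Hh ltac:(lra)). lra.
Qed.

Lemma approx_time_split N t t' : 0 <= t -> t <= t' ->
  (step_count (time_step N) t + (step_count (time_step N) t' - step_count (time_step N) t))%nat
  = step_count (time_step N) t'.
Proof. intros Ht Htt. pose proof (step_count_le _ t t' (time_step_pos N) Ht Htt). lia. Qed.

Lemma time_step_lim : filterlim time_step U (locally 0).
Proof.
  apply filterlim_R_eps. intros eps He.
  destruct (step_count_spec eps 1 He ltac:(lra)) as [_ Hn]. set (n := step_count eps 1) in *.
  generalize (free_ultra_large U U_free n). apply filter_imp. intros N HN. apply le_INR in HN.
  pose proof (time_step_pos N) as Hh. rewrite Rminus_0_r, Rabs_pos_eq by lra.
  unfold time_step in *. pose proof (bracket_ge_1 N) as HqN.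
  assert (Hpow : bracket N <= bracket N ^ 5).
  { rewrite <- (pow_1 (bracket N)) at 1. apply Rle_pow; [auto|lia]. }
  apply Rmult_lt_reg_r with (bracket N ^ 5); [lra|]. rewrite Rinv_l by lra.
  unfold bracket in *. nra.
Qed.

Lemma elapsed_time_lim t t' : 0 <= t -> t <= t' ->
  filterlim (fun N => INR (step_count (time_step N) t' - step_count (time_step N) t) * time_step N)
    U (locally (t' - t)).
Proof.
  intros Ht Htt. apply filterlim_R_eps. intros eps He.
  pose proof time_step_lim as Hlim. rewrite filterlim_R_eps in Hlim.
  generalize (Hlim eps He). apply filter_imp. intros N HN. pose proof (time_step_pos N) as Hh.
  rewrite Rminus_0_r, Rabs_pos_eq in HN by lra.
  destruct (step_count_spec (time_step N) t Hh Ht).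
  destruct (step_count_spec (time_step N) t' Hh ltac:(lra)).
  rewrite minus_INR by (now apply step_count_le). apply Rabs_def1; lra.
Qed.

Section BoundedEnergy.
Variable T : R.
Hypothesis T_nonneg : 0 <= T.
Hypothesis T_bounded : energy_bounded T.

Lemma approx_lim t k : t <= T -> filterlim (fun N => approx N t k) U (locally (limit_modes t k)).
Proof.
  intros Ht. destruct (euler_decay T T_bounded 0) as [A HA]. apply ultralim_correct with A; auto.
  revert HA. apply filter_imp. intros N HN. apply (decay_Rabs_le 0 A).
  apply HN, approx_time_le; auto.
Qed.

Lemma limit_modes_decay s : exists A, forall t, t <= T -> decay s A (limit_modes t).
Proof.
  destruct (euler_decay T T_bounded s) as [A HA]. exists A. intros t Ht k.
  apply (filterlim_Rle (F := U) (fun N => bracket k ^ s * Rabs (approx N t k)) (fun _ => A)).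
  - revert HA. apply filter_imp. intros N HN. apply HN, approx_time_le; auto.
  - apply filterlim_Rmult; [apply filterlim_Rconst|now apply filterlim_Rabs, approx_lim].
  - apply filterlim_Rconst.
Qed.

Lemma limit_modes_0 t : t <= T -> limit_modes t O = 0.
Proof.
  intros Ht. apply (filterlim_locally_unique (F := U) (fun N => approx N t O)).
  - now apply approx_lim.
  - apply filterlim_ext with (fun _ => 0); [|apply filterlim_Rconst].
    intros N. symmetry. apply (proj1 (euler_supported N _)).
Qed.

Lemma mode_kernel_approx_lim k j t : t <= T ->
  filterlim (fun N => mode_kernel m (approx N t) k j) U
    (locally (mode_kernel m (limit_modes t) k j)).
Proof.
  intros Ht. unfold mode_kernel, mode_kernel_anti. apply filterlim_Rplus.
  - apply filterlim_Rmult; [apply filterlim_Rconst|now apply approx_lim].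
  - destruct (le_dec k j); [|apply filterlim_Ropp];
      (apply filterlim_Rmult; [apply filterlim_Rconst|now apply approx_lim]).
Qed.

Lemma transport_trunc_lim t k : (1 <= k)%nat -> t <= T ->
  filterlim (fun N => transport_trunc g m N (approx N t) (approx N t) k) U
    (locally (transport g m (limit_modes t) (limit_modes t) k)).
Proof.
  intros Hk Ht.
  apply filterlim_ext_loc with (fun N => transport g m (approx N t) (approx N t) k).
  { generalize (free_ultra_large U U_free (S k)). apply filter_imp. intros N HN. symmetry.
    apply transport_trunc_eq_transport; [apply euler_supported|lia]. }
  destruct k; [lia|]. apply filterlim_Rmult; [apply filterlim_Rconst|].
  destruct (euler_decay T T_bounded 3) as [A HA]. destruct (limit_modes_decay 3) as [A' HA'].
  set (B := Rmax A A').
  assert (Hterm : forall M c j, decay 3 M c -> M <= B ->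
    Rabs (INR j * c j * mode_kernel m c (S k) j) <= 8 * 2 ^ 0 * (B * B) * weight j).
  { intros M c j Hc HM. rewrite <- (Rmult_1_l (Rabs _)).
    apply (decay_transport_term m m_le 0 B B c c (S k) j);
      apply (decay_le 3 _ M B); auto; lia. }
  apply (filterlim_Series U _ _ (fun j => 8 * 2 ^ 0 * (B * B) * weight j)).
  - apply ex_series_weight.
  - revert HA. apply filter_imp. intros N HN j. apply (Hterm A); [|apply Rmax_l].
    apply HN, approx_time_le; auto.
  - intros j. apply (Hterm A'); [|apply Rmax_r]. now apply HA'.
  - intros j. apply filterlim_Rmult; [|now apply mode_kernel_approx_lim].
    apply filterlim_Rmult; [apply filterlim_Rconst|now apply approx_lim].
Qed.

Lemma limit_modes_lipschitz s : exists A, 0 <= A /\ forall t t', 0 <= t -> t <= t' -> t' <= T ->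
  decay s (A * (t' - t)) (fun k => limit_modes t' k - limit_modes t k).
Proof.
  destruct (euler_decay T T_bounded (s + 3)) as [A HA].
  exists (8 * 2 ^ s * g * (A * A)). split.
  { assert (0 <= A * A) by nra. assert (0 <= 2 ^ s) by (apply pow_le; lra).
    repeat (apply Rmult_le_pos; [|lra]). lra. }
  intros t t' Ht Htt Ht' k.
  apply (filterlim_Rle (F := U) (fun N => bracket k ^ s * Rabs (approx N t' k - approx N t k))
    (fun N => 8 * 2 ^ s * g * (A * A) *
      (INR (step_count (time_step N) t' - step_count (time_step N) t) * time_step N))).
  - revert HA. apply filter_imp. intros N HN.
    pose proof (euler_lipschitz N T s A HN
      (step_count (time_step N) t' - step_count (time_step N) t)
      (step_count (time_step N) t)) as HL.
    rewrite approx_time_split in HL by auto. apply HL. apply approx_time_le; lra.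
  - apply filterlim_Rmult; [apply filterlim_Rconst|].
    apply filterlim_Rabs, filterlim_Rminus; apply approx_lim; lra.
  - apply filterlim_Rmult; [apply filterlim_Rconst|]. now apply elapsed_time_lim.
Qed.

Lemma limit_modes_taylor k : (1 <= k)%nat -> exists A, 0 <= A /\
  forall t t', 0 <= t -> t <= t' -> t' <= T ->
  Rabs (limit_modes t' k - limit_modes t k
        - (t' - t) * transport g m (limit_modes t) (limit_modes t) k) <= A * (t' - t) ^ 2 /\
  Rabs (transport g m (limit_modes t') (limit_modes t') k
        - transport g m (limit_modes t) (limit_modes t) k) <= A * (t' - t).
Proof.
  intros Hk. destruct (euler_decay T T_bounded 6) as [A HA].
  assert (HA0 : 0 <= A).
  { destruct (filter_ex _ HA) as [N HN]. apply (decay_nonneg 6 A (euler N 0)).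
    apply HN. simpl; lra. }
  exists (1024 * g ^ 2 * A ^ 3). split.
  { apply Rmult_le_pos; [apply Rmult_le_pos; [lra|apply pow2_ge_0]|now apply pow_le]. }
  intros t t' Ht Htt Ht'. pose proof (elapsed_time_lim t t' Ht Htt) as Hel.
  set (elapsed := fun N => _) in Hel.
  split.
  - apply (filterlim_Rle (F := U) (fun N => Rabs (approx N t' k - approx N t k
        - elapsed N * transport_trunc g m N (approx N t) (approx N t) k))
      (fun N => 1024 * g ^ 2 * A ^ 3 * elapsed N ^ 2)).
    + revert HA. apply filter_imp. intros N HN.
      pose proof (euler_taylor N T A HA0 HN
        (step_count (time_step N) t' - step_count (time_step N) t)
        (step_count (time_step N) t) k) as H.
      rewrite approx_time_split in H by auto. apply H. apply approx_time_le; lra.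
    + apply filterlim_Rabs, filterlim_Rminus; [apply filterlim_Rminus; apply approx_lim; lra|].
      apply filterlim_Rmult; [exact Hel|apply transport_trunc_lim; auto; lra].
    + apply filterlim_Rmult; [apply filterlim_Rconst|].
      repeat apply filterlim_Rmult; auto. apply filterlim_Rconst.
  - apply (filterlim_Rle (F := U)
      (fun N => Rabs (transport_trunc g m N (approx N t') (approx N t') k
                      - transport_trunc g m N (approx N t) (approx N t) k))
      (fun N => 1024 * g ^ 2 * A ^ 3 * elapsed N)).
    + revert HA. apply filter_imp. intros N HN.
      pose proof (euler_transport_lipschitz N T A HA0 HN
        (step_count (time_step N) t' - step_count (time_step N) t)
        (step_count (time_step N) t) k) as H.
      rewrite approx_time_split in H by auto. apply H. apply approx_time_le; lra.
    + apply filterlim_Rabs, filterlim_Rminus; apply transport_trunc_lim; auto; lra.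
    + apply filterlim_Rmult; [apply filterlim_Rconst|exact Hel].
Qed.

Lemma limit_modes_ode t k : 0 < t < T ->
  is_derive (fun s => limit_modes s k) t (transport g m (limit_modes t) (limit_modes t) k).
Proof.
  intros Ht. destruct k as [|k].
  - apply is_derive_ext_loc with (fun _ => 0); [|apply is_derive_Rconst].
    exists (mkposreal (T - t) ltac:(lra)). intros s Hs. symmetry. apply limit_modes_0.
    change (Rabs (s - t) < T - t) in Hs. apply Rabs_def2 in Hs. lra.
  - destruct (limit_modes_taylor (S k) ltac:(lia)) as [A [HA Htaylor]].
    now apply (is_derive_of_taylor (fun s => limit_modes s (S k))
      (fun s => transport g m (limit_modes s) (limit_modes s) (S k)) t T A).
Qed.

Lemma approx_energy_le t K : 0 <= t <= T ->
  (forall n, psum (fun k => moment 2 (limit_modes t) k ^ 2) n <= K) ->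
  U (fun N => energy N 2 (approx N t) <= K + 1).
Proof.
  intros Ht HK. destruct (euler_decay T T_bounded 3) as [A HA].
  destruct (Series_tail_small (fun k => A ^ 2 * weight k) (/ 2) (ex_series_weight _) ltac:(lra))
    as [n0 Hn0].
  specialize (Hn0 n0 (le_n n0)). rewrite (Series_split _ n0) in Hn0 by apply ex_series_weight.
  assert (Hlim : filterlim (fun N => psum (fun k => moment 2 (approx N t) k ^ 2) n0) U
    (locally (psum (fun k => moment 2 (limit_modes t) k ^ 2) n0))).
  { apply filterlim_psum; [apply U_proper|]. intros k.
    assert (Hk : filterlim (fun N => moment 2 (approx N t) k) U
      (locally (moment 2 (limit_modes t) k))).
    { apply filterlim_Rmult; [apply filterlim_Rconst|]. apply filterlim_Rabs, approx_lim; lra. }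
    apply filterlim_Rmult; [exact Hk|]. apply filterlim_Rmult; [exact Hk|apply filterlim_Rconst]. }
  rewrite filterlim_R_eps in Hlim. assert (Hhalf : 0 < / 2) by lra.
  generalize (filter_and _ _ (Hlim (/ 2) Hhalf)
    (filter_and _ _ HA (free_ultra_large U U_free n0))).
  apply filter_imp. intros N [Hhead [HdecN Hn0N]]. apply Rabs_def2 in Hhead. specialize (HK n0).
  assert (Hsplit : forall f, psum f N = psum f n0 + psum (fun k => f (n0 + k)%nat) (N - n0)).
  { intros f. rewrite <- psum_split. f_equal. lia. }
  unfold energy. rewrite Hsplit.
  assert (Htail : psum (fun k => moment 2 (approx N t) (n0 + k) ^ 2) (N - n0)
    <= Series (fun k => A ^ 2 * weight (n0 + k))); [|lra].
  eapply Rle_trans.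
  - apply psum_le. intros k _. apply (moment_sq_le_weight 2 A). apply HdecN, approx_time_le; lra.
  - apply (psum_le_Series (fun k => A ^ 2 * weight (n0 + k))).
    + apply (ex_series_incr_n (fun k => A ^ 2 * weight k) n0), ex_series_weight.
    + intros k. pose proof (weight_pos (n0 + k)). pose proof (pow2_ge_0 A). nra.
Qed.
End BoundedEnergy.

Lemma limit_modes_initial t k : t <= 0 -> limit_modes t k = c0 k.
Proof.
  intros Ht. apply (filterlim_locally_unique (F := U) (fun N => approx N t k)).
  2: { apply filterlim_ext_loc with (fun _ => c0 k); [|apply filterlim_Rconst].
    generalize (free_ultra_large U U_free (S k)). apply filter_imp. intros N HN. unfold approx.
    rewrite step_count_nonpos; [|apply time_step_pos|auto]. simpl. unfold trunc_data.
    destruct (lt_dec k N); auto; lia. }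
  apply ultralim_correct with (Rabs (c0 k)); auto. apply filter_forall. intros N. unfold approx.
  rewrite step_count_nonpos; [|apply time_step_pos|auto]. simpl. unfold trunc_data.
  destruct (lt_dec k N); [lra|]. rewrite Rabs_R0. apply Rabs_pos.
Qed.

Lemma limit_modes_Rmax t k : limit_modes t k = limit_modes (Rmax 0 t) k.
Proof.
  destruct (Rle_dec 0 t); [rewrite Rmax_right; auto|].
  rewrite Rmax_left by lra. rewrite !limit_modes_initial; auto; lra.
Qed.

Lemma limit_modes_lipschitz_Rabs T : energy_bounded (Rmax 0 T) -> forall s, exists A, 0 <= A /\
  forall t t', t <= T -> t' <= T ->
  decay s (A * Rabs (t' - t)) (fun k => limit_modes t' k - limit_modes t k).
Proof.
  intros HT s. destruct (limit_modes_lipschitz _ (Rmax_l 0 T) HT s) as [A [HA0 HA]].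
  exists A. split; auto.
  assert (Hordered : forall t t', t <= t' -> t' <= T ->
    decay s (A * (t' - t)) (fun k => limit_modes t' k - limit_modes t k)).
  { intros t t' Htt Ht' k. rewrite (limit_modes_Rmax t'), (limit_modes_Rmax t).
    eapply Rle_trans.
    - apply (HA (Rmax 0 t) (Rmax 0 t')); [apply Rmax_l| |]; now apply Rle_max_compat_l.
    - apply Rmult_le_compat_l; auto. unfold Rmax. destruct (Rle_dec 0 t), (Rle_dec 0 t'); lra. }
  intros t t' Ht Ht'. destruct (Rle_dec t t').
  - rewrite Rabs_pos_eq by lra. now apply Hordered.
  - rewrite Rabs_minus_sym, Rabs_pos_eq by lra. intros k. rewrite Rabs_minus_sym.
    apply Hordered; auto; lra.
Qed.

Lemma limit_modes_solution Tm : 0 < Tm -> (forall T, T < Tm -> energy_bounded T) ->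
  mode_solution g m Tm limit_modes.
Proof.
  intros HTm HE.
  assert (Hmax : forall T, T < Tm -> energy_bounded (Rmax 0 T)).
  { intros T HT. now apply HE, Rmax_lub_lt. }
  split.
  - intros T HT s. destruct (limit_modes_decay _ (Rmax_l 0 T) (Hmax T HT) s) as [A HA].
    exists A. intros t Ht. apply HA. pose proof (Rmax_r 0 T). lra.
  - intros t Ht. apply (limit_modes_0 _ (Rmax_l 0 t) (Hmax t Ht)), Rmax_r.
  - intros t k Ht. apply (limit_modes_ode ((t + Tm) / 2)); [lra|apply HE; lra|lra].
  - intros T HT. apply limit_modes_lipschitz_Rabs; auto.
Qed.

Lemma euler_energy_doubling N Y n0 : 1 + energy N 2 (euler N n0) <= Y ->
  forall i, energy_rate g 1 * Y * (INR i * time_step N) <= / 2 ->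
  1 + energy N 2 (euler N (n0 + i)) <= 2 * Y.
Proof.
  intros HY i Hi. pose proof (time_step_pos N) as Hh.
  pose proof (energy_rate_nonneg g g_pos 1) as HK.
  assert (HE : forall n, 0 <= energy N 2 (euler N n)) by (intros; apply energy_nonneg).
  assert (HYp : 1 <= Y) by (specialize (HE n0); lra).
  assert (Hinv : forall i, / Y - energy_rate g 1 * (INR i * time_step N)
    <= / (1 + energy N 2 (euler N (n0 + i)))).
  { intros j. induction j as [|j IH].
    - rewrite Nat.add_0_r, Rmult_0_l, Rmult_0_r, Rminus_0_r.
      apply Rinv_le_contravar; auto. specialize (HE n0); lra.
    - rewrite S_INR, Nat.add_succ_r.
      pose proof (euler_energy_step_le N 1 (n0 + j)) as Hs. rewrite <- Rmult_assoc in Hs.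
      apply Rinv_riccati_step in Hs; auto; [lra|]. apply Rmult_le_pos; lra. }
  assert (Hhalf : / (2 * Y) <= / (1 + energy N 2 (euler N (n0 + i)))).
  { eapply Rle_trans; [|apply Hinv]. rewrite Rinv_mult.
    assert (energy_rate g 1 * (INR i * time_step N) <= / 2 * / Y); [|lra].
    apply Rmult_le_reg_r with Y; [lra|]. rewrite (Rmult_assoc (/ 2)), Rinv_l by lra. lra. }
  apply Rinv_le_contravar in Hhalf; [|apply Rinv_0_lt_compat; lra].
  now rewrite !Rinv_inv in Hhalf.
Qed.

Lemma energy_bounded_extend t Y de : 0 <= t -> 0 < de -> 1 <= Y ->
  energy_rate g 1 * Y * de <= / 2 -> energy_bounded t ->
  U (fun N => 1 + energy N 2 (approx N t) <= Y) -> energy_bounded (t + de / 2).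
Proof.
  intros Ht Hde HY Hsmall [M HM] Hstart. exists (Rmax M (2 * Y)).
  pose proof time_step_lim as Hlim. rewrite filterlim_R_eps in Hlim.
  assert (Hde2 : 0 < de / 2) by lra.
  generalize (filter_and _ _ HM (filter_and _ _ Hstart (Hlim _ Hde2))).
  apply filter_imp. intros N [HMN [HYN HhN]] n Hn. pose proof (time_step_pos N) as Hh.
  rewrite Rminus_0_r, Rabs_pos_eq in HhN by lra.
  destruct (Rle_dec (INR n * time_step N) t) as [Hle|Hgt].
  { eapply Rle_trans; [apply HMN; auto|apply Rmax_l]. }
  set (n0 := step_count (time_step N) t).
  destruct (step_count_spec (time_step N) t Hh Ht) as [Hlow Hup]. fold n0 in Hlow, Hup.
  assert (Hn0 : (n0 <= n)%nat) by (apply INR_le, Rmult_le_reg_r with (time_step N); lra).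
  pose proof (euler_energy_doubling N Y n0 HYN (n - n0)) as HD.
  replace (n0 + (n - n0))%nat with n in HD by lia. rewrite minus_INR in HD by auto.
  assert (1 + energy N 2 (euler N n) <= 2 * Y).
  { apply HD. eapply Rle_trans; [|exact Hsmall]. apply Rmult_le_compat_l; [|lra].
    pose proof (energy_rate_nonneg g g_pos 1). nra. }
  eapply Rle_trans; [|apply Rmax_r]. lra.
Qed.

Lemma extension_time Y : 1 <= Y -> exists de, 0 < de /\ energy_rate g 1 * Y * de <= / 2.
Proof.
  intros HY. pose proof (energy_rate_nonneg g g_pos 1) as HK.
  assert (Hp : 0 < 2 * (energy_rate g 1 * Y) + 1) by nra.
  exists (/ (2 * (energy_rate g 1 * Y) + 1)). split; [now apply Rinv_0_lt_compat|].
  apply Rmult_le_reg_r with (2 * (energy_rate g 1 * Y) + 1); auto.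
  rewrite Rmult_assoc, Rinv_l by lra. lra.
Qed.

Lemma energy_bounded_short_time : exists T, 0 < T /\ energy_bounded T.
Proof.
  destruct (trunc_data_energy_le 2) as [E0 HE0].
  assert (0 <= E0) by (eapply Rle_trans; [apply (energy_nonneg O 2 (trunc_data O))|apply HE0]).
  destruct (extension_time (1 + E0) ltac:(lra)) as [de [Hde Hsmall]].
  exists (0 + de / 2). split; [lra|]. apply energy_bounded_extend with (1 + E0); auto; try lra.
  - exists E0. apply filter_forall. intros N n Hn. pose proof (time_step_pos N).
    destruct n; [apply HE0|]. rewrite S_INR in Hn. pose proof (pos_INR n). nra.
  - apply filter_forall. intros N. unfold approx.
    rewrite step_count_nonpos; [|apply time_step_pos|lra]. specialize (HE0 N). simpl. lra.
Qed.

Lemma energy_bounded_past Tm K : 0 < Tm -> (forall T, T < Tm -> energy_bounded T) ->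
  (forall t n, 0 <= t < Tm -> psum (fun k => moment 2 (limit_modes t) k ^ 2) n <= K) ->
  exists T, Tm < T /\ energy_bounded T.
Proof.
  intros HTm HE HK.
  assert (HK0 : 0 <= K) by (specialize (HK 0 O ltac:(lra)); simpl in HK; lra).
  destruct (extension_time (2 + K) ltac:(lra)) as [de [Hde Hsmall]].
  pose (t := Rmax 0 (Tm - de / 4)).
  assert (Ht : 0 <= t < Tm) by (split; [apply Rmax_l|apply Rmax_lub_lt; lra]).
  assert (Hlate : Tm - de / 4 <= t) by apply Rmax_r.
  assert (HEt : energy_bounded t) by (apply HE; lra).
  exists (t + de / 2). split; [lra|]. apply energy_bounded_extend with (2 + K); auto; try lra.
  generalize (approx_energy_le t ltac:(lra) HEt t K ltac:(lra) (fun n => HK t n Ht)).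
  apply filter_imp. intros N HN. lra.
Qed.
End Scheme.

(** * Cosine series and the transport identity *)

Definition cos_series (phi : R) (a : nat -> R) (x : R) : R :=
  Series (fun k => a k * cos (INR k * x + phi)).
Definition sin_series (a : nat -> R) (x : R) : R := Series (fun k => a k * sin (INR k * x)).

(* The modes of the solutions below are its coefficients on [cos kx - 1]. *)
Definition profile (c : nat -> R) (x : R) : R := cos_series 0 c x - cos_series 0 c 0.
Definition density (c : R -> nat -> R) (t x : R) : R := profile (c t) x.

Lemma decay_cos_term s A phi a x :
  decay s A a -> decay s A (fun k => a k * cos (INR k * x + phi)).
Proof. intros H. apply decay_mult_le_1; [intros; apply Rabs_cos_le|exact H]. Qed.

Lemma ex_series_cos phi a x : rapid a -> ex_series (fun k => a k * cos (INR k * x + phi)).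
Proof.
  intros H. destruct (H 2%nat) as [A HA]. now apply decay_2_ex_series with A, decay_cos_term.
Qed.

Lemma cos_series_le phi a A x : decay 2 A a -> Rabs (cos_series phi a x) <= 2 * A.
Proof. intros H. now apply decay_2_Series_le, decay_cos_term. Qed.

Lemma cos_series_ext phi a b x : (forall k, a k = b k) -> cos_series phi a x = cos_series phi b x.
Proof. intros H. apply Series_ext; intros; rewrite H; auto. Qed.

Lemma cos_series_minus phi a b x : rapid a -> rapid b ->
  cos_series phi (fun k => a k - b k) x = cos_series phi a x - cos_series phi b x.
Proof.
  intros Ha Hb. unfold cos_series. rewrite <- Series_minus by now apply ex_series_cos.
  apply Series_ext; intros; ring.
Qed.

Lemma sin_series_cos a x : sin_series a x = cos_series (- (PI / 2)) a x.
Proof.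
  apply Series_ext. intros k. rewrite <- cos_shift, <- (cos_neg (PI / 2 - INR k * x)).
  do 2 f_equal. ring.
Qed.

Lemma cos_series_sin a x : cos_series (PI / 2) a x = - sin_series a x.
Proof.
  unfold cos_series, sin_series. rewrite <- Series_opp. apply Series_ext. intros k.
  rewrite Rplus_comm, (sin_cos (INR k * x)). ring.
Qed.

Lemma ex_series_sin a x : rapid a -> ex_series (fun k => a k * sin (INR k * x)).
Proof.
  intros Ha. eapply ex_series_ext; [|apply (ex_series_cos (- (PI / 2)) a x Ha)].
  intros k. rewrite <- (cos_shift (INR k * x)), <- (cos_neg (PI / 2 - INR k * x)).
  cbv beta. do 2 f_equal. ring.
Qed.

Lemma sin_series_le a A x : decay 2 A a -> Rabs (sin_series a x) <= 2 * A.
Proof. rewrite sin_series_cos. apply cos_series_le. Qed.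

Lemma sin_series_0 a : sin_series a 0 = 0.
Proof.
  apply is_series_unique, (is_series_finite _ 0). intros k _. rewrite Rmult_0_r, sin_0. ring.
Qed.

Lemma sin_series_PI a : sin_series a PI = 0.
Proof.
  apply is_series_unique, (is_series_finite _ 0). intros k _. rewrite sin_INR_mult_PI. ring.
Qed.

Lemma cos_series_even a x : cos_series 0 a (- x) = cos_series 0 a x.
Proof.
  apply Series_ext. intros k. rewrite !Rplus_0_r, Ropp_mult_distr_r_reverse, cos_neg. reflexivity.
Qed.

Lemma cos_series_periodic phi a : periodic2pi (cos_series phi a).
Proof.
  intros x. apply Series_ext. intros k. f_equal.
  replace (INR k * (x + 2 * PI) + phi) with (INR k * x + phi + 2 * INR k * PI) by ring.
  apply cos_period.
Qed.

Lemma is_derive_cos_series phi a x : rapid a ->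
  is_derive (cos_series phi a) x (cos_series (phi + PI / 2) (fun k => INR k * a k) x).
Proof.
  intros Ha. destruct (rapid_INR_mult a Ha 2%nat) as [B HB].
  apply (is_derive_Series (fun x k => a k * cos (INR k * x + phi))
    (fun x k => INR k * a k * cos (INR k * x + (phi + PI / 2))) (fun k => B * weight k) x 1).
  - lra.
  - apply ex_series_weight.
  - intros s k _. replace (cos (INR k * s + (phi + PI / 2))) with (- sin (INR k * s + phi)).
    + auto_derive; auto. ring.
    + replace (INR k * s + (phi + PI / 2)) with (PI / 2 + (INR k * s + phi)) by ring.
      rewrite sin_cos. ring.
  - intros s k _.
    apply (decay_2_weight B (fun k => INR k * a k * cos (INR k * s + (phi + PI / 2)))).
    now apply (decay_cos_term 2 B _ (fun k => INR k * a k)).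
  - intros s _. now apply ex_series_cos.
Qed.

Lemma is_derive_cos_series_sin a x : rapid a ->
  is_derive (cos_series 0 a) x (- sin_series (fun k => INR k * a k) x).
Proof.
  intros Ha. rewrite <- cos_series_sin, <- (Rplus_0_l (PI / 2)). now apply is_derive_cos_series.
Qed.

Lemma is_derive_sin_series a x : rapid a ->
  is_derive (sin_series a) x (cos_series 0 (fun k => INR k * a k) x).
Proof.
  intros Ha. apply is_derive_ext with (cos_series (- (PI / 2)) a).
  - intros; symmetry; apply sin_series_cos.
  - replace 0 with (- (PI / 2) + PI / 2) by ring. now apply is_derive_cos_series.
Qed.

Lemma continuous_sin_series a x : rapid a -> continuous (sin_series a) x.
Proof. intros Ha. eapply continuous_of_is_derive. now apply is_derive_sin_series. Qed.

Lemma cos_series_iter_derive phi a b n x : rapid a ->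
  ex_derive_n (fun y => cos_series phi a y - b) n x /\
  Derive_n (fun y => cos_series phi a y - b) n x =
    cos_series (phi + INR n * (PI / 2)) (fun k => INR k ^ n * a k) x
    - (if Nat.eqb n 0 then b else 0).
Proof.
  intros Ha. revert x. induction n; intros x.
  - split; [exact I|]. simpl. f_equal. rewrite Rmult_0_l, Rplus_0_r.
    apply cos_series_ext; intros; ring.
  - assert (Hd : is_derive (Derive_n (fun y => cos_series phi a y - b) n) x
       (cos_series (phi + INR (S n) * (PI / 2)) (fun k => INR k ^ S n * a k) x)).
    { apply is_derive_ext with (fun x => cos_series (phi + INR n * (PI / 2))
        (fun k => INR k ^ n * a k) x - (if Nat.eqb n 0 then b else 0)).
      { intros y. symmetry. apply IHn. }
      apply is_derive_minus_const. rewrite S_INR, Rmult_plus_distr_r, Rmult_1_l, <- Rplus_assoc.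
      rewrite (cos_series_ext _ (fun k => INR k ^ S n * a k) (fun k => INR k * (INR k ^ n * a k)))
        by (intros; simpl; ring).
      now apply is_derive_cos_series, rapid_INR_pow_mult. }
    split; [eexists; exact Hd|].
    simpl Derive_n. rewrite (is_derive_unique _ _ _ Hd).
    change (if Nat.eqb (S n) 0 then b else 0) with 0. now rewrite Rminus_0_r.
Qed.

Lemma profile_smooth a : rapid a -> smooth_per (profile a).
Proof.
  intros Ha. split; [|split].
  - intros x. unfold profile. now rewrite cos_series_periodic.
  - intros n x. now apply cos_series_iter_derive.
  - intros n. destruct (rapid_INR_pow_mult n a Ha 2%nat) as [A HA].
    set (b := cos_series 0 a 0). exists (2 * A + Rabs b). intros x. unfold profile. fold b.
    rewrite (proj2 (cos_series_iter_derive 0 a b n x Ha)).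
    eapply Rle_trans; [apply Rabs_triang|]. rewrite Rabs_Ropp.
    apply Rplus_le_compat; [now apply cos_series_le|].
    destruct (Nat.eqb n 0); [lra|rewrite Rabs_R0; apply Rabs_pos].
Qed.

Lemma profile_series b x : rapid b ->
  is_series (fun k => b k * (cos (INR k * x) - 1)) (profile b x).
Proof.
  intros Hb. apply is_series_ext with
    (fun k => minus (b k * cos (INR k * x + 0)) (b k * cos (INR k * 0 + 0))).
  - intros k. rewrite Rmult_0_r, !Rplus_0_r, cos_0. unfold minus, plus, opp; simpl. ring.
  - apply (is_series_minus (fun k => b k * cos (INR k * x + 0)));
      now apply Series_correct, ex_series_cos.
Qed.

Lemma continuous_cos_series_param {T : UniformSpace} phi (a : T -> nat -> R) (y : T -> R) p A :
  locally p (fun z => decay 2 A (a z)) ->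
  (forall k, continuous (fun z => a z k) p) -> continuous y p ->
  continuous (fun z => cos_series phi (a z) (y z)) p.
Proof.
  intros HA Ha Hy.
  apply (filterlim_Series (locally p) (fun z k => a z k * cos (INR k * y z + phi)) _
    (fun k => A * weight k)).
  - apply ex_series_weight.
  - revert HA. apply filter_imp. intros z Hz k.
    now apply (decay_2_weight A (fun k => a z k * cos (INR k * y z + phi))), decay_cos_term.
  - intros k. apply (decay_2_weight A (fun k => a p k * cos (INR k * y p + phi))), decay_cos_term.
    apply (locally_singleton _ _ HA).
  - intros k. apply filterlim_Rmult; [apply Ha|].
    apply (continuous_comp y (fun r => cos (INR k * r + phi))); [exact Hy|].
    apply continuous_of_ex_derive. auto_derive; auto.
Qed.

(** * Regularity in time *)

Section Time.
Variables (g : R) (m : nat -> R).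
Hypothesis g_pos : 0 < g.
Hypothesis m_le : forall k, Rabs (m k) <= 2.
Variable Tm : R.

Fixpoint rapid_Cn (n : nat) (a : R -> nat -> R) : Prop :=
  unif_rapid Tm a /\
  match n with
  | O => True
  | S n' => exists a', (forall t k, 0 < t < Tm -> is_derive (fun s => a s k) t (a' t k))
                       /\ rapid_Cn n' a'
  end.

Lemma rapid_Cn_unif n a : rapid_Cn n a -> unif_rapid Tm a.
Proof. destruct n; intros [H _]; auto. Qed.

Lemma rapid_Cn_pred n a : rapid_Cn (S n) a -> rapid_Cn n a.
Proof.
  revert a. induction n; intros a [Ha [a' [Hd Ha']]]; split; auto. exists a'; auto.
Qed.

Lemma rapid_Cn_plus n a b : rapid_Cn n a -> rapid_Cn n b -> rapid_Cn n (fun t k => a t k + b t k).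
Proof.
  revert a b. induction n; intros a b [Ha Ha'] [Hb Hb']; split; try exact I;
    try now apply unif_rapid_plus.
  destruct Ha' as [a' [Hda Ha']]. destruct Hb' as [b' [Hdb Hb']].
  exists (fun t k => a' t k + b' t k). split; auto. intros t k Ht. apply is_derive_Rplus; auto.
Qed.

Lemma rapid_Cn_INR_mult n a : rapid_Cn n a -> rapid_Cn n (fun t k => INR k * a t k).
Proof.
  revert a. induction n; intros a [Ha Ha']; split; try exact I; try now apply unif_rapid_INR_mult.
  destruct Ha' as [a' [Hda Ha']]. exists (fun t k => INR k * a' t k). split; auto.
  intros t k Ht. apply (is_derive_scal (fun s => a s k)); auto.
Qed.

Lemma locally_interior t : 0 < t < Tm -> locally t (fun s => 0 < s < Tm).
Proof.
  intros Ht. assert (Hd : 0 < Rmin t (Tm - t)) by (apply Rmin_pos; lra).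
  exists (mkposreal _ Hd). intros s Hs. change (Rabs (s - t) < Rmin t (Tm - t)) in Hs.
  pose proof (Rmin_l t (Tm - t)). pose proof (Rmin_r t (Tm - t)). apply Rabs_def2 in Hs. lra.
Qed.

Lemma unif_rapid_near_interior a t s : unif_rapid Tm a -> 0 < t < Tm ->
  exists d A, 0 < d /\ forall t', Rabs (t' - t) < d -> 0 < t' < Tm /\ decay s A (a t').
Proof.
  intros Ha Ht. destruct (unif_rapid_near Tm a t s Ha ltac:(lra)) as [d [A [Hd HA]]].
  destruct (locally_interior t Ht) as [e He].
  exists (Rmin d e), A. split; [apply Rmin_pos; [exact Hd|apply cond_pos]|].
  intros t' Ht'. pose proof (Rmin_l d e). pose proof (Rmin_r d e).
  split; [apply He; change (Rabs (t' - t) < e); lra|apply HA; lra].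
Qed.

Lemma is_derive_Series_modes a a' (e : nat -> R) M t : unif_rapid Tm a -> unif_rapid Tm a' ->
  (forall t k, 0 < t < Tm -> is_derive (fun s => a s k) t (a' t k)) ->
  (forall k, Rabs (e k) <= M) -> 0 < t < Tm ->
  is_derive (fun s => Series (fun k => a s k * e k)) t (Series (fun k => a' t k * e k)).
Proof.
  intros Ha Ha' Hd He Ht.
  destruct (unif_rapid_near_interior a' t 2 Ha' Ht) as [d [A [Hd0 HA]]].
  apply (is_derive_Series (fun s k => a s k * e k) (fun s k => a' s k * e k)
    (fun k => M * A * weight k) t d); auto.
  - apply ex_series_weight.
  - intros s k Hs. replace (a' s k * e k) with (a' s k * e k + a s k * 0) by ring.
    apply is_derive_Rmult; [now apply Hd, HA|apply is_derive_Rconst].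
  - intros s k Hs. now apply (decay_2_weight _ (fun k => a' s k * e k)), decay_mult_r, HA.
  - intros s Hs. destruct (unif_rapid_at Tm a s Ha ltac:(apply HA in Hs; lra) 2%nat) as [B HB].
    now apply decay_2_ex_series with (M * B), decay_mult_r.
Qed.

Lemma is_derive_cos_series_time phi a a' t x : unif_rapid Tm a -> unif_rapid Tm a' ->
  (forall t k, 0 < t < Tm -> is_derive (fun s => a s k) t (a' t k)) -> 0 < t < Tm ->
  is_derive (fun s => cos_series phi (a s) x) t (cos_series phi (a' t) x).
Proof.
  intros Ha Ha' Hd Ht. apply is_derive_Series_modes with 1; auto. intros; apply Rabs_cos_le.
Qed.

Lemma is_derive_mode_kernel (b b' : R -> nat -> R) k j t :
  (forall i, is_derive (fun s => b s i) t (b' t i)) ->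
  is_derive (fun s => mode_kernel m (b s) k j) t (mode_kernel m (b' t) k j).
Proof.
  intros H. unfold mode_kernel, mode_kernel_anti.
  apply is_derive_Rplus; [apply (is_derive_scal (fun s => b s _)), H|].
  destruct (le_dec k j); [|apply is_derive_Ropp]; apply (is_derive_scal (fun s => b s _)), H.
Qed.

Lemma is_derive_transport a a' b b' t k :
  unif_rapid Tm a -> unif_rapid Tm a' -> unif_rapid Tm b -> unif_rapid Tm b' ->
  (forall t k, 0 < t < Tm -> is_derive (fun s => a s k) t (a' t k)) ->
  (forall t k, 0 < t < Tm -> is_derive (fun s => b s k) t (b' t k)) -> 0 < t < Tm ->
  is_derive (fun s => transport g m (a s) (b s) k) t
    (transport g m (a' t) (b t) k + transport g m (a t) (b' t) k).
Proof.
  intros Ha Ha' Hb Hb' Hda Hdb Ht. destruct k as [|k]; unfold transport.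
  { rewrite Rplus_0_r. apply is_derive_Rconst. }
  assert (HT : (t + Tm) / 2 < Tm) by lra.
  destruct (Ha _ HT 3%nat) as [A HA]. destruct (Ha' _ HT 3%nat) as [A' HA'].
  destruct (Hb _ HT 0%nat) as [B HB]. destruct (Hb' _ HT 0%nat) as [B' HB'].
  set (d := Rmin t ((Tm - t) / 2)). assert (Hd : 0 < d) by (apply Rmin_pos; lra).
  assert (Hnear : forall s, Rabs (s - t) < d -> 0 < s < Tm /\ s <= (t + Tm) / 2).
  { intros s Hs. apply Rabs_def2 in Hs.
    assert (d <= t) by apply Rmin_l. assert (d <= (Tm - t) / 2) by apply Rmin_r. lra. }
  assert (Hterm : forall M M' u v j, decay 3 M u -> decay 0 M' v ->
    Rabs (INR j * u j * mode_kernel m v (S k) j) <= 8 * 2 ^ 0 * (M * M') * weight j).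
  { intros M M' u v j Hu Hv. rewrite <- (Rmult_1_l (Rabs _)).
    now apply (decay_transport_term m m_le 0). }
  rewrite <- Rmult_plus_distr_l.
  apply (is_derive_scal (fun s => Series (fun j => INR j * a s j * mode_kernel m (b s) (S k) j))).
  rewrite <- Series_plus.
  2: apply (ex_series_transport m m_le A' B); [apply HA'|apply HB]; lra.
  2: apply (ex_series_transport m m_le A B'); [apply HA|apply HB']; lra.
  apply (is_derive_Series (fun s j => INR j * a s j * mode_kernel m (b s) (S k) j)
    (fun s j => INR j * a' s j * mode_kernel m (b s) (S k) j
                + INR j * a s j * mode_kernel m (b' s) (S k) j)
    (fun j => (8 * 2 ^ 0 * (A' * B) + 8 * 2 ^ 0 * (A * B')) * weight j) t d); auto.
  - apply ex_series_weight.
  - intros s j Hs. apply Hnear in Hs as [Hs _].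
    apply (is_derive_Rmult (fun s => INR j * a s j) (fun s => mode_kernel m (b s) (S k) j)).
    { apply (is_derive_scal (fun s => a s j)); auto. }
    apply (is_derive_mode_kernel b b'); auto.
  - intros s j Hs. apply Hnear in Hs as [_ Hs]. eapply Rle_trans; [apply Rabs_triang|].
    rewrite Rmult_plus_distr_r. apply Rplus_le_compat; apply Hterm; auto.
  - intros s Hs. apply Hnear in Hs as [_ Hs]. apply (ex_series_transport m m_le A B); auto.
Qed.

Lemma rapid_Cn_transport n a b : rapid_Cn n a -> rapid_Cn n b ->
  rapid_Cn n (fun t => transport g m (a t) (b t)).
Proof.
  revert a b. induction n; intros a b Ha Hb.
  - split; auto. apply unif_rapid_transport; auto; [apply Ha|apply Hb].
  - pose proof (rapid_Cn_pred _ _ Ha) as Ha0. pose proof (rapid_Cn_pred _ _ Hb) as Hb0.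
    destruct Ha as [Ha [a' [Hda Ha']]]. destruct Hb as [Hb [b' [Hdb Hb']]].
    split; [now apply unif_rapid_transport|].
    exists (fun t k => transport g m (a' t) (b t) k + transport g m (a t) (b' t) k). split.
    + intros t k Ht. apply is_derive_transport; auto; now apply rapid_Cn_unif with n.
    + apply rapid_Cn_plus; now apply IHn.
Qed.

Section Density.
Variable c : R -> nat -> R.
Hypothesis c_sol : mode_solution g m Tm c.

Let c_unif : unif_rapid Tm c := modes_unif_rapid _ _ _ _ c_sol.

Lemma rapid_Cn_modes n : rapid_Cn n c.
Proof.
  induction n; split; auto. exists (fun t => transport g m (c t) (c t)). split.
  - apply (modes_ode _ _ _ _ c_sol).
  - now apply rapid_Cn_transport.
Qed.

Lemma modes_rapid t : t < Tm -> rapid (c t).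
Proof. now apply unif_rapid_at. Qed.

Lemma continuous_modes t k : t < Tm -> continuous (fun s => c s k) t.
Proof.
  intros Ht.
  destruct (modes_lipschitz _ _ _ _ c_sol ((t + Tm) / 2) ltac:(lra) O) as [A [HA0 HA]].
  apply continuous_of_lipschitz with ((Tm - t) / 2) A; [lra|]. intros s Hs. apply Rabs_def2 in Hs.
  apply (decay_Rabs_le 0 _ (fun k => c s k - c t k)), HA; lra.
Qed.

Lemma continuous_density_form phi be a t x : unif_rapid Tm a -> t < Tm ->
  (forall k, continuous (fun s => a s k) t) ->
  continuous (fun p : R * R => cos_series phi (a (fst p)) (snd p)
                               - be * cos_series phi (a (fst p)) 0) (t, x).
Proof.
  intros Ha Ht Hc. destruct (unif_rapid_near Tm a t 2 Ha Ht) as [d [A [Hd HA]]].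
  assert (HAp : locally (t, x) (fun p : R * R => decay 2 A (a (fst p)))).
  { exists (mkposreal d Hd). intros [s y] [Hs _]. now apply HA. }
  assert (Hcp : forall k, continuous (fun p : R * R => a (fst p) k) (t, x)).
  { intros k. apply (continuous_comp fst (fun s => a s k)); [apply continuous_fst|apply Hc]. }
  apply continuous_Rminus; [|apply continuous_Rscal];
    apply (continuous_cos_series_param phi (fun p : R * R => a (fst p)) _ (t, x) A); auto.
  - apply continuous_snd.
  - apply continuous_const.
Qed.

Lemma is_derive_density_form phi be a a' t x : unif_rapid Tm a -> unif_rapid Tm a' ->
  (forall t k, 0 < t < Tm -> is_derive (fun s => a s k) t (a' t k)) -> 0 < t < Tm ->
  is_derive (fun s => cos_series phi (a s) x - be * cos_series phi (a s) 0) t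
    (cos_series phi (a' t) x - be * cos_series phi (a' t) 0).
Proof.
  intros Ha Ha' Hd Ht.
  apply is_derive_Rminus; [|apply (is_derive_scal (fun s => cos_series phi (a s) 0))];
    now apply is_derive_cos_series_time.
Qed.

Lemma pd_density_form w : forall n, exists phi be a, rapid_Cn n a /\
  forall t x, 0 < t < Tm ->
    pd w (density c) t x = cos_series phi (a t) x - be * cos_series phi (a t) 0.
Proof.
  induction w as [|b w IH]; intros n.
  - exists 0, 1, c. split; [apply rapid_Cn_modes|]. intros t x _. simpl.
    unfold density, profile. ring.
  - destruct (IH (S n)) as [phi [be [a [Ha Hf]]]]. pose proof (rapid_Cn_unif _ _ Ha) as Hua.
    destruct b.
    + destruct Ha as [_ [a' [Hd Ha']]]. pose proof (rapid_Cn_unif _ _ Ha') as Hua'.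
      exists phi, be, a'. split; auto. intros t x Ht. simpl. unfold pdt.
      apply is_derive_unique.
      apply is_derive_ext_loc with (fun s => cos_series phi (a s) x - be * cos_series phi (a s) 0).
      * generalize (locally_interior t Ht). apply filter_imp. intros s Hs. symmetry. auto.
      * now apply is_derive_density_form.
    + exists (phi + PI / 2), 0, (fun t k => INR k * a t k).
      split; [now apply rapid_Cn_INR_mult, rapid_Cn_pred|].
      intros t x Ht. simpl. unfold pdx. apply is_derive_unique.
      apply is_derive_ext with (fun y => cos_series phi (a t) y - be * cos_series phi (a t) 0).
      { intros y. symmetry. auto. }
      rewrite Rmult_0_l, Rminus_0_r. apply is_derive_minus_const, is_derive_cos_series.
      apply (unif_rapid_at Tm); auto; lra.
Qed.

Lemma pd_density_regular w t x : 0 < t < Tm ->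
  ex_derive (fun s => pd w (density c) s x) t /\ ex_derive (fun y => pd w (density c) t y) x /\
  continuous (uncurry2 (pd w (density c))) (t, x).
Proof.
  intros Ht. destruct (pd_density_form w 1) as [phi [be [a [Ha Hf]]]].
  pose proof (rapid_Cn_unif _ _ Ha) as Hua. destruct Ha as [_ [a' [Hd [Hua' _]]]].
  pose proof (locally_interior t Ht) as Hint. split; [|split].
  - exists (cos_series phi (a' t) x - be * cos_series phi (a' t) 0).
    apply is_derive_ext_loc with (fun s => cos_series phi (a s) x - be * cos_series phi (a s) 0).
    + generalize Hint. apply filter_imp. intros s Hs. symmetry. now apply Hf.
    + now apply is_derive_density_form.
  - exists (cos_series (phi + PI / 2) (fun k => INR k * a t k) x).
    apply is_derive_ext with (fun y => cos_series phi (a t) y - be * cos_series phi (a t) 0).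
    + intros y. symmetry. now apply Hf.
    + apply is_derive_minus_const, is_derive_cos_series. apply (unif_rapid_at Tm); auto; lra.
  - eapply continuous_ext_loc; [|apply (continuous_density_form phi be a); auto; [lra|]].
    + apply (filter_imp (fun p : R * R => 0 < fst p < Tm)); [|exact (continuous_fst t x _ Hint)].
      intros [s y] Hs. symmetry. now apply Hf.
    + intros k. eapply continuous_of_is_derive. auto.
Qed.

Lemma iter_pdx_density n t x : t < Tm ->
  Nat.iter n pdx (density c) t x = cos_series (INR n * (PI / 2)) (fun k => INR k ^ n * c t k) x
    - (if Nat.eqb n 0 then 1 else 0) *
      cos_series (INR n * (PI / 2)) (fun k => INR k ^ n * c t k) 0.
Proof.
  intros Ht.
  assert (Hiter : forall x, Nat.iter n pdx (density c) t x = Derive_n (profile (c t)) n x).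
  { clear x. induction n; intros x; [reflexivity|]. simpl. now apply Derive_ext. }
  rewrite Hiter. unfold profile.
  rewrite (proj2 (cos_series_iter_derive 0 (c t) (cos_series 0 (c t) 0) n x (modes_rapid t Ht))).
  rewrite Rplus_0_l. f_equal. destruct n; simpl; [|ring].
  rewrite Rmult_0_l, Rmult_1_l. apply cos_series_ext. intros; ring.
Qed.

Lemma continuous_iter_pdx_density n t x : t < Tm ->
  continuous (uncurry2 (Nat.iter n pdx (density c))) (t, x).
Proof.
  intros Ht. eapply continuous_ext_loc; [|apply (continuous_density_form (INR n * (PI / 2))
    (if Nat.eqb n 0 then 1 else 0) (fun t k => INR k ^ n * c t k)); auto].
  - assert (Hd : 0 < Tm - t) by lra. exists (mkposreal _ Hd). intros [s y] [Hs _]. symmetry.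
    change (Rabs (s - t) < Tm - t) in Hs. apply Rabs_def2 in Hs. apply iter_pdx_density. simpl. lra.
  - intros T HT s. destruct (c_unif T HT (n + s)%nat) as [A HA]. exists A. intros t' Ht'.
    now apply decay_INR_pow_mult, HA.
  - intros k. apply continuous_Rscal. now apply continuous_modes.
Qed.

Lemma is_derive_density_time t x : 0 < t < Tm ->
  is_derive (fun s => density c s x) t (profile (transport g m (c t) (c t)) x).
Proof.
  intros Ht. apply is_derive_Rminus;
    apply (is_derive_cos_series_time 0 c (fun t => transport g m (c t) (c t))); auto;
    try apply (modes_ode _ _ _ _ c_sol); now apply unif_rapid_transport.
Qed.
End Density.
End Time.

Section TransportIdentity.
Variables (g : R) (m c : nat -> R).
Hypothesis g_pos : 0 < g.
Hypothesis m_le : forall k, Rabs (m k) <= 2.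
Hypothesis c_rapid : rapid c.
Hypothesis c_0 : c O = 0.

Let p (i : nat) := m i * c i.

Lemma ex_series_multiplier (e : nat -> R) : (forall k, Rabs (e k) <= 2) ->
  ex_series (fun i => p i * e i).
Proof.
  intros He. apply rapid_ex_series.
  pose proof (rapid_mult e p 2 He (rapid_mult m c 2 m_le c_rapid)) as Hr.
  intros s. destruct (Hr s) as [A HA]. exists A. eapply decay_ext; [|exact HA].
  intros; apply Rmult_comm.
Qed.

Lemma mode_kernel_anti_below j x :
  psum (fun k => mode_kernel_anti m c k j * (cos (INR k * x) - 1)) j =
  psum (fun i => p i * (cos (INR i * x - INR j * x) - 1)) j.
Proof.
  set (F i := p i * (cos (INR i * x - INR j * x) - 1)).
  rewrite (psum_ext _ (fun k => F (j - k)%nat)).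
  - rewrite psum_rev. assert (H : F O + psum (fun k => F (S k)) j = psum F j + F j)
      by (rewrite <- psum_head; reflexivity).
    assert (F O = 0) by (unfold F, p; rewrite c_0; ring).
    assert (F j = 0) by (unfold F; rewrite Rminus_diag, cos_0; ring). lra.
  - intros k Hk. unfold mode_kernel_anti, F. destruct (le_dec k j); [|lia].
    fold (p (j - k)%nat). do 2 f_equal. rewrite minus_INR by lia.
    replace ((INR j - INR k) * x - INR j * x) with (- (INR k * x)) by ring.
    now rewrite cos_neg.
Qed.

Lemma mode_kernel_anti_above j k : mode_kernel_anti m c (j + k) j = - p k.
Proof.
  assert (Hp0 : p O = 0) by (unfold p; rewrite c_0; ring).
  unfold mode_kernel_anti. destruct (le_dec (j + k) j).
  - assert (k = O) by lia. subst. rewrite Hp0, Nat.add_0_r, Nat.sub_diag. fold (p O).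
    rewrite Hp0. ring.
  - now replace (j + k - j)%nat with k by lia.
Qed.

Lemma Series_mode_kernel j x :
  is_series (fun k => mode_kernel m c k j * (cos (INR k * x) - 1))
    (2 * sin (INR j * x) * sin_series p x).
Proof.
  set (F i := p i * (cos (INR i * x - INR j * x) - 1)).
  set (G i := p i * (cos (INR i * x + INR j * x) - 1)).
  assert (HF : ex_series F) by (apply ex_series_multiplier; intros; apply Rabs_cos_minus_1_le).
  assert (HG : ex_series G) by (apply ex_series_multiplier; intros; apply Rabs_cos_minus_1_le).
  assert (Hplus : is_series (fun k => p (j + k)%nat * (cos (INR k * x) - 1)) (Series F - psum F j)).
  { rewrite (Series_split F j HF).
    replace (_ + _ - _) with (Series (fun k => F (j + k)%nat)) by ring.
    apply is_series_ext with (fun k => F (j + k)%nat).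
    - intros k. unfold F. rewrite plus_INR. do 3 f_equal. ring.
    - now apply Series_correct, (ex_series_incr_n F j). }
  assert (Hanti : is_series (fun k => mode_kernel_anti m c k j * (cos (INR k * x) - 1))
    (psum F j - Series G)).
  { unfold F. rewrite <- mode_kernel_anti_below.
    set (H k := mode_kernel_anti m c k j * (cos (INR k * x) - 1)).
    apply is_series_psum, (is_lim_seq_incr_n _ j).
    apply is_lim_seq_ext with (fun n => psum H j - psum G n).
    - intros n. rewrite (Nat.add_comm n), psum_split. unfold Rminus. f_equal.
      rewrite <- (Rmult_1_l (psum G n)), Ropp_mult_distr_l, <- psum_scal.
      apply psum_ext. intros k _. unfold H, G. rewrite mode_kernel_anti_above, plus_INR.
      replace ((INR j + INR k) * x) with (INR k * x + INR j * x) by ring. ring.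
    - apply is_lim_seq_minus'; [apply is_lim_seq_const|].
      now apply is_series_psum, Series_correct. }
  replace (2 * sin (INR j * x) * sin_series p x) with
    (plus (Series F - psum F j) (psum F j - Series G)).
  - eapply is_series_ext; [|apply (is_series_plus _ _ _ _ Hplus Hanti)].
    intros k. unfold mode_kernel, p, plus; simpl. ring.
  - change (plus (Series F - psum F j) (psum F j - Series G)) with
      (Series F - psum F j + (psum F j - Series G)).
    replace (Series F - psum F j + (psum F j - Series G)) with (Series F - Series G) by ring.
    rewrite <- Series_minus by auto. unfold sin_series. rewrite <- Series_scal_l.
    apply Series_ext. intros i. unfold F, G. rewrite cos_minus, cos_plus. ring.
Qed.

Lemma transport_mult_cos_minus_1 k x : transport g m c c k * (cos (INR k * x) - 1) =
  g / 2 * Series (fun j => INR j * c j * (mode_kernel m c k j * (cos (INR k * x) - 1))).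
Proof.
  destruct k.
  - simpl INR. rewrite (Rmult_0_l x), cos_0, Rminus_diag, Rmult_0_r. symmetry.
    apply Rmult_eq_0_compat_l, is_series_unique, (is_series_finite _ 0). intros; ring.
  - unfold transport. rewrite Rmult_assoc, <- Series_scal_r. f_equal.
    apply Series_ext; intros; ring.
Qed.

Lemma profile_transport x :
  profile (transport g m c c) x = g * sin_series p x * sin_series (fun j => INR j * c j) x.
Proof.
  rewrite <- (is_series_unique _ _ (profile_series _ x (rapid_transport g m g_pos m_le c c_rapid))).
  set (f j k := INR j * c j * (mode_kernel m c k j * (cos (INR k * x) - 1))).
  rewrite (Series_ext _ (fun k => g / 2 * Series (fun j => f j k)))
    by (intros; apply transport_mult_cos_minus_1).
  rewrite Series_scal_l. destruct (c_rapid 5%nat) as [A HA].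
  assert (HAA : 0 <= A * A) by nra.
  rewrite (Series_swap f (fun j => 64 * (A * A) * weight j) weight).
  - rewrite (Series_ext _ (fun j => 2 * sin_series p x * (INR j * c j * sin (INR j * x)))).
    + rewrite Series_scal_l. unfold sin_series. field.
    + intros j. unfold f. rewrite Series_scal_l, (is_series_unique _ _ (Series_mode_kernel j x)).
      ring.
  - apply ex_series_weight.
  - eapply ex_series_ext; [|apply (ex_series_weight 1)]. intros; apply Rmult_1_l.
  - intros j. pose proof (weight_pos j). nra.
  - intros k. left; apply weight_pos.
  - intros j k. unfold f. rewrite <- Rmult_assoc, Rabs_mult.
    apply le_weight; [|pose proof (weight_pos j); nra].
    pose proof (decay_transport_term m m_le 2 A A c c k j HA
      (decay_le 5 2 A A c ltac:(lia) (Rle_refl A) HA)) as Hterm.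
    pose proof (Rabs_cos_minus_1_le (INR k * x)). pose proof (Rabs_pos (cos (INR k * x) - 1)).
    rewrite <- Rmult_assoc. replace (64 * (A * A) * weight j) with
      (8 * 2 ^ 2 * (A * A) * weight j * 2) by ring.
    apply Rmult_le_compat; auto.
    apply (bracket_pow_Rabs_nonneg 2 (fun k => INR j * c j * mode_kernel m c k j)).
Qed.
End TransportIdentity.

(** * The Fourier symbol of the kernel *)

Definition continuous_on_pos (f : R -> R) : Prop := forall y, 0 < y -> continuous f y.

Lemma continuous_on_pos_mult f h :
  continuous_on_pos f -> continuous_on_pos h -> continuous_on_pos (fun y => f y * h y).
Proof. intros Hf Hh y Hy. apply continuous_Rmult; auto. Qed.

Lemma continuous_on_pos_of_continuous f : (forall y, continuous f y) -> continuous_on_pos f.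
Proof. intros Hf y _. apply Hf. Qed.

Lemma ex_RInt_on_pos f al be : continuous_on_pos f -> 0 < al -> 0 < be -> ex_RInt f al be.
Proof.
  intros Hf Ha Hb. apply ex_RInt_continuous_on. intros z Hz. apply Hf.
  apply Rlt_le_trans with (Rmin al be); [now apply Rmin_pos|apply Hz].
Qed.

Lemma is_RInt_on_pos f al be : continuous_on_pos f -> 0 < al -> 0 < be ->
  is_RInt f al be (RInt f al be).
Proof. intros. now apply is_RInt_of_ex, ex_RInt_on_pos. Qed.

Lemma RInt_Chasles_on_pos f al be ga : continuous_on_pos f -> 0 < al -> 0 < be -> 0 < ga ->
  RInt f al be + RInt f be ga = RInt f al ga.
Proof. intros. apply RInt_Chasles_R; now apply ex_RInt_on_pos. Qed.

Lemma is_derive_RInt_on_pos f al y : continuous_on_pos f -> 0 < al -> 0 < y ->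
  is_derive (fun z => RInt f al z) y (f y).
Proof.
  intros Hf Ha Hy. apply (is_derive_RInt f (fun z => RInt f al z) al y); [|now apply Hf].
  exists (mkposreal _ Hy). intros z Hz. apply is_RInt_on_pos; auto.
  change (Rabs (z - y) < y) in Hz. apply Rabs_def2 in Hz. lra.
Qed.

Lemma RInt_on_pos_le f h h' al be : continuous_on_pos f -> 0 < al <= be ->
  (forall y, 0 < y -> is_derive h y (h' y)) ->
  (forall y, al <= y <= be -> Rabs (f y) <= h' y) -> Rabs (RInt f al be) <= h be - h al.
Proof.
  intros Hf Hab Hh Hle. rewrite <- (Rminus_0_r (RInt f al be)), <- (RInt_self f al).
  apply (increment_le_of_derive_le (fun z => RInt f al z) f h h'); auto; [lra| |].
  - intros; apply is_derive_RInt_on_pos; auto; lra.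
  - intros; apply Hh; lra.
Qed.

Lemma Rabs_lim_minus_le (u : nat -> R) (l x M : R) : is_lim_seq u l ->
  eventually (fun n => Rabs (u n - x) <= M) -> Rabs (l - x) <= M.
Proof.
  intros Hu HM. apply (filterlim_Rle (F := eventually) _ (fun _ => M) _ _ HM).
  - apply filterlim_Rabs, filterlim_Rminus; [exact Hu|apply filterlim_Rconst].
  - apply filterlim_Rconst.
Qed.

Lemma filterlim_inv_sq_p_infty D :
  filterlim (fun b => D / b ^ 2) (Rbar_locally p_infty) (locally 0).
Proof.
  apply filterlim_R_eps. intros eps He. exists (1 + Rabs D / eps). intros b Hb.
  assert (HD : 0 <= Rabs D / eps) by (apply Rdiv_le_0_compat; [apply Rabs_pos|exact He]).
  assert (Hb2 : 0 < b ^ 2) by nra.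
  unfold Rdiv. rewrite Rminus_0_r, Rabs_mult, Rabs_inv, (Rabs_pos_eq (b ^ 2)) by lra.
  apply Rmult_lt_reg_r with (b ^ 2); [exact Hb2|]. rewrite Rmult_assoc, Rinv_l, Rmult_1_r by lra.
  apply Rlt_le_trans with (eps * b); [|apply Rmult_le_compat_l; [lra|simpl; nra]].
  apply Rle_lt_trans with (eps * (Rabs D / eps)); [right; field; lra|].
  apply Rmult_lt_compat_l; lra.
Qed.

Lemma ex_lim_p_infty_of_inv_sq (J : R -> R) (b0 D : R) : 0 < b0 -> 0 <= D ->
  (forall b b', b0 <= b <= b' -> Rabs (J b' - J b) <= D / b ^ 2) ->
  exists l : R, filterlim J (Rbar_locally p_infty) (locally l).
Proof.
  intros Hb0 HD HJ.
  apply (proj1 (filterlim_locally_cauchy (F := Rbar_locally p_infty) J)). intros eps.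
  pose proof (proj1 (filterlim_R_eps _ _) (filterlim_inv_sq_p_infty D) _ (cond_pos eps)) as [B HB].
  exists (fun b => Rmax B b0 < b). split; [now exists (Rmax B b0)|].
  assert (Hord : forall u v, Rmax B b0 < u -> u <= v -> Rabs (J v - J u) < eps).
  { intros u v Hu Huv. pose proof (Rmax_l B b0). pose proof (Rmax_r B b0).
    eapply Rle_lt_trans; [apply HJ; lra|]. specialize (HB u ltac:(lra)).
    rewrite Rminus_0_r in HB. eapply Rle_lt_trans; [apply Rle_abs|exact HB]. }
  intros u v Hu Hv. change (Rabs (J v - J u) < eps).
  destruct (Rle_dec u v); [now apply Hord|]. rewrite Rabs_minus_sym. apply Hord; lra.
Qed.

Lemma is_RInt_gen_of_filterlim (h : R -> R) (ep l : R) : 0 < ep -> continuous_on_pos h ->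
  filterlim (fun b => RInt h ep b) (Rbar_locally p_infty) (locally l) ->
  is_RInt_gen h (at_point ep) (Rbar_locally p_infty) l.
Proof.
  intros Hep Hh Hl P HP. destruct (Hl P HP) as [B HB].
  apply (Filter_prod _ _ _ (fun z => z = ep) (fun b => Rmax B ep < b)).
  - reflexivity.
  - now exists (Rmax B ep).
  - intros x b -> Hb. pose proof (Rmax_l B ep). pose proof (Rmax_r B ep).
    exists (RInt h ep b). split; [apply is_RInt_on_pos; auto; simpl; lra|apply HB; lra].
Qed.

Lemma is_RInt_gen_reflect (h : R -> R) (ep l : R) :
  is_RInt_gen h (at_point ep) (Rbar_locally p_infty) l ->
  is_RInt_gen (fun y => h (- y)) (Rbar_locally m_infty) (at_point (- ep)) l.
Proof.
  intros Hl P HP. destruct (Hl P HP) as [Q S HQ [B HB] HQS].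
  apply (Filter_prod _ _ _ (fun b => b < - B) (fun z => z = - ep)).
  - now exists (- B).
  - reflexivity.
  - intros b z Hb ->. destruct (HQS ep (- b) HQ (HB (- b) ltac:(lra))) as [v [Hv HPv]].
    exists v. split; [|exact HPv]. simpl in *.
    apply is_RInt_ext with (fun y => h (0 - y)); [intros; now rewrite Rminus_0_l|].
    apply is_RInt_reflect. replace (0 - - ep) with ep by ring. now rewrite Rminus_0_l.
Qed.

Section Kernel.
Variable a : R.
Hypothesis a_pos : 0 < a.

Lemma Ka_denominator_pos y : 0 < y -> 0 < PI * y * (y ^ 2 + a ^ 2).
Proof. intros Hy. pose proof PI_gt_3. apply Rmult_lt_0_compat; [nra|nra]. Qed.

Lemma Ka_pos y : 0 < y -> 0 < Ka a y.
Proof. intros Hy. apply Rdiv_lt_0_compat; [nra|now apply Ka_denominator_pos]. Qed.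

Lemma Ka_odd y : Ka a (- y) = - Ka a y.
Proof.
  unfold Ka. replace (PI * - y * ((- y) ^ 2 + a ^ 2)) with (- (PI * y * (y ^ 2 + a ^ 2))) by ring.
  apply Rdiv_opp_r.
Qed.

Lemma continuous_Ka : continuous_on_pos (Ka a).
Proof.
  intros y Hy. apply continuous_of_ex_derive. unfold Ka.
  pose proof (Ka_denominator_pos y Hy). auto_derive. lra.
Qed.

Lemma continuous_mult_Ka f : (forall y, continuous f y) ->
  continuous_on_pos (fun y => f y * Ka a y).
Proof.
  intros Hf. apply continuous_on_pos_mult; [|apply continuous_Ka].
  now apply continuous_on_pos_of_continuous.
Qed.

Lemma mult_Ka y : 0 < y -> y * Ka a y = a ^ 2 / (PI * (y ^ 2 + a ^ 2)).
Proof. intros Hy. unfold Ka. pose proof PI_gt_3. field. repeat split; nra. Qed.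

Lemma mult_Ka_decreasing y z : 0 < y <= z -> z * Ka a z <= y * Ka a y.
Proof.
  intros H. rewrite !mult_Ka by lra. pose proof PI_gt_3.
  unfold Rdiv. apply Rmult_le_compat_l; [nra|]. apply Rinv_le_contravar.
  - apply Rmult_lt_0_compat; [lra|nra].
  - apply Rmult_le_compat_l; [lra|]. nra.
Qed.

Lemma Ka_decreasing y z : 0 < y <= z -> Ka a z <= Ka a y.
Proof.
  intros H. pose proof (mult_Ka_decreasing y z H). pose proof (Ka_pos z ltac:(lra)).
  apply Rmult_le_reg_l with y; [lra|]. nra.
Qed.

Lemma mult_Ka_le y : 0 < y -> y * Ka a y <= / PI.
Proof.
  intros Hy. rewrite mult_Ka by auto. pose proof PI_gt_3.
  apply Rmult_le_reg_r with (PI * (y ^ 2 + a ^ 2)); [apply Rmult_lt_0_compat; nra|].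
  unfold Rdiv. rewrite Rmult_assoc, Rinv_l by nra. rewrite <- Rmult_assoc, Rinv_l by lra. nra.
Qed.

Lemma Ka_le_inv y : 0 < y -> Ka a y <= / y.
Proof.
  intros Hy. pose proof (mult_Ka_le y Hy). pose proof PI_inv_lt.
  apply Rmult_le_reg_l with y; [exact Hy|]. rewrite Rinv_r; lra.
Qed.

Lemma Ka_le_cube y : 0 < y -> Ka a y <= a ^ 2 / y ^ 3.
Proof.
  intros Hy. unfold Ka, Rdiv. apply Rmult_le_compat_l; [nra|]. pose proof PI_gt_3.
  apply Rinv_le_contravar; [now apply pow_lt|].
  assert (0 < y ^ 2) by nra. assert (0 < a ^ 2) by nra.
  apply Rle_trans with (y * (y ^ 2 + a ^ 2)); [simpl; nra|].
  apply Rmult_le_compat_r; [nra|]. nra.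
Qed.

Definition dKa (y : R) : R :=
  - (a ^ 2 * (PI * (3 * y ^ 2 + a ^ 2))) / (PI * y * (y ^ 2 + a ^ 2)) ^ 2.

Lemma is_derive_Ka y : 0 < y -> is_derive (Ka a) y (dKa y).
Proof.
  intros Hy. pose proof (Ka_denominator_pos y Hy). unfold Ka, dKa. auto_derive; [lra|]. field.
  pose proof PI_gt_3. repeat split; nra.
Qed.

Lemma dKa_nonpos y : 0 < y -> dKa y <= 0.
Proof.
  intros Hy. pose proof (Ka_denominator_pos y Hy). pose proof PI_gt_3. unfold dKa.
  assert (0 < / (PI * y * (y ^ 2 + a ^ 2)) ^ 2) by (apply Rinv_0_lt_compat; nra).
  assert (0 <= a ^ 2 * (PI * (3 * y ^ 2 + a ^ 2)))
    by (apply Rmult_le_pos; [nra|apply Rmult_le_pos; nra]).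
  unfold Rdiv. nra.
Qed.

Lemma RInt_mult_Ka_le f M al be : (forall y, continuous f y) -> (forall y, Rabs (f y) <= M) ->
  0 < al <= be -> Rabs (RInt (fun y => f y * Ka a y) al be) <= M * a ^ 2 / 2 / al ^ 2.
Proof.
  intros Hf HM Hab.
  assert (HM0 : 0 <= M) by (eapply Rle_trans; [apply Rabs_pos|apply (HM 0)]).
  assert (0 < al ^ 2) by nra.
  eapply Rle_trans.
  - apply (RInt_on_pos_le _ (fun y => - (M * a ^ 2 / 2) * / y ^ 2) (fun y => M * (a ^ 2 / y ^ 3)));
      auto.
    + now apply continuous_mult_Ka.
    + intros y Hy. auto_derive; [nra|]. field. lra.
    + intros y Hy. rewrite Rabs_mult. pose proof (Ka_pos y ltac:(lra)).
      rewrite (Rabs_pos_eq (Ka a y)) by lra.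
      apply Rmult_le_compat; auto; [apply Rabs_pos|lra|apply Ka_le_cube; lra].
  - assert (0 <= M * a ^ 2 / 2) by nra. assert (0 < / be ^ 2) by (apply Rinv_0_lt_compat; nra).
    unfold Rdiv at 3. nra.
Qed.

Definition sine_Ka_int (k : nat) (al be : R) : R := RInt (fun y => sin (INR k * y) * Ka a y) al be.

Lemma continuous_sin_INR k y : continuous (fun y => sin (INR k * y)) y.
Proof. apply continuous_of_ex_derive. auto_derive; auto. Qed.

Lemma continuous_sine_Ka k : continuous_on_pos (fun y => sin (INR k * y) * Ka a y).
Proof. apply continuous_mult_Ka, continuous_sin_INR. Qed.

Lemma sine_Ka_int_near_0 k al be : 0 < al <= be -> Rabs (sine_Ka_int k al be) <= INR k * be / PI.
Proof.
  intros H. pose proof (pos_INR k) as Hk. pose proof PI_inv_lt.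
  eapply Rle_trans.
  - apply (RInt_on_pos_le _ (fun y => INR k * / PI * y) (fun y => INR k * / PI)); auto.
    + apply continuous_sine_Ka.
    + intros y Hy. auto_derive; auto. ring.
    + intros y Hy. rewrite Rabs_mult. pose proof (Ka_pos y ltac:(lra)) as Hpos.
      rewrite (Rabs_pos_eq (Ka a y)) by lra.
      pose proof (Rabs_sin_le_id (INR k * y) ltac:(nra)). pose proof (mult_Ka_le y ltac:(lra)).
      apply Rle_trans with (INR k * y * Ka a y); [apply Rmult_le_compat_r; lra|].
      rewrite Rmult_assoc. apply Rmult_le_compat_l; lra.
  - unfold Rdiv. assert (0 <= INR k * / PI * al) by (apply Rmult_le_pos; [nra|lra]). lra.
Qed.

Lemma sine_Ka_int_near_infty k al be : 0 < al <= be ->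
  Rabs (sine_Ka_int k al be) <= a ^ 2 / 2 / al ^ 2.
Proof.
  intros H. rewrite <- (Rmult_1_l (a ^ 2)). apply RInt_mult_Ka_le; auto.
  - apply continuous_sin_INR.
  - intros; apply Rabs_sin_le.
Qed.

(* Integration by parts against the decreasing kernel. *)
Lemma sine_Ka_int_oscillation k al be : (1 <= k)%nat -> 0 < al <= be ->
  Rabs (sine_Ka_int k al be) <= 2 * Ka a al / INR k.
Proof.
  intros Hk H. assert (Hk1 : 1 <= INR k) by (change 1 with (INR 1); now apply le_INR).
  set (x := INR k) in *. assert (Hik : 0 < / x) by (apply Rinv_0_lt_compat; lra).
  assert (Hcos : forall z, 0 < z ->
    is_derive (fun z => cos (x * z) * Ka a z) z (- x * sin (x * z) * Ka a z + cos (x * z) * dKa z)).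
  { intros z Hz. apply (is_derive_Rmult (fun z => cos (x * z)) (Ka a)); [|now apply is_derive_Ka].
    auto_derive; auto. ring. }
  assert (Hparts : Rabs (sine_Ka_int k al be + / x * (cos (x * be) * Ka a be)
    - (0 + / x * (cos (x * al) * Ka a al))) <= / x * - Ka a be - / x * - Ka a al).
  { rewrite <- (RInt_self (fun y => sin (x * y) * Ka a y) al).
    apply (increment_le_of_derive_le
      (fun z => RInt (fun y => sin (x * y) * Ka a y) al z + / x * (cos (x * z) * Ka a z))
      (fun z => / x * (cos (x * z) * dKa z)) (fun z => / x * - Ka a z) (fun z => / x * - dKa z));
      [lra| | |].
    - intros z Hz. replace (/ x * (cos (x * z) * dKa z)) with (sin (x * z) * Ka a z
        + / x * (- x * sin (x * z) * Ka a z + cos (x * z) * dKa z)) by (field; lra).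
      apply is_derive_Rplus; [|apply (is_derive_scal (fun z => cos (x * z) * Ka a z)), Hcos; lra].
      apply (is_derive_RInt_on_pos (fun y => sin (x * y) * Ka a y));
        [apply continuous_sine_Ka|lra|lra].
    - intros z Hz. apply (is_derive_scal (fun z => - Ka a z)), is_derive_Ropp, is_derive_Ka. lra.
    - intros z Hz. pose proof (dKa_nonpos z ltac:(lra)).
      rewrite !Rabs_mult, (Rabs_pos_eq (/ x)), (Rabs_left1 (dKa z)) by lra.
      apply Rmult_le_compat_l; [lra|]. pose proof (Rabs_cos_le (x * z)). nra. }
  pose proof (Ka_pos al ltac:(lra)). pose proof (Ka_pos be ltac:(lra)).
  assert (Hbd : forall z, 0 < Ka a z -> Rabs (/ x * (cos (x * z) * Ka a z)) <= / x * Ka a z).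
  { intros z Hz. rewrite !Rabs_mult, (Rabs_pos_eq (/ x)), (Rabs_pos_eq (Ka a z)) by lra.
    apply Rmult_le_compat_l; [lra|]. pose proof (Rabs_cos_le (x * z)). nra. }
  pose proof (Hbd al ltac:(lra)) as Hal. pose proof (Hbd be ltac:(lra)) as Hbe.
  apply Rabs_le_between in Hparts, Hal, Hbe. apply Rabs_le. unfold Rdiv. lra.
Qed.

Lemma sine_Ka_int_Chasles k al be ga : 0 < al -> 0 < be -> 0 < ga ->
  sine_Ka_int k al ga = sine_Ka_int k al be + sine_Ka_int k be ga.
Proof. intros. symmetry. now apply RInt_Chasles_on_pos; [apply continuous_sine_Ka| | |]. Qed.

Lemma sine_Ka_int_le_1 k al be : 0 < al <= be -> Rabs (sine_Ka_int k al be) <= 1.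
Proof.
  intros H. pose proof PI_inv_lt.
  destruct k as [|k].
  { eapply Rle_trans; [now apply sine_Ka_int_near_0|]. simpl. unfold Rdiv. lra. }
  set (x := INR (S k)).
  assert (Hx : 1 <= x) by (unfold x; rewrite S_INR; pose proof (pos_INR k); lra).
  assert (Hix : 0 < / x) by (apply Rinv_0_lt_compat; lra).
  assert (Hnear : forall al be, 0 < al <= be -> be <= / x -> Rabs (sine_Ka_int (S k) al be) <= / 3).
  { intros al' be' H' Hb. eapply Rle_trans; [now apply sine_Ka_int_near_0|]. fold x. unfold Rdiv.
    assert (x * be' <= 1).
    { apply Rle_trans with (x * / x); [apply Rmult_le_compat_l; lra|rewrite Rinv_r; lra]. }
    nra. }
  assert (Hfar : forall al be, 0 < al <= be -> / x <= al ->
    Rabs (sine_Ka_int (S k) al be) <= 2 / 3).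
  { intros al' be' H' Hb. eapply Rle_trans; [now apply sine_Ka_int_oscillation; [lia|]|]. fold x.
    pose proof (mult_Ka_le al' ltac:(lra)). pose proof (Ka_pos al' ltac:(lra)).
    unfold Rdiv. nra. }
  destruct (Rle_dec be (/ x)) as [Hb|Hb]; [pose proof (Hnear al be H Hb); lra|].
  destruct (Rle_dec (/ x) al) as [Hal|Hal]; [pose proof (Hfar al be H Hal); lra|].
  rewrite (sine_Ka_int_Chasles _ al (/ x) be) by lra.
  pose proof (Hnear al (/ x) ltac:(lra) ltac:(lra)).
  pose proof (Hfar (/ x) be ltac:(lra) ltac:(lra)).
  eapply Rle_trans; [apply Rabs_triang|]. lra.
Qed.

Lemma sine_Ka_int_cauchy k al be al' be' : 0 < al' <= al -> al <= be -> be <= be' ->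
  Rabs (sine_Ka_int k al' be' - sine_Ka_int k al be) <= INR k * al + a ^ 2 / 2 / be ^ 2.
Proof.
  intros Hal Hab Hbe.
  rewrite (sine_Ka_int_Chasles k al' al be'), (sine_Ka_int_Chasles k al be be') by lra.
  replace (_ + _ - _) with (sine_Ka_int k al' al + sine_Ka_int k be be') by ring.
  eapply Rle_trans; [apply Rabs_triang|]. apply Rplus_le_compat.
  - eapply Rle_trans; [now apply sine_Ka_int_near_0|]. pose proof PI_inv_lt. pose proof (pos_INR k).
    unfold Rdiv. assert (0 <= INR k * al) by nra. nra.
  - apply sine_Ka_int_near_infty; lra.
Qed.

Definition symbol (k : nat) : R :=
  2 * real (Lim_seq (fun n => sine_Ka_int k (/ bracket n) (bracket n))).

Lemma symbol_lim k : is_lim_seq (fun n => sine_Ka_int k (/ bracket n) (bracket n)) (symbol k / 2).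
Proof.
  assert (Hex : ex_finite_lim_seq (fun n => sine_Ka_int k (/ bracket n) (bracket n))).
  { apply ex_lim_seq_cauchy_corr. intros eps.
    assert (HC : 0 < INR k + a ^ 2 / 2 + 1) by (pose proof (pos_INR k); nra).
    pose proof is_lim_seq_inv_bracket as Hlim. apply is_lim_seq_spec in Hlim.
    destruct (Hlim (mkposreal _ (Rdiv_lt_0_compat _ _ (cond_pos eps) HC))) as [n0 Hn0].
    assert (Hord : forall n n', (n0 <= n)%nat -> (n <= n')%nat ->
      Rabs (sine_Ka_int k (/ bracket n') (bracket n')
            - sine_Ka_int k (/ bracket n) (bracket n)) < eps).
    { intros n n' Hn Hnn. pose proof (bracket_ge_1 n) as Hb.
      destruct (Rinv_self_le _ Hb) as [Hi Hib].
      assert (Hbb : bracket n <= bracket n') by (unfold bracket; apply le_INR in Hnn; lra).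
      eapply Rle_lt_trans; [apply sine_Ka_int_cauchy; auto|].
      { split; [apply Rinv_0_lt_compat|apply Rinv_le_contravar]; lra. }
      apply Rle_lt_trans with (/ bracket n * (INR k + a ^ 2 / 2 + 1)).
      - assert (/ bracket n ^ 2 <= / bracket n) by (apply Rinv_le_contravar; nra).
        assert (a ^ 2 / 2 / bracket n ^ 2 <= a ^ 2 / 2 * / bracket n)
          by (apply Rmult_le_compat_l; nra).
        lra.
      - specialize (Hn0 n Hn). simpl in Hn0. rewrite Rminus_0_r, Rabs_pos_eq in Hn0 by lra.
        apply Rlt_le_trans with (eps / (INR k + a ^ 2 / 2 + 1) * (INR k + a ^ 2 / 2 + 1)).
        + now apply Rmult_lt_compat_r.
        + right. field. lra. }
    exists n0. intros n n' Hn Hn'. destruct (Nat.le_ge_cases n n'); [|now apply Hord].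
    rewrite Rabs_minus_sym. now apply Hord. }
  destruct Hex as [l Hl]. unfold symbol. rewrite (is_lim_seq_unique _ _ Hl). simpl.
  now replace (2 * l / 2) with l by field.
Qed.

Lemma symbol_close k al be : 0 < al <= be ->
  Rabs (2 * sine_Ka_int k al be - symbol k) <= 2 * (INR k * al + a ^ 2 / 2 / be ^ 2).
Proof.
  intros H. assert (Hia : 0 < / al) by (apply Rinv_0_lt_compat; lra).
  assert (Hhalf : Rabs (symbol k / 2 - sine_Ka_int k al be) <= INR k * al + a ^ 2 / 2 / be ^ 2).
  { apply (Rabs_lim_minus_le _ _ _ _ (symbol_lim k)).
    destruct (step_count_spec 1 (be + / al) ltac:(lra) ltac:(lra)) as [_ Hn].
    exists (step_count 1 (be + / al)). intros n Hn'.
    assert (Hq : be + / al < bracket n) by (unfold bracket; apply le_INR in Hn'; lra).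
    apply sine_Ka_int_cauchy; try lra. split; [apply Rinv_0_lt_compat; lra|].
    rewrite <- (Rinv_inv al). apply Rinv_le_contravar; lra. }
  replace (2 * sine_Ka_int k al be - symbol k) with (- 2 * (symbol k / 2 - sine_Ka_int k al be))
    by field.
  rewrite Rabs_mult, (Rabs_left (-2)) by lra. lra.
Qed.

Lemma symbol_le_2 k : Rabs (symbol k) <= 2.
Proof.
  assert (Hhalf : Rabs (symbol k / 2 - 0) <= 1).
  { apply (Rabs_lim_minus_le _ _ _ _ (symbol_lim k)). exists O. intros n _. rewrite Rminus_0_r.
    apply sine_Ka_int_le_1, Rinv_self_le, bracket_ge_1. }
  rewrite Rminus_0_r in Hhalf. replace (symbol k) with (2 * (symbol k / 2)) by field.
  rewrite Rabs_mult, Rabs_pos_eq; lra.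
Qed.

Section SineSeries.
Variables (A : nat -> R) (M : R).
Hypothesis A_decay : decay 3 M A.

Lemma bracket_mult_weight k : bracket k * Rabs (A k) <= M * weight k.
Proof. pose proof (decay_weight 1 M A A_decay k) as H. simpl in H. lra. Qed.

Lemma decay_3_2 : decay 2 M A.
Proof. apply (decay_le 3 2 M M); auto; lra. Qed.

Lemma ex_series_mult_2 (e : nat -> R) : (forall k, Rabs (e k) <= 2) ->
  ex_series (fun k => A k * e k).
Proof.
  intros He. apply decay_2_ex_series with (2 * M).
  apply decay_mult_r; auto. apply decay_3_2.
Qed.

Lemma is_RInt_sin_series_Ka al be : 0 < al <= be ->
  is_RInt (fun y => 2 * sin_series A y * Ka a y) al be
    (Series (fun k => A k * (2 * sine_Ka_int k al be))).
Proof.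
  intros H. pose proof (Ka_pos al ltac:(lra)) as HK.
  apply is_RInt_ext with (fun y => Series (fun k => A k * (2 * (sin (INR k * y) * Ka a y)))).
  { intros y _. unfold sin_series. rewrite <- Series_scal_l, <- Series_scal_r.
    apply Series_ext; intros; ring. }
  apply (is_RInt_Series_decay A (fun k y => 2 * (sin (INR k * y) * Ka a y))
    (fun k => 2 * sine_Ka_int k al be) M (2 * Ka a al)); [lra|apply decay_3_2| |].
  - intros k y Hy. pose proof (Ka_pos y ltac:(lra)). pose proof (Ka_decreasing al y ltac:(lra)).
    rewrite !Rabs_mult, (Rabs_pos_eq 2), (Rabs_pos_eq (Ka a y)) by lra.
    pose proof (Rabs_sin_le (INR k * y)). pose proof (Rabs_pos (sin (INR k * y))). nra.
  - intros k. apply is_RInt_Rscal, is_RInt_on_pos; try lra. apply continuous_sine_Ka.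
Qed.

Lemma RInt_sin_series_Ka_close al be : 0 < al <= be ->
  Rabs (RInt (fun y => 2 * sin_series A y * Ka a y) al be - Series (fun k => A k * symbol k))
  <= 4 * M * (al + a ^ 2 / 2 / be ^ 2).
Proof.
  intros H. rewrite (is_RInt_unique _ _ _ _ (is_RInt_sin_series_Ka al be H)).
  set (r := a ^ 2 / 2 / be ^ 2).
  assert (Hr : 0 <= r) by (apply Rdiv_le_0_compat; nra).
  rewrite <- Series_minus; [| |apply ex_series_mult_2, symbol_le_2].
  2: { apply ex_series_mult_2. intros k. rewrite Rabs_mult, Rabs_pos_eq by lra.
       pose proof (sine_Ka_int_le_1 k al be H). lra. }
  replace (4 * M * (al + r)) with (2 * (2 * M * (al + r))) by ring.
  rewrite <- Series_weight. apply Rabs_Series_le; [apply ex_series_weight|].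
  intros k. rewrite <- Rmult_minus_distr_l, Rabs_mult.
  pose proof (symbol_close k al be H) as Hclose. fold r in Hclose.
  pose proof (bracket_mult_weight k) as HA. pose proof (INR_le_bracket k).
  pose proof (bracket_ge_1 k).
  apply Rle_trans with (Rabs (A k) * (2 * (bracket k * (al + r)))).
  - apply Rmult_le_compat_l; [apply Rabs_pos|]. eapply Rle_trans; [exact Hclose|]. nra.
  - replace (Rabs (A k) * (2 * (bracket k * (al + r)))) with
      (2 * (al + r) * (bracket k * Rabs (A k))) by ring.
    replace (2 * M * (al + r) * weight k) with (2 * (al + r) * (M * weight k)) by ring.
    apply Rmult_le_compat_l; auto. lra.
Qed.
End SineSeries.

Lemma RInt_mult_Ka_tail f M ep : (forall y, continuous f y) -> (forall y, Rabs (f y) <= M) ->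
  0 < ep -> exists l,
  filterlim (fun b => RInt (fun y => f y * Ka a y) ep b) (Rbar_locally p_infty) (locally l) /\
  is_RInt_gen (fun y => f y * Ka a y) (at_point ep) (Rbar_locally p_infty) l.
Proof.
  intros Hf HM He. assert (HM0 : 0 <= M) by (eapply Rle_trans; [apply Rabs_pos|apply (HM 0)]).
  pose proof (continuous_mult_Ka f Hf) as Hc.
  destruct (ex_lim_p_infty_of_inv_sq (fun b => RInt (fun y => f y * Ka a y) ep b) ep
    (M * a ^ 2 / 2) He ltac:(nra)) as [l Hl].
  - intros b b' Hb. rewrite <- (RInt_Chasles_on_pos _ ep b b') by (auto; lra).
    rewrite Rplus_minus_l. apply RInt_mult_Ka_le; auto. lra.
  - exists l. split; [exact Hl|]. now apply is_RInt_gen_of_filterlim.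
Qed.

Lemma Ha_trunc_tails (f : R -> R) x v M C ep :
  (forall y, continuous f y) -> (forall y, Rabs (f y) <= M) -> 0 < ep ->
  (forall be, ep <= be -> Rabs (RInt (fun y => (f (x - y) - f (x + y)) * Ka a y) ep be - v)
    <= C * (ep + a ^ 2 / 2 / be ^ 2)) ->
  exists l r,
    is_RInt_gen (fun y => f (x - y) * Ka a y) (Rbar_locally m_infty) (at_point (- ep)) l /\
    is_RInt_gen (fun y => f (x - y) * Ka a y) (at_point ep) (Rbar_locally p_infty) r /\
    Rabs (l + r - v) <= C * ep.
Proof.
  intros Hf HM He Hv.
  assert (Hleft : forall y, continuous (fun y => f (x - y)) y)
    by (intros; now apply continuous_shift_reflect).
  assert (Hright : forall y, continuous (fun y => f (x + y)) y)
    by (intros; now apply continuous_shift).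
  destruct (RInt_mult_Ka_tail (fun y => f (x - y)) M ep Hleft ltac:(intros; apply HM) He)
    as [r [Hr Hgr]].
  destruct (RInt_mult_Ka_tail (fun y => f (x + y)) M ep Hright ltac:(intros; apply HM) He)
    as [l [Hl Hgl]].
  exists (- l), r. split; [|split; [exact Hgr|]].
  - apply is_RInt_gen_reflect, is_RInt_gen_opp in Hgl; try apply _.
    revert Hgl. apply is_RInt_gen_ext, filter_forall. intros b y _.
    change (- (f (x + - y) * Ka a (- y)) = f (x - y) * Ka a y). rewrite Ka_odd. unfold Rminus. ring.
  - rewrite (Rplus_comm (- l)). fold (r - l).
    apply (filterlim_Rle (F := Rbar_locally p_infty)
      (fun b => Rabs (RInt (fun y => f (x - y) * Ka a y) ep b
                      - RInt (fun y => f (x + y) * Ka a y) ep b - v))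
      (fun b => C * (ep + a ^ 2 / 2 / b ^ 2))).
    + exists ep. intros b Hb. eapply Rle_trans; [right|apply (Hv b); lra]. do 2 f_equal.
      symmetry. apply is_RInt_unique.
      apply is_RInt_ext with (fun y => f (x - y) * Ka a y - f (x + y) * Ka a y);
        [intros; symmetry; apply Rmult_minus_distr_r|].
      apply is_RInt_Rminus; apply is_RInt_on_pos; try lra; now apply continuous_mult_Ka.
    + apply filterlim_Rabs, filterlim_Rminus; [|apply filterlim_Rconst].
      now apply filterlim_Rminus.
    + apply filterlim_Rmult; [apply filterlim_Rconst|].
      replace ep with (ep + 0) at 1 by ring.
      apply filterlim_Rplus; [apply filterlim_Rconst|apply filterlim_inv_sq_p_infty].
Qed.

Lemma is_Ha_of_close (f : R -> R) x v M C :
  (forall y, continuous f y) -> (forall y, Rabs (f y) <= M) ->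
  (forall al be, 0 < al <= be ->
    Rabs (RInt (fun y => (f (x - y) - f (x + y)) * Ka a y) al be - v)
    <= C * (al + a ^ 2 / 2 / be ^ 2)) ->
  is_Ha a f x v.
Proof.
  intros Hf HM Hv. split.
  - intros ep He.
    destruct (Ha_trunc_tails f x v M C ep) as [l [r [Hl [Hr _]]]]; auto.
    split; [exists l|exists r]; auto.
  - assert (FF : Filter (at_right 0)) by apply within_filter, locally_filter.
    apply filterlim_R_eps. intros eps He.
    assert (HC : 0 < Rabs C + 1) by (pose proof (Rabs_pos C); lra).
    exists (mkposreal _ (Rdiv_lt_0_compat _ _ He HC)). intros ep Hep Hep0.
    change (Rabs (ep - 0) < eps / (Rabs C + 1)) in Hep.
    rewrite Rminus_0_r, Rabs_pos_eq in Hep by lra.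
    destruct (Ha_trunc_tails f x v M C ep) as [l [r [Hl [Hr Hlr]]]]; auto.
    unfold Ha_trunc. rewrite (is_RInt_gen_unique _ _ Hl), (is_RInt_gen_unique _ _ Hr).
    eapply Rle_lt_trans; [exact Hlr|]. pose proof (Rle_abs C).
    apply Rmult_lt_compat_r with (r := Rabs C + 1) in Hep; [|lra].
    replace (eps / (Rabs C + 1) * (Rabs C + 1)) with eps in Hep by (field; lra). nra.
Qed.
End Kernel.

(** * Fourier inversion *)

Lemma sin_ge_third z : 0 <= z <= 2 -> z / 3 <= sin z.
Proof.
  intros Hz.
  assert (Hcos : forall y, 0 <= y -> 0 <= cos y - 1 + y ^ 2 / 2).
  { intros y Hy. replace 0 with (cos 0 - 1 + 0 ^ 2 / 2) at 1 by (rewrite cos_0; field).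
    apply (le_of_nonneg_derive (fun t => cos t - 1 + t ^ 2 / 2) (fun t => - sin t + t)); auto.
    - intros x Hx. auto_derive; auto. field.
    - intros x Hx. pose proof (Rabs_sin_le_id x ltac:(lra)) as Hs.
      apply Rabs_le_between in Hs. lra. }
  assert (Hsin : 0 <= sin z - z + z ^ 3 / 6).
  { replace 0 with (sin 0 - 0 + 0 ^ 3 / 6) at 1 by (rewrite sin_0; field).
    apply (le_of_nonneg_derive (fun t => sin t - t + t ^ 3 / 6) (fun t => cos t - 1 + t ^ 2 / 2));
      [lra| |].
    - intros x Hx. auto_derive; auto. field.
    - intros x Hx. apply Hcos; lra. }
  assert (z ^ 3 <= 4 * z) by (simpl; nra). lra.
Qed.

Lemma sq_le_1_minus_cos y : - PI <= y <= PI -> y ^ 2 <= 18 * (1 - cos y).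
Proof.
  pose proof PI_4.
  assert (Hpos : forall y, 0 <= y <= PI -> y ^ 2 <= 18 * (1 - cos y)).
  { intros z Hz. pose proof (sin_ge_third (z / 2) ltac:(lra)) as Hs.
    replace z with (2 * (z / 2)) at 2 by field. rewrite cos_2a_sin. nra. }
  intros Hy. destruct (Rle_dec 0 y); [apply Hpos; lra|].
  specialize (Hpos (- y) ltac:(lra)). rewrite cos_neg in Hpos. lra.
Qed.

Lemma lim_seq_0_of_bounded_psum (u : nat -> R) (L B : R) :
  is_lim_seq u L -> (forall n, Rabs (psum u n) <= B) -> L = 0.
Proof.
  assert (Hnonpos : forall (u : nat -> R) (L : R),
    is_lim_seq u L -> (forall n, Rabs (psum u n) <= B) -> L <= 0).
  { clear u L. intros u L Hu HB. apply Rnot_lt_le. intros HL.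
    apply is_lim_seq_spec in Hu. assert (HL2 : 0 < L / 2) by lra.
    destruct (Hu (mkposreal _ HL2)) as [N HN]. simpl in HN.
    assert (HB0 : 0 <= B) by (eapply Rle_trans; [apply Rabs_pos|apply (HB O)]).
    destruct (step_count_spec (L / 2) (2 * B + 1) HL2 ltac:(lra)) as [_ Hi].
    set (i := S (step_count (L / 2) (2 * B + 1))).
    assert (Hsum : INR i * (L / 2) <= psum (fun k => u (N + k)%nat) i).
    { rewrite <- psum_const. apply psum_le. intros k _. specialize (HN (N + k)%nat ltac:(lia)).
      apply Rabs_def2 in HN. lra. }
    pose proof (psum_split u N i). pose proof (HB N) as HBN. pose proof (HB (N + i)%nat) as HBi.
    apply Rabs_le_between in HBN, HBi.
    unfold i in Hsum. rewrite S_INR in Hsum. fold i in Hsum. lra. }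
  intros Hu HB. apply Rle_antisym; [now apply (Hnonpos u)|].
  assert (- L <= 0); [|lra]. apply (Hnonpos (fun n => -1 * u n)).
  - replace (Finite (- L)) with (Finite (-1 * L)) by (f_equal; ring).
    apply is_lim_seq_mult'; [apply is_lim_seq_const|auto].
  - intros n. rewrite psum_scal, Rabs_mult, (Rabs_left (-1)) by lra.
    replace (- -1 * Rabs (psum u n)) with (Rabs (psum u n)) by ring. auto.
Qed.

Definition dirichlet (n : nat) (y : R) : R := 2 * psum (fun k => cos (INR k * y)) (S n) - 1.

Lemma dirichlet_telescope n y :
  (1 - cos y) * dirichlet n y = cos (INR n * y) - cos ((INR n + 1) * y).
Proof.
  unfold dirichlet. induction n.
  - simpl. rewrite !Rmult_0_l, Rplus_0_l, cos_0, Rplus_0_l, Rmult_1_l. ring.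
  - rewrite psum_S.
    replace ((1 - cos y) * (2 * (psum (fun k => cos (INR k * y)) (S n) + cos (INR (S n) * y)) - 1))
      with ((1 - cos y) * (2 * psum (fun k => cos (INR k * y)) (S n) - 1)
            + (1 - cos y) * (2 * cos (INR (S n) * y))) by ring.
    rewrite IHn, S_INR.
    replace (INR n * y) with ((INR n + 1) * y - y) by ring.
    replace ((INR n + 1 + 1) * y) with ((INR n + 1) * y + y) by ring.
    rewrite cos_minus, cos_plus. ring.
Qed.

Lemma fejer_identity M y : (1 - cos y) * psum (fun n => dirichlet n y) M = 1 - cos (INR M * y).
Proof.
  induction M.
  - simpl. rewrite Rmult_0_l, cos_0. ring.
  - rewrite psum_S, Rmult_plus_distr_l, IHM, dirichlet_telescope, S_INR. ring.
Qed.

Lemma RInt_periodic_shift (h : R -> R) x : (forall y, continuous h y) -> periodic2pi h ->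
  RInt (fun y => h (x + y)) (- PI) PI = RInt h (- PI) PI.
Proof.
  intros Hc Hp. pose (G z := RInt h 0 (PI + z) - RInt h 0 (- PI + z)).
  assert (HG : forall z, RInt h (- PI + z) (PI + z) = G z).
  { intros z. unfold G. rewrite <- (RInt_Chasles_R h 0 (- PI + z) (PI + z)); [lra| |];
      now apply ex_RInt_of_continuous. }
  assert (Hlin : RInt (fun y => h (x + y)) (- PI) PI = RInt h (- PI + x) (PI + x)).
  { apply is_RInt_unique. apply is_RInt_ext with (fun y => scal 1 (h (1 * y + x))).
    - intros y _. change (1 * h (1 * y + x) = h (x + y)).
      now rewrite !Rmult_1_l, (Rplus_comm y x).
    - apply (is_RInt_comp_lin h 1 x). rewrite !Rmult_1_l. now apply is_RInt_of_continuous. }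
  rewrite Hlin, HG, (constant_of_derive_0 G) with (y := 0).
  - now rewrite <- HG, !Rplus_0_r.
  - intros z. replace 0 with (1 * h (PI + z) - 1 * h (- PI + z)).
    2: { replace (PI + z) with (- PI + z + 2 * PI) by ring. rewrite Hp. ring. }
    apply is_derive_Rminus; apply (is_derive_comp (fun b => RInt h 0 b));
      try (now apply is_derive_RInt_of_continuous); auto_derive; auto.
Qed.

Lemma RInt_even_interval (h : R -> R) : (forall y, continuous h y) ->
  RInt (fun y => h (- y)) (- PI) PI = RInt h (- PI) PI.
Proof.
  intros Hc. apply is_RInt_unique.
  apply is_RInt_ext with (fun y => h (0 - y)); [intros; now rewrite Rminus_0_l|].
  apply is_RInt_reflect. rewrite Rminus_0_l. replace (0 - - PI) with PI by ring.
  now apply is_RInt_of_continuous.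
Qed.

Definition cos_coef (h : R -> R) (phi : R) (k : nat) : R :=
  RInt (fun x => h x * cos (INR k * x + phi)) (- PI) PI.

Lemma continuous_cos_phase k phi x : continuous (fun x => cos (INR k * x + phi)) x.
Proof. apply continuous_of_ex_derive. auto_derive; auto. Qed.

Lemma is_RInt_cos_coef h phi k : (forall y, continuous h y) ->
  is_RInt (fun x => h x * cos (INR k * x + phi)) (- PI) PI (cos_coef h phi k).
Proof.
  intros Hh. apply is_RInt_of_continuous. intros y.
  apply continuous_Rmult; [apply Hh|apply continuous_cos_phase].
Qed.

Lemma cos_coef_1_0 : cos_coef (fun _ => 1) 0 0 = 2 * PI.
Proof.
  unfold cos_coef. rewrite (RInt_ext _ (fun _ => 1)).
  - rewrite RInt_const. change ((PI - - PI) * 1 = 2 * PI). ring.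
  - intros. simpl. rewrite Rmult_0_l, Rplus_0_l, cos_0. ring.
Qed.

Section Inversion.
Variable f : R -> R.
Hypothesis f_smooth : smooth_per f.

Lemma is_derive_Derive_n n x : is_derive (Derive_n f n) x (Derive_n f (S n) x).
Proof. apply Derive_correct. apply (proj1 (proj2 f_smooth) (S n) x). Qed.

Lemma continuous_Derive_n n x : continuous (Derive_n f n) x.
Proof. eapply continuous_of_is_derive. apply is_derive_Derive_n. Qed.

Lemma continuous_smooth x : continuous f x.
Proof. apply (continuous_Derive_n 0). Qed.

Lemma Derive_n_periodic n : periodic2pi (Derive_n f n).
Proof.
  intros x. rewrite <- Derive_n_comp_trans. apply Derive_n_ext. apply (proj1 f_smooth).
Qed.

Lemma cos_coef_by_parts n phi k :
  INR k * cos_coef (Derive_n f n) phi k = cos_coef (Derive_n f (S n)) (phi + PI / 2) k.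
Proof.
  set (B x := Derive_n f n x * sin (INR k * x + phi)).
  assert (HB : forall x, is_derive B x
    (Derive_n f (S n) x * sin (INR k * x + phi)
     + Derive_n f n x * (INR k * cos (INR k * x + phi)))).
  { intros x. apply (is_derive_Rmult (Derive_n f n) (fun x => sin (INR k * x + phi)));
      [apply is_derive_Derive_n|]. auto_derive; auto. ring. }
  assert (HI : is_RInt (fun x => Derive_n f (S n) x * sin (INR k * x + phi)
    + Derive_n f n x * (INR k * cos (INR k * x + phi))) (- PI) PI (B PI - B (- PI))).
  { apply (is_RInt_derive B); [intros; apply HB|].
    intros x _. apply continuous_Rplus; apply continuous_Rmult; try apply continuous_Derive_n.
    - apply continuous_of_ex_derive. auto_derive; auto.
    - apply continuous_Rscal, continuous_cos_phase. }
  replace (B PI - B (- PI)) with 0 in HI.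
  2: { unfold B. replace (INR k * PI + phi) with (INR k * - PI + phi + 2 * INR k * PI) by ring.
       rewrite sin_period. pose proof (Derive_n_periodic n (- PI)) as Hper.
       replace (- PI + 2 * PI) with PI in Hper by ring. rewrite Hper. ring. }
  symmetry. apply is_RInt_unique.
  rewrite <- (Rminus_0_r (INR k * _)).
  eapply is_RInt_ext; [|apply is_RInt_Rminus; [apply is_RInt_Rscal, is_RInt_cos_coef|exact HI]].
  - intros x _. simpl. replace (INR k * x + (phi + PI / 2)) with (PI / 2 + (INR k * x + phi))
      by ring.
    rewrite (sin_cos (INR k * x + phi)). ring.
  - apply continuous_Derive_n.
Qed.

Lemma cos_coef_iter_parts s phi k :
  INR k ^ s * cos_coef f phi k = cos_coef (Derive_n f s) (phi + INR s * (PI / 2)) k.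
Proof.
  revert phi. induction s; intros phi.
  - simpl. rewrite Rmult_0_l, Rplus_0_r, Rmult_1_l. reflexivity.
  - simpl pow. rewrite Rmult_assoc, IHs, cos_coef_by_parts. f_equal. rewrite S_INR. ring.
Qed.

Lemma cos_coef_rapid phi : rapid (cos_coef f phi).
Proof.
  assert (Hmoment : forall s, exists B, forall k, INR k ^ s * Rabs (cos_coef f phi k) <= B).
  { intros s. destruct (proj2 (proj2 f_smooth) s) as [M HM]. exists ((PI - - PI) * M). intros k.
    rewrite <- (Rabs_pos_eq (INR k ^ s)), <- Rabs_mult, cos_coef_iter_parts
      by apply pow_le, pos_INR.
    eapply is_RInt_Rabs_le; [|apply is_RInt_cos_coef, continuous_Derive_n|].
    - pose proof PI_gt_3; lra.
    - intros y _. cbv beta. rewrite Rabs_mult. specialize (HM y).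
      pose proof (Rabs_cos_le (INR k * y + (phi + INR s * (PI / 2)))).
      pose proof (Rabs_pos (Derive_n f s y)). nra. }
  intros s. destruct (Hmoment s) as [B HB]. destruct (Hmoment O) as [B0 HB0].
  exists (2 ^ s * (B + B0)). intros k.
  assert (Hpow : bracket k ^ s <= 2 ^ s * (INR k ^ s + 1 ^ s))
    by (apply pow_add_le; [apply pos_INR|lra]).
  rewrite pow1 in Hpow. specialize (HB k). specialize (HB0 k). simpl in HB0.
  rewrite Rmult_1_l in HB0.
  apply Rle_trans with (2 ^ s * (INR k ^ s + 1) * Rabs (cos_coef f phi k)).
  - apply Rmult_le_compat_r; [apply Rabs_pos|auto].
  - rewrite Rmult_assoc. apply Rmult_le_compat_l; [apply pow_le; lra|]. lra.
Qed.

Hypothesis f_even : forall x, f (- x) = f x.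

Lemma sine_coef_even k : is_RInt (fun z => f z * sin (INR k * z)) (- PI) PI 0.
Proof.
  set (h z := f z * sin (INR k * z)).
  assert (Hc : forall y, continuous h y).
  { intros y. apply continuous_Rmult; [apply continuous_smooth|apply continuous_sin_INR]. }
  replace 0 with (RInt h (- PI) PI); [now apply is_RInt_of_continuous|].
  assert (Hodd : RInt h (- PI) PI = -1 * RInt h (- PI) PI); [|lra].
  rewrite <- (RInt_even_interval h Hc) at 1. apply is_RInt_unique.
  apply is_RInt_ext with (fun y => -1 * h y); [|now apply is_RInt_Rscal, is_RInt_of_continuous].
  intros y _. unfold h. rewrite f_even, Ropp_mult_distr_r_reverse, sin_neg. lra.
Qed.

Lemma is_RInt_shift_cos k x :
  is_RInt (fun y => f (x + y) * cos (INR k * y)) (- PI) PI (cos (INR k * x) * cos_coef f 0 k).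
Proof.
  set (h z := f z * cos (INR k * z + - (INR k * x))).
  assert (Hc : forall y, continuous h y).
  { intros y. apply continuous_Rmult; [apply continuous_smooth|apply continuous_cos_phase]. }
  replace (cos (INR k * x) * cos_coef f 0 k) with (RInt (fun y => h (x + y)) (- PI) PI).
  - apply is_RInt_ext with (fun y => h (x + y)).
    + intros y _. unfold h. do 2 f_equal. ring.
    + apply is_RInt_of_continuous. intros. now apply continuous_shift.
  - rewrite RInt_periodic_shift; auto.
    + apply is_RInt_unique.
      replace (_ * cos_coef f 0 k) with
        (cos (INR k * x) * cos_coef f 0 k + sin (INR k * x) * 0) by ring.
      eapply is_RInt_ext; [|apply is_RInt_Rplus; apply is_RInt_Rscal;
        [apply is_RInt_cos_coef, continuous_smooth|apply (sine_coef_even k)]].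
      intros z _. unfold h. simpl.
      change (INR k * z + - (INR k * x)) with (INR k * z - INR k * x).
      rewrite Rplus_0_r, cos_minus. ring.
    + intros y. unfold h. rewrite (proj1 f_smooth). f_equal.
      replace (INR k * (y + 2 * PI) + - (INR k * x)) with
        (INR k * y + - (INR k * x) + 2 * INR k * PI) by ring.
      apply cos_period.
Qed.

Definition sym_increment (x y : R) : R := (f (x + y) + f (x - y)) / 2 - f x.

Lemma is_derive_sym_increment x z : is_derive (sym_increment x) z
  ((Derive_n f 1 (x + z) - Derive_n f 1 (x - z)) / 2).
Proof.
  assert (Hf : forall z, is_derive f z (Derive_n f 1 z)) by (intros; apply (is_derive_Derive_n 0)).
  unfold sym_increment. auto_derive.
  - split; [eexists; apply Hf|split; [eexists; apply Hf|auto]].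
  - change (fun x0 : R => f x0) with f. fold (x - z).
    rewrite (is_derive_unique f _ _ (Hf (x + z))), (is_derive_unique f _ _ (Hf (x - z))). field.
Qed.

Lemma sym_increment_le x : exists C, 0 <= C /\
  forall y, - PI <= y <= PI -> Rabs (sym_increment x y) <= C * (1 - cos y).
Proof.
  destruct (proj2 (proj2 f_smooth) 2%nat) as [M HM].
  assert (HM0 : 0 <= M) by (eapply Rle_trans; [apply Rabs_pos|apply (HM 0)]).
  exists (18 * M). split; [lra|].
  assert (Hpos : forall y, 0 <= y -> Rabs (sym_increment x y) <= M * y ^ 2).
  { intros y Hy. replace (sym_increment x y) with (sym_increment x y - sym_increment x 0)
      by (unfold sym_increment at 2; rewrite Rplus_0_r, Rminus_0_r; field).
    replace (M * y ^ 2) with (M * y ^ 2 - M * 0 ^ 2) by ring.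
    apply (increment_le_of_derive_le (sym_increment x)
      (fun z => (Derive_n f 1 (x + z) - Derive_n f 1 (x - z)) / 2) (fun z => M * z ^ 2)
      (fun z => M * (2 * z))); auto.
    - intros; apply is_derive_sym_increment.
    - intros z Hz. auto_derive; auto. ring.
    - intros z Hz.
      assert (Hlip : Rabs (Derive_n f 1 (x + z) - Derive_n f 1 (x - z)) 
        <= M * (x + z) - M * (x - z)).
      { apply (increment_le_of_derive_le _ (Derive_n f 2) (fun t => M * t) (fun _ => M));
          [lra| | |].
        - intros; apply (is_derive_Derive_n 1).
        - intros; auto_derive; auto; ring.
        - intros; apply HM. }
      unfold Rdiv. rewrite Rabs_mult, (Rabs_pos_eq (/ 2)) by lra.
      assert (0 <= M * z) by (apply Rmult_le_pos; lra). lra. }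
  intros y Hy. pose proof (sq_le_1_minus_cos y Hy) as Hq.
  assert (Rabs (sym_increment x y) <= M * y ^ 2); [|nra].
  destruct (Rle_dec 0 y); [now apply Hpos|].
  replace (sym_increment x y) with (sym_increment x (- y)).
  - replace (y ^ 2) with ((- y) ^ 2) by ring. apply Hpos; lra.
  - unfold sym_increment. replace (x + - y) with (x - y) by ring.
    replace (x - - y) with (x + y) by ring. field.
Qed.

Lemma is_RInt_sym_increment_cos k x :
  is_RInt (fun y => sym_increment x y * cos (INR k * y)) (- PI) PI
    (cos (INR k * x) * cos_coef f 0 k - f x * cos_coef (fun _ => 1) 0 k).
Proof.
  assert (Hminus : is_RInt (fun y => f (x - y) * cos (INR k * y)) (- PI) PI
    (cos (INR k * x) * cos_coef f 0 k)).
  { apply is_RInt_ext with (fun y => (fun z => f (x + z) * cos (INR k * z)) (0 - y)).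
    - intros y _. cbv beta. rewrite Rminus_0_l, Ropp_mult_distr_r_reverse, cos_neg. reflexivity.
    - apply (is_RInt_reflect (fun z => f (x + z) * cos (INR k * z))).
      rewrite Rminus_0_l. replace (0 - - PI) with PI by ring. apply is_RInt_shift_cos. }
  pose proof (is_RInt_cos_coef (fun _ => 1) 0 k ltac:(intros; apply continuous_const)) as Hone.
  set (v := cos (INR k * x) * cos_coef f 0 k) in *.
  replace (v - _) with (/ 2 * (v + v) - f x * cos_coef (fun _ => 1) 0 k) by field.
  eapply is_RInt_ext; [|apply is_RInt_Rminus;
    [apply is_RInt_Rscal, is_RInt_Rplus; [apply is_RInt_shift_cos|exact Hminus]
    |apply is_RInt_Rscal; exact Hone]].
  intros y _. simpl. unfold sym_increment. rewrite Rplus_0_r. field.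
Qed.

Lemma cos_coef_1 k : (1 <= k)%nat -> cos_coef (fun _ => 1) 0 k = 0.
Proof.
  intros Hk. assert (Hk1 : 1 <= INR k) by (change 1 with (INR 1); now apply le_INR).
  apply is_RInt_unique. apply is_RInt_ext with (fun y => cos (INR k * y)).
  { intros. now rewrite Rplus_0_r, Rmult_1_l. }
  replace 0 with (sin (INR k * PI) / INR k - sin (INR k * - PI) / INR k).
  - apply (is_RInt_derive (fun y => sin (INR k * y) / INR k)).
    + intros x _. auto_derive; auto. field. lra.
    + intros x _. apply continuous_of_ex_derive. auto_derive; auto.
  - rewrite Ropp_mult_distr_r_reverse, sin_neg, sin_INR_mult_PI. field. lra.
Qed.

Definition dirichlet_error (x : R) (n : nat) : R :=
  2 * psum (fun k => cos (INR k * x) * cos_coef f 0 k) (S n) - cos_coef f 0 0 - 2 * PI * f x.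

Lemma is_RInt_dirichlet n x :
  is_RInt (fun y => sym_increment x y * dirichlet n y) (- PI) PI (dirichlet_error x n).
Proof.
  set (I k := cos (INR k * x) * cos_coef f 0 k - f x * cos_coef (fun _ => 1) 0 k).
  assert (Hsum : forall i, is_RInt
    (fun y => psum (fun k => sym_increment x y * cos (INR k * y)) (S i))
    (- PI) PI (psum (fun k => cos (INR k * x) * cos_coef f 0 k) (S i) - f x * (2 * PI))).
  { intros i. replace (_ - f x * (2 * PI)) with (psum I (S i)).
    - rewrite (psum_ext I (fun k => RInt (fun y => sym_increment x y * cos (INR k * y)) (- PI) PI))
        by (intros; symmetry; apply is_RInt_unique, is_RInt_sym_increment_cos).
      apply is_RInt_psum. intros k. eexists. apply is_RInt_sym_increment_cos.
    - unfold I. rewrite psum_minus, psum_scal, (psum_head (cos_coef (fun _ => 1) 0)), cos_coef_1_0.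
      rewrite (psum_0 (fun k => cos_coef _ 0 (S k))) by (intros; apply cos_coef_1; lia). ring. }
  unfold dirichlet_error.
  replace (_ - cos_coef f 0 0 - 2 * PI * f x) with
    (2 * (psum (fun k => cos (INR k * x) * cos_coef f 0 k) (S n) - f x * (2 * PI))
     - (psum (fun k => cos (INR k * x) * cos_coef f 0 k) 1 - f x * (2 * PI))).
  2: { simpl (psum _ 1). rewrite Rmult_0_l, cos_0. ring. }
  eapply is_RInt_ext; [|apply is_RInt_Rminus; [apply is_RInt_Rscal|]; apply Hsum].
  intros y _. cbv beta. unfold dirichlet. rewrite !psum_scal. simpl (psum _ 1).
  rewrite Rmult_0_l, cos_0. lra.
Qed.

(* Fejer means of [sym_increment x] stay bounded since it is [O(1 - cos y)]; hence its
   Dirichlet means, which converge, converge to [0]. *)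
Lemma fourier_inversion x :
  2 * Series (fun k => cos (INR k * x) * cos_coef f 0 k) = cos_coef f 0 0 + 2 * PI * f x.
Proof.
  destruct (sym_increment_le x) as [C [HC0 HC]]. pose proof PI_gt_3.
  apply Rminus_diag_uniq.
  apply (lim_seq_0_of_bounded_psum (dirichlet_error x) _ (2 * PI * (2 * C))).
  - unfold Rminus. rewrite Ropp_plus_distr, <- Rplus_assoc.
    apply is_lim_seq_minus'; [|apply is_lim_seq_const].
    apply is_lim_seq_minus'; [|apply is_lim_seq_const].
    apply is_lim_seq_mult'; [apply is_lim_seq_const|].
    apply (is_lim_seq_incr_1 (psum (fun k => cos (INR k * x) * cos_coef f 0 k))).
    apply is_series_psum, Series_correct, rapid_ex_series.
    apply rapid_mult with 1; [intros; apply Rabs_cos_le|apply cos_coef_rapid].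
  - intros M. replace (2 * PI * (2 * C)) with ((PI - - PI) * (2 * C)) by ring.
    apply (is_RInt_Rabs_le (fun y => psum (fun n => sym_increment x y * dirichlet n y) M));
      [lra| |].
    + rewrite (psum_ext (dirichlet_error x)
        (fun n => RInt (fun y => sym_increment x y * dirichlet n y) (- PI) PI))
        by (intros; symmetry; apply is_RInt_unique, is_RInt_dirichlet).
      apply is_RInt_psum. intros n. eexists. apply is_RInt_dirichlet.
    + intros y Hy. rewrite psum_scal, Rabs_mult. specialize (HC y Hy).
      pose proof (COS_bound y). pose proof (COS_bound (INR M * y)).
      pose proof (f_equal Rabs (fejer_identity M y)) as HF.
      rewrite Rabs_mult, (Rabs_pos_eq (1 - cos y)), (Rabs_pos_eq (1 - cos (INR M * y))) in HF
        by lra.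
      set (P := Rabs (psum (fun n => dirichlet n y) M)) in *.
      apply Rle_trans with (C * ((1 - cos y) * P)).
      * rewrite <- Rmult_assoc. apply Rmult_le_compat_r; [apply Rabs_pos|exact HC].
      * rewrite HF. nra.
Qed.

Lemma even_smooth_is_profile : exists c, c O = 0 /\ rapid c /\ forall x, f x - f 0 = profile c x.
Proof.
  pose (c := fun k => (match k with O => 0 | S _ => / PI end) * cos_coef f 0 k).
  pose proof PI_inv_lt as HPI.
  assert (Hrapid : rapid c).
  { apply rapid_mult with (/ PI); [|apply cos_coef_rapid].
    intros [|k]; [rewrite Rabs_R0|rewrite Rabs_pos_eq]; lra. }
  exists c. split; [apply Rmult_0_l|split; [exact Hrapid|]]. intros x.
  assert (Hser : forall z, Series (fun k => cos (INR k * z) * cos_coef f 0 k)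
    = cos_coef f 0 0 + PI * cos_series 0 c z).
  { intros z. rewrite Series_incr_1.
    2: apply rapid_ex_series, rapid_mult with 1; [intros; apply Rabs_cos_le|apply cos_coef_rapid].
    simpl (INR 0). rewrite Rmult_0_l, cos_0, Rmult_1_l. f_equal.
    unfold cos_series. rewrite (Series_incr_1 (fun k => c k * _)) by now apply ex_series_cos.
    unfold c. rewrite !Rmult_0_l, Rplus_0_l, <- Series_scal_l.
    apply Series_ext. intros k. rewrite Rplus_0_r. field. apply PI_neq0. }
  pose proof (fourier_inversion x) as Hx. pose proof (fourier_inversion 0) as Hzero.
  rewrite Hser in Hx, Hzero. unfold profile. apply Rmult_eq_reg_l with (2 * PI); [lra|].
  pose proof PI_neq0; lra.
Qed.
End Inversion.

(** * Monotone profiles *)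

Lemma periodic_shift (f : R -> R) n x : periodic2pi f -> f (x + INR n * (2 * PI)) = f x.
Proof.
  intros Hp. induction n; [f_equal; simpl; ring|].
  rewrite S_INR. replace (x + (INR n + 1) * (2 * PI)) with (x + INR n * (2 * PI) + 2 * PI) by ring.
  now rewrite Hp.
Qed.

Lemma even_periodic_reflect (f : R -> R) x : periodic2pi f -> (forall y, f (- y) = f y) ->
  f (2 * PI - x) = f x.
Proof. intros Hp He. rewrite <- (He x), <- (Hp (- x)). f_equal. ring. Qed.

Lemma even_periodic_reduce (f : R -> R) x : periodic2pi f -> (forall y, f (- y) = f y) ->
  exists y, 0 <= y <= PI /\ f x = f y.
Proof.
  intros Hp He. pose proof PI_gt_3.
  assert (Hpos : forall x, 0 <= x -> exists y, 0 <= y <= PI /\ f x = f y).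
  { clear x. intros x Hx. pose proof (step_count_spec (2 * PI) x ltac:(lra) Hx) as Hn.
    set (n := step_count (2 * PI) x) in *. set (z := x - INR n * (2 * PI)).
    assert (Hz : f x = f z) by (rewrite <- (periodic_shift f n z Hp); f_equal; unfold z; ring).
    assert (0 <= z < 2 * PI) by (unfold z; lra).
    destruct (Rle_dec z PI); [exists z; split; auto; lra|].
    exists (2 * PI - z). split; [lra|]. now rewrite even_periodic_reflect. }
  destruct (Rle_dec 0 x); [auto|]. rewrite <- He. apply Hpos. lra.
Qed.

Lemma Linf_bounds (f : R -> R) M : (forall x, Rabs (f x) <= M) ->
  (forall x, Rabs (f x) <= Linf f) /\ Linf f <= M.
Proof.
  intros HM. unfold Linf.
  destruct (Lub_Rbar_correct (fun y => exists x, y = Rabs (f x))) as [Hub Hlub].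
  assert (Hle : Rbar_le (Lub_Rbar (fun y => exists x, y = Rabs (f x))) M).
  { apply Hlub. intros y [x ->]. apply HM. }
  pose proof (Hub (Rabs (f 0)) (ex_intro _ 0 eq_refl)) as Hge.
  destruct (Lub_Rbar _) as [l| |]; simpl in *; try contradiction.
  split; auto. intros x. apply (Hub (Rabs (f x)) (ex_intro _ x eq_refl)).
Qed.

Lemma Linf_contraction (f h : R -> R) M d :
  (forall x, Rabs (f x) <= M) -> (forall x, Rabs (h x) <= M) ->
  (forall x, Rabs (f x - h x) <= d) -> Rabs (Linf f - Linf h) <= d.
Proof.
  assert (Hone : forall f h, (forall x, Rabs (h x) <= M) -> (forall x, Rabs (f x - h x) <= d) ->
    Linf f <= Linf h + d).
  { clear f h. intros f h Hh Hd. apply (Linf_bounds f). intros x.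
    pose proof (proj1 (Linf_bounds h M Hh) x). specialize (Hd x).
    replace (f x) with (h x + (f x - h x)) by ring.
    eapply Rle_trans; [apply Rabs_triang|lra]. }
  intros Hf Hh Hd. apply Rabs_le.
  pose proof (Hone f h Hh Hd). pose proof (Hone h f Hf ltac:(intros; rewrite Rabs_minus_sym; auto)).
  lra.
Qed.

Definition clamp (p q x : R) : R := Rmax p (Rmin q x).

Lemma clamp_bounds p q x : p <= q -> p <= clamp p q x <= q.
Proof. intros H. unfold clamp. split; [apply Rmax_l|apply Rmax_lub; [exact H|apply Rmin_l]]. Qed.

Lemma clamp_id p q x : p <= x <= q -> clamp p q x = x.
Proof. intros H. unfold clamp. rewrite Rmin_right, Rmax_right; lra. Qed.

Lemma clamp_contraction p q x y : Rabs (clamp p q x - clamp p q y) <= Rabs (x - y).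
Proof.
  unfold clamp, Rmax, Rmin. destruct (Rle_dec q x), (Rle_dec q y); repeat destruct Rle_dec;
    apply Rabs_le_between; split; unfold Rabs; destruct Rcase_abs; lra.
Qed.

Lemma exists_min_interval (f : R -> R) p q : p <= q -> (forall x, continuous f x) ->
  exists x, p <= x <= q /\ forall y, p <= y <= q -> f x <= f y.
Proof.
  intros Hpq Hf. destruct (continuity_ab_min f p q Hpq) as [x [Hmin Hx]].
  - intros y _. apply continuity_pt_filterlim, Hf.
  - now exists x.
Qed.

Lemma exists_min_rectangle (w : R -> R -> R) s1 s2 p q : s1 <= s2 -> p <= q ->
  (forall s x, s1 <= s <= s2 -> p <= x <= q -> continuous (uncurry2 w) (s, x)) ->
  exists s0 x0, s1 <= s0 <= s2 /\ p <= x0 <= q /\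
    forall s x, s1 <= s <= s2 -> p <= x <= q -> w s0 x0 <= w s x.
Proof.
  intros Hs Hpq Hw. set (W s x := w (clamp s1 s2 s) (clamp p q x)).
  assert (Hunif : forall eps : posreal, exists d : posreal, forall s x s' x',
    Rabs (s' - s) < d -> Rabs (x' - x) < d -> Rabs (W s' x' - W s x) < eps).
  { intros eps. destruct (uniform_continuity_2d w s1 s2 p q) with (eps := eps) as [d Hd].
    - intros s x Hs' Hx. apply continuity_2d_pt_filterlim. now apply Hw.
    - exists d. intros s x s' x' Hss Hxx. apply Hd; first
        [now apply clamp_bounds|eapply Rle_lt_trans; [apply clamp_contraction|assumption]]. }
  assert (HWx : forall s x, continuous (W s) x).
  { intros s x. apply filterlim_R_eps. intros eps He.
    destruct (Hunif (mkposreal _ He)) as [d Hd]. exists d. intros y Hy. apply Hd; [|exact Hy].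
    rewrite Rminus_diag, Rabs_R0. apply cond_pos. }
  assert (Hargmin : forall s, exists x, p <= x <= q /\ forall y, p <= y <= q -> W s x <= W s y).
  { intros s. apply exists_min_interval; auto. }
  destruct (choice _ Hargmin) as [X HX].
  destruct (exists_min_interval (fun s => W s (X s)) s1 s2 Hs) as [s0 [Hs0 Hmin]].
  { intros s. apply filterlim_R_eps. intros eps He.
    destruct (Hunif (mkposreal _ He)) as [d Hd]. exists d. intros s' Hs'.
    destruct (HX s) as [Xs Hle]. destruct (HX s') as [Xs' Hle'].
    specialize (Hle _ Xs'). specialize (Hle' _ Xs).
    assert (Hclose : forall x, Rabs (W s' x - W s x) < eps).
    { intros x. apply Hd; [exact Hs'|]. rewrite Rminus_diag, Rabs_R0. apply cond_pos. }
    pose proof (Hclose (X s)) as HXs. pose proof (Hclose (X s')) as HXs'.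
    apply Rabs_def2 in HXs, HXs'. apply Rabs_def1; lra. }
  exists s0, (X s0). split; [exact Hs0|split; [apply HX|]]. intros s x Hs' Hx.
  specialize (Hmin s Hs'). specialize (proj2 (HX s) x Hx). unfold W in *.
  rewrite !clamp_id in * by (auto; apply HX). lra.
Qed.

Lemma derive_0_of_interior_min (f : R -> R) (p q x l : R) : p < x < q -> is_derive f x l ->
  (forall y, p < y < q -> f x <= f y) -> l = 0.
Proof.
  intros Hx Hf Hmin. apply is_derive_Reals in Hf.
  apply (deriv_minimum f p q x (exist _ l Hf)); auto; lra.
Qed.

(* At a negative minimum of [exp (- (L + 1) t) * w] the transport term vanishes and the time
   derivative is positive. *)
Lemma transport_minimum_principle (w wx b v : R -> R -> R) T p q L : 0 <= T -> p < q ->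
  (forall t x, 0 <= t <= T -> p <= x <= q -> continuous (uncurry2 w) (t, x)) ->
  (forall t x, 0 < t <= T -> p < x < q -> is_derive (w t) x (wx t x)) ->
  (forall t x, 0 < t <= T -> p < x < q ->
    is_derive (fun s => w s x) t (- (b t x * w t x + v t x * wx t x))) ->
  (forall t x, 0 < t <= T -> p < x < q -> Rabs (b t x) <= L) ->
  (forall x, p <= x <= q -> 0 <= w 0 x) -> (forall t, 0 <= t <= T -> 0 <= w t p /\ 0 <= w t q) ->
  forall x, p <= x <= q -> 0 <= w T x.
Proof.
  intros HT Hpq Hc Hwx Hwt HL Hinit Hends x Hx. apply Rnot_lt_le. intros Hneg.
  set (e t := exp (- (L + 1) * t)). assert (He : forall t, 0 < e t) by (intros; apply exp_pos).
  destruct (exists_min_rectangle (fun t x => e t * w t x) 0 T p q HT ltac:(lra))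
    as [t0 [x0 [Ht0 [Hx0 Hmin]]]].
  { intros t y Ht Hy. apply (continuous_Rmult (fun z => e (fst z)) (uncurry2 w)); auto.
    apply (continuous_comp fst e); [apply continuous_fst|].
    apply continuous_of_ex_derive. unfold e. auto_derive; auto. }
  assert (Hneg0 : w t0 x0 < 0).
  { specialize (Hmin T x ltac:(lra) Hx). pose proof (He T). pose proof (He t0). nra. }
  assert (Htpos : 0 < t0).
  { destruct (Req_dec t0 0) as [E|]; [|lra]. rewrite E in Hneg0. specialize (Hinit x0 Hx0). lra. }
  assert (Hinside : p < x0 < q).
  { specialize (Hends t0 Ht0). split; apply Rnot_le_lt; intros Hle.
    - replace x0 with p in Hneg0; lra.
    - replace x0 with q in Hneg0; lra. }
  assert (Hcrit : wx t0 x0 = 0).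
  { apply (derive_0_of_interior_min (w t0) p q x0); [exact Hinside|apply Hwx; lra|].
    intros y Hy. apply Rmult_le_reg_l with (e t0); [apply He|]. apply Hmin; lra. }
  specialize (HL t0 x0 ltac:(lra) Hinside). specialize (Hwt t0 x0 ltac:(lra) Hinside).
  rewrite Hcrit in Hwt. apply Rabs_le_between in HL.
  assert (Hd : is_derive (fun s => e s * w s x0) t0 (e t0 * ((- b t0 x0 - (L + 1)) * w t0 x0))).
  { replace (e t0 * _) with
      (- (L + 1) * e t0 * w t0 x0 + e t0 * - (b t0 x0 * w t0 x0 + v t0 x0 * 0)) by ring.
    apply (is_derive_Rmult e (fun s => w s x0)); [|exact Hwt]. unfold e. auto_derive; auto. ring. }
  destruct (exists_lt_left_of_derive_pos _ _ _ Hd) as [s [Hs Hlt]]; [|exact Htpos|].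
  - apply Rmult_lt_0_compat; [apply He|nra].
  - specialize (Hmin s x0 ltac:(lra) Hx0). lra.
Qed.

Definition lap (c : nat -> R) (k : nat) : R := INR k * (INR k * c k).

Lemma decay_lap s A c : decay (S (S s)) A c -> decay s A (lap c).
Proof. intros H. now apply decay_INR_mult, decay_INR_mult. Qed.

Lemma rapid_lap c : rapid c -> rapid (lap c).
Proof. intros H. now apply rapid_INR_mult, rapid_INR_mult. Qed.

Definition velocity (a : R) (c : nat -> R) (x : R) : R := sin_series (fun k => symbol a k * c k) x.
Definition velocity_x (a : R) (c : nat -> R) (x : R) : R :=
  cos_series 0 (fun k => INR k * (symbol a k * c k)) x.
Definition slope (c : nat -> R) (x : R) : R := - sin_series (fun k => INR k * c k) x.
Definition curvature (c : nat -> R) (x : R) : R := - cos_series 0 (lap c) x.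

Lemma profile_even c x : profile c (- x) = profile c x.
Proof. unfold profile. now rewrite cos_series_even. Qed.

Lemma profile_periodic c : periodic2pi (profile c).
Proof. intros x. unfold profile. now rewrite cos_series_periodic. Qed.

Lemma profile_0 c : profile c 0 = 0.
Proof. unfold profile. ring. Qed.

Lemma profile_ext c d x : (forall k, c k = d k) -> profile c x = profile d x.
Proof. intros H. unfold profile. now rewrite !(cos_series_ext 0 c d). Qed.

Lemma slope_0 c : slope c 0 = 0.
Proof. unfold slope. rewrite sin_series_0. ring. Qed.

Lemma slope_PI c : slope c PI = 0.
Proof. unfold slope. rewrite sin_series_PI. ring. Qed.

Lemma slope_ext c d x : (forall k, c k = d k) -> slope c x = slope d x.
Proof. intros H. unfold slope. f_equal. apply Series_ext. intros k. now rewrite H. Qed.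

Lemma slope_cos_series c x : slope c x = cos_series (PI / 2) (fun k => INR k * c k) x.
Proof. symmetry. apply cos_series_sin. Qed.

Section Profile.
Variable c : nat -> R.
Hypothesis c_rapid : rapid c.

Lemma is_derive_profile x : is_derive (profile c) x (slope c x).
Proof. apply is_derive_minus_const. now apply is_derive_cos_series_sin. Qed.

Lemma is_derive_slope x : is_derive (slope c) x (curvature c x).
Proof. apply is_derive_Ropp, is_derive_sin_series. now apply rapid_INR_mult. Qed.

Lemma continuous_profile x : continuous (profile c) x.
Proof. eapply continuous_of_is_derive. apply is_derive_profile. Qed.

Lemma continuous_slope x : continuous (slope c) x.
Proof. eapply continuous_of_is_derive. apply is_derive_slope. Qed.

Lemma profile_bounded : bounded_fun (profile c).
Proof.
  destruct (c_rapid 2%nat) as [A HA]. exists (2 * A + 2 * A). intros x. unfold profile.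
  eapply Rle_trans; [apply Rabs_triang|]. rewrite Rabs_Ropp.
  apply Rplus_le_compat; now apply cos_series_le.
Qed.

Lemma profile_reflect_minus x y :
  profile c (x - y) - profile c (x + y) = 2 * sin_series (fun k => c k * sin (INR k * x)) y.
Proof.
  unfold profile, sin_series. rewrite <- Series_scal_l.
  replace (_ - _) with (cos_series 0 c (x - y) - cos_series 0 c (x + y)) by ring. unfold cos_series.
  rewrite <- Series_minus by now apply ex_series_cos. apply Series_ext. intros k.
  rewrite !Rplus_0_r, Rmult_minus_distr_l, Rmult_plus_distr_l, cos_minus, cos_plus. ring.
Qed.

Lemma slope_reflect_minus x y :
  slope c (x - y) - slope c (x + y) = 2 * sin_series (fun k => INR k * c k * cos (INR k * x)) y.
Proof.
  unfold slope. replace (_ - _) with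
    (sin_series (fun k => INR k * c k) (x + y) - sin_series (fun k => INR k * c k) (x - y)) by ring.
  unfold sin_series. rewrite <- Series_scal_l.
  rewrite <- Series_minus by (apply ex_series_sin; now apply rapid_INR_mult).
  apply Series_ext. intros k.
  rewrite Rmult_minus_distr_l, Rmult_plus_distr_l, sin_minus, sin_plus. ring.
Qed.

Lemma profile_incr_of_slope_nonneg : (forall x, 0 <= x <= PI -> 0 <= slope c x) ->
  forall x y, 0 <= x <= y -> y <= PI -> profile c x <= profile c y.
Proof.
  intros Hslope x y Hxy Hy. apply (le_of_nonneg_derive (profile c) (slope c)); [lra| |].
  - intros; apply is_derive_profile.
  - intros; apply Hslope; lra.
Qed.

Lemma profile_nonneg_of_slope_nonneg : (forall x, 0 <= x <= PI -> 0 <= slope c x) ->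
  forall x, 0 <= profile c x.
Proof.
  intros Hslope x.
  destruct (even_periodic_reduce _ x (profile_periodic c) (profile_even c)) as [y [Hy ->]].
  rewrite <- (profile_0 c). apply profile_incr_of_slope_nonneg; auto; lra.
Qed.

Variable a : R.
Hypothesis a_pos : 0 < a.

Lemma rapid_symbol_mult : rapid (fun k => symbol a k * c k).
Proof. apply rapid_mult with 2; [now apply symbol_le_2|exact c_rapid]. Qed.

Lemma is_derive_velocity x : is_derive (velocity a c) x (velocity_x a c x).
Proof. apply is_derive_sin_series, rapid_symbol_mult. Qed.

Lemma velocity_close A x al be : decay 3 A c -> 0 < al <= be ->
  Rabs (RInt (fun y => (profile c (x - y) - profile c (x + y)) * Ka a y) al be - velocity a c x)
  <= 4 * A * (al + a ^ 2 / 2 / be ^ 2).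
Proof.
  intros HA Hab.
  rewrite (RInt_ext _ (fun y => 2 * sin_series (fun k => c k * sin (INR k * x)) y * Ka a y))
    by (intros; now rewrite profile_reflect_minus).
  unfold velocity, sin_series at 2.
  rewrite (Series_ext _ (fun k => c k * sin (INR k * x) * symbol a k)) by (intros; ring).
  apply RInt_sin_series_Ka_close; auto. apply decay_mult_le_1; auto. intros; apply Rabs_sin_le.
Qed.

Lemma is_Ha_profile x : is_Ha a (profile c) x (velocity a c x).
Proof.
  destruct (c_rapid 3%nat) as [A HA]. destruct profile_bounded as [M HM].
  apply (is_Ha_of_close a a_pos _ _ _ M (4 * A)); auto.
  - intros; apply continuous_profile.
  - intros; now apply velocity_close.
Qed.

End Profile.

Section Transported.
Variables (a g : R) (c : nat -> R).
Hypothesis a_pos : 0 < a.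
Hypothesis g_pos : 0 < g.
Hypothesis c_rapid : rapid c.
Hypothesis c_0 : c O = 0.

Lemma profile_transport_velocity x :
  profile (transport g (symbol a) c c) x = - (g * velocity a c x * slope c x).
Proof.
  rewrite (profile_transport g (symbol a) c g_pos (symbol_le_2 a a_pos) c_rapid c_0).
  unfold velocity, slope. ring.
Qed.

Lemma slope_transport_velocity x : slope (transport g (symbol a) c c) x =
  - (g * velocity_x a c x * slope c x + g * velocity a c x * curvature c x).
Proof.
  pose proof (rapid_transport g _ g_pos (symbol_le_2 a a_pos) c c_rapid) as Hrapid.
  rewrite <- (is_derive_unique _ _ _ (is_derive_profile _ Hrapid x)). apply is_derive_unique.
  apply is_derive_ext with (fun y => - (g * (velocity a c y * slope c y))).
  { intros y. rewrite profile_transport_velocity. lra. }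
  replace (- (_ + _)) with
    (- (g * (velocity_x a c x * slope c x + velocity a c x * curvature c x))) by ring.
  apply is_derive_Ropp. apply (is_derive_scal (fun y => velocity a c y * slope c y)).
  apply is_derive_Rmult; [now apply is_derive_velocity|now apply is_derive_slope].
Qed.
End Transported.

Section Evolution.
Variables (a g Tm : R) (c : R -> nat -> R).
Hypothesis a_pos : 0 < a.
Hypothesis g_pos : 0 < g.
Hypothesis c_sol : mode_solution g (symbol a) Tm c.

Let c_unif : unif_rapid Tm c := modes_unif_rapid _ _ _ _ c_sol.

Let c_rapid : forall t, t < Tm -> rapid (c t) := modes_rapid _ _ _ _ c_sol.

Lemma pdx_density t x : t < Tm -> pdx (density c) t x = slope (c t) x.
Proof. intros Ht. now apply is_derive_unique, is_derive_profile, c_rapid. Qed.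

Lemma is_derive_density_velocity t x : 0 < t < Tm ->
  is_derive (fun s => density c s x) t (- (g * velocity a (c t) x * slope (c t) x)).
Proof.
  intros Ht. rewrite <- (profile_transport_velocity a g (c t) a_pos g_pos).
  - now apply (is_derive_density_time g (symbol a) g_pos (symbol_le_2 a a_pos) Tm c c_sol).
  - apply c_rapid; lra.
  - apply (modes_zero _ _ _ _ c_sol); lra.
Qed.

Lemma is_derive_slope_time t x : 0 < t < Tm ->
  is_derive (fun s => slope (c s) x) t
    (- (g * velocity_x a (c t) x * slope (c t) x + g * velocity a (c t) x * curvature (c t) x)).
Proof.
  intros Ht.
  rewrite <- slope_transport_velocity;
    [|exact a_pos|exact g_pos|apply c_rapid; lra|apply (modes_zero _ _ _ _ c_sol); lra].
  rewrite slope_cos_series. apply is_derive_ext with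
    (fun s => cos_series (PI / 2) (fun k => INR k * c s k) x);
      [intros; symmetry; apply slope_cos_series|].
  apply (is_derive_cos_series_time Tm (PI / 2) (fun s k => INR k * c s k)
    (fun s k => INR k * transport g (symbol a) (c s) (c s) k)); auto.
  - now apply unif_rapid_INR_mult.
  - apply unif_rapid_INR_mult, unif_rapid_transport; auto. now apply symbol_le_2.
  - intros s k Hs. apply (is_derive_scal (fun s => c s k)). now apply (modes_ode _ _ _ _ c_sol).
Qed.

Lemma continuous_slope_modes t x : t < Tm -> continuous (uncurry2 (fun s => slope (c s))) (t, x).
Proof.
  intros Ht. eapply continuous_ext;
    [|apply (continuous_density_form Tm (PI / 2) 0 (fun s k => INR k * c s k) t x); auto].
  - intros [s y]. unfold uncurry2. simpl. rewrite slope_cos_series. ring.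
  - now apply unif_rapid_INR_mult.
  - intros k. apply continuous_Rscal. now apply (continuous_modes _ _ _ _ c_sol).
Qed.

Lemma slope_unif_bounded T : T < Tm -> exists M, forall t x, t <= T -> Rabs (slope (c t) x) <= M.
Proof.
  intros HT. destruct (c_unif T HT 3%nat) as [A HA]. exists (2 * A). intros t x Ht.
  unfold slope. rewrite Rabs_Ropp. apply sin_series_le, decay_INR_mult. auto.
Qed.

Lemma slope_lipschitz T : T < Tm -> exists A, forall t t' x, t <= T -> t' <= T ->
  Rabs (slope (c t') x - slope (c t) x) <= A * Rabs (t' - t).
Proof.
  intros HT. destruct (modes_lipschitz _ _ _ _ c_sol T HT 3%nat) as [A [HA0 HA]]. exists (2 * A).
  intros t t' x Ht Ht'. specialize (HA t t' Ht Ht'). rewrite !slope_cos_series.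
  rewrite <- cos_series_minus by (apply rapid_INR_mult, c_rapid; lra).
  rewrite (cos_series_ext _ _ (fun k => INR k * (c t' k - c t k))) by (intros; ring).
  rewrite Rmult_assoc. now apply cos_series_le, decay_INR_mult.
Qed.

Lemma velocity_x_unif_bounded T : T < Tm ->
  exists L, forall t x, t <= T -> Rabs (velocity_x a (c t) x) <= L.
Proof.
  intros HT. destruct (c_unif T HT 3%nat) as [A HA]. exists (2 * (2 * A)). intros t x Ht.
  apply cos_series_le, decay_INR_mult, decay_mult; auto. now apply symbol_le_2.
Qed.

Lemma slope_le_Linf t x : t < Tm -> Rabs (slope (c t) x) <= Linf (pdx (density c) t).
Proof.
  intros Ht. destruct (slope_unif_bounded t Ht) as [M HM]. rewrite <- pdx_density by auto.
  apply (Linf_bounds _ M). intros y. rewrite pdx_density by auto. apply HM. lra.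
Qed.

Lemma continuous_Linf_pdx t : t < Tm -> continuous (fun s => Linf (pdx (density c) s)) t.
Proof.
  intros Ht. assert (HT : (t + Tm) / 2 < Tm) by lra.
  destruct (slope_lipschitz _ HT) as [A HA]. destruct (slope_unif_bounded _ HT) as [M HM].
  apply continuous_of_lipschitz with ((Tm - t) / 2) A; [lra|]. intros s Hs. apply Rabs_def2 in Hs.
  apply (Linf_contraction _ _ M); intros x; rewrite !pdx_density by lra;
    [apply HM|apply HM|apply HA]; lra.
Qed.

Lemma ex_RInt_Linf_pdx t t' : t < Tm -> t' < Tm -> ex_RInt (fun s => Linf (pdx (density c) s)) t t'.
Proof.
  intros Ht Ht'. apply ex_RInt_continuous_on. intros s Hs. apply continuous_Linf_pdx.
  eapply Rle_lt_trans; [apply Hs|]. now apply Rmax_lub_lt.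
Qed.

Hypothesis init_slope : forall x, 0 <= x <= PI -> 0 <= slope (c 0) x.

Lemma slope_nonneg t : 0 <= t < Tm -> forall x, 0 <= x <= PI -> 0 <= slope (c t) x.
Proof.
  intros Ht. destruct (velocity_x_unif_bounded t ltac:(lra)) as [L HL]. pose proof PI_gt_3.
  apply (transport_minimum_principle (fun s => slope (c s)) (fun s => curvature (c s))
    (fun s x => g * velocity_x a (c s) x) (fun s x => g * velocity a (c s) x) t 0 PI (g * L)).
  - lra.
  - lra.
  - intros s x Hs _. apply continuous_slope_modes; lra.
  - intros s x Hs _. apply is_derive_slope, c_rapid; lra.
  - intros s x Hs _. apply is_derive_slope_time; lra.
  - intros s x Hs _. rewrite Rabs_mult, (Rabs_pos_eq g) by lra.
    apply Rmult_le_compat_l; [lra|]. apply HL; lra.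
  - exact init_slope.
  - intros s _. rewrite slope_0, slope_PI. lra.
Qed.
End Evolution.

(** * Finite time blow-up *)

Section Folding.
Variables D K : R -> R.
Hypothesis D_continuous : forall y, continuous D y.
Hypothesis D_periodic : periodic2pi D.
Hypothesis D_odd : forall y, D (- y) = - D y.
Hypothesis D_nonneg : forall y, 0 <= y <= PI -> 0 <= D y.
Hypothesis K_continuous : continuous_on_pos K.
Hypothesis K_decreasing : forall y z, 0 < y <= z -> K z <= K y.

Lemma continuous_odd_mult_kernel : continuous_on_pos (fun y => D y * K y).
Proof. apply continuous_on_pos_mult; [now apply continuous_on_pos_of_continuous|exact K_continuous].
Qed.

Definition folded (p y : R) : R := D y * (K y - K (2 * p - y)).

Lemma continuous_folded p y : 0 < y <= p -> continuous (folded p) y.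
Proof.
  intros Hy. apply continuous_Rmult; [apply D_continuous|].
  apply continuous_Rminus; [apply K_continuous; lra|].
  apply (continuous_comp (fun y => 2 * p - y) K); [|apply K_continuous; lra].
  apply continuous_of_ex_derive. auto_derive; auto.
Qed.

Lemma ex_RInt_folded p al : 0 < al <= p -> ex_RInt (folded p) al p.
Proof.
  intros Hal. apply ex_RInt_continuous_on. intros y Hy. rewrite Rmin_left, Rmax_right in Hy by lra.
  apply continuous_folded. lra.
Qed.

Lemma RInt_fold p al : 0 < al <= p -> (forall y, D (2 * p - y) = - D y) ->
  RInt (fun y => D y * K y) al (2 * p - al) = RInt (folded p) al p.
Proof.
  intros Hal Hrefl. pose proof continuous_odd_mult_kernel as HDK.
  rewrite <- (RInt_Chasles_on_pos _ al p (2 * p - al) HDK) by lra.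
  assert (Hright : is_RInt (fun y => - (D y * K (2 * p - y))) al p
    (RInt (fun y => D y * K y) p (2 * p - al))).
  { apply is_RInt_ext with (fun y => (fun z => D z * K z) (2 * p - y)).
    - intros y _. rewrite Hrefl. lra.
    - apply (is_RInt_reflect (fun z => D z * K z)). replace (2 * p - p) with p by ring.
      apply is_RInt_on_pos; auto; lra. }
  symmetry. apply is_RInt_unique. eapply is_RInt_ext;
    [|apply is_RInt_Rplus; [apply is_RInt_on_pos; [exact HDK|lra|lra]|exact Hright]].
  intros y _. unfold folded. simpl. lra.
Qed.

Lemma odd_reflect n y : D (INR n * (2 * PI) - y) = - D y.
Proof.
  replace (INR n * (2 * PI) - y) with (- y + INR n * (2 * PI)) by ring.
  now rewrite periodic_shift.
Qed.

Definition odd_multiple_PI (n : nat) : R := PI * (2 * INR n + 1).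

Lemma odd_reflect_odd_multiple n y : D (2 * odd_multiple_PI n - y) = - D y.
Proof.
  rewrite <- (odd_reflect (2 * n + 1)). f_equal. unfold odd_multiple_PI.
  rewrite plus_INR, mult_INR. simpl. ring.
Qed.

Lemma folded_nonneg n y : INR n * (2 * PI) <= y <= odd_multiple_PI n -> 0 < y ->
  0 <= folded (odd_multiple_PI n) y.
Proof.
  intros Hy Hpos. unfold odd_multiple_PI in *. apply Rmult_le_pos.
  - replace y with (y - INR n * (2 * PI) + INR n * (2 * PI)) by ring.
    rewrite periodic_shift by auto. apply D_nonneg. lra.
  - assert (K (2 * (PI * (2 * INR n + 1)) - y) <= K y) by (apply K_decreasing; lra). lra.
Qed.

Lemma RInt_periods_nonneg n :
  0 <= RInt (fun y => D y * K y) (2 * PI) ((INR n + 1) * (2 * PI)).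
Proof.
  pose proof PI_gt_3 as HP. pose proof continuous_odd_mult_kernel as HDK. induction n.
  - simpl INR. rewrite Rplus_0_l, Rmult_1_l, RInt_self. lra.
  - pose proof (pos_INR n) as Hn. rewrite S_INR. set (al := (INR n + 1) * (2 * PI)) in *.
    assert (Hal : 0 < al) by (apply Rmult_lt_0_compat; lra).
    assert (Hp : odd_multiple_PI (S n) = al + PI).
    { unfold odd_multiple_PI, al. rewrite S_INR. ring. }
    replace ((INR n + 1 + 1) * (2 * PI)) with (2 * odd_multiple_PI (S n) - al)
      by (rewrite Hp; unfold al; ring).
    rewrite <- (RInt_Chasles_on_pos _ (2 * PI) al _ HDK) by lra.
    apply Rplus_le_le_0_compat; [exact IHn|].
    rewrite RInt_fold by (try apply odd_reflect_odd_multiple; lra).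
    apply RInt_nonneg; [lra|apply ex_RInt_folded; lra|]. intros y Hy.
    apply folded_nonneg; [|lra]. rewrite S_INR. fold al. lra.
Qed.
End Folding.

Lemma Ka_fold_gap a y : 0 < a -> 0 < y <= PI / 2 -> 2 / 3 * Ka a y <= Ka a y - Ka a (2 * PI - y).
Proof.
  intros Ha Hy. pose proof (Ka_decreasing a Ha (3 * y) (2 * PI - y) ltac:(lra)).
  pose proof (mult_Ka_decreasing a y (3 * y) ltac:(lra)).
  assert (3 * Ka a (3 * y) <= Ka a y) by (apply Rmult_le_reg_l with y; lra). lra.
Qed.

Definition velocity_gain (a : R) : R := / 3 * (PI / 2 * Ka a (PI / 2)).

Lemma velocity_gain_pos a : 0 < a -> 0 < velocity_gain a.
Proof.
  intros Ha. unfold velocity_gain. pose proof PI_gt_3.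
  pose proof (Ka_pos a Ha (PI / 2) ltac:(lra)). apply Rmult_lt_0_compat; [lra|].
  apply Rmult_lt_0_compat; lra.
Qed.

Section VelocityBound.
Variables (a : R) (c : nat -> R) (x mu : R).
Hypothesis a_pos : 0 < a.
Hypothesis c_rapid : rapid c.
Hypothesis profile_incr : forall x y, 0 <= x <= y -> y <= PI -> profile c x <= profile c y.
Hypothesis x_inside : 0 < x < PI.
Hypothesis mu_range : 0 < mu <= / 4.
Hypothesis mu_le : mu * x <= PI - x.

Let increment (y : R) : R := profile c (x + y) - profile c (x - y).
Let local_gap : R := profile c x - profile c ((1 - mu) * x).

Lemma continuous_increment y : continuous increment y.
Proof.
  apply continuous_Rminus; [apply continuous_shift|apply continuous_shift_reflect];
    now apply continuous_profile.
Qed.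

Lemma increment_periodic : periodic2pi increment.
Proof.
  intros y. unfold increment. rewrite <- Rplus_assoc, profile_periodic.
  rewrite <- (profile_periodic c (x - (y + 2 * PI))). do 2 f_equal. ring.
Qed.

Lemma increment_odd y : increment (- y) = - increment y.
Proof.
  unfold increment. replace (x + - y) with (x - y) by ring. replace (x - - y) with (x + y) by ring.
  ring.
Qed.

Lemma profile_le_folded y z : 0 <= y <= z -> y <= 2 * PI - z -> profile c y <= profile c z.
Proof.
  intros Hy Hz. destruct (Rle_dec z PI); [apply profile_incr; lra|].
  rewrite <- (even_periodic_reflect _ z (profile_periodic c) (profile_even c)).
  apply profile_incr; lra.
Qed.

Lemma increment_nonneg y : 0 <= y <= PI -> 0 <= increment y.
Proof.
  intros Hy. unfold increment. assert (profile c (x - y) <= profile c (x + y)); [|lra].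
  destruct (Rle_dec 0 (x - y)).
  - apply profile_le_folded; lra.
  - rewrite <- (profile_even c (x - y)). apply profile_le_folded; lra.
Qed.

Lemma increment_ge_local_gap y : mu * x <= y <= 2 * (mu * x) -> local_gap <= increment y.
Proof.
  intros Hy. unfold local_gap, increment. assert (0 < mu * x) by nra.
  assert (mu * x <= x / 4) by nra.
  pose proof (profile_le_folded x (x + y) ltac:(lra) ltac:(lra)).
  pose proof (profile_incr (x - y) ((1 - mu) * x) ltac:(lra) ltac:(lra)). lra.
Qed.

Lemma local_gap_nonneg : 0 <= local_gap.
Proof.
  unfold local_gap. assert (0 < mu * x) by nra. assert (mu * x <= x / 4) by nra.
  pose proof (profile_incr ((1 - mu) * x) x ltac:(lra) ltac:(lra)). lra.
Qed.

Lemma RInt_first_period_ge ep : 0 < ep < mu * x ->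
  velocity_gain a * local_gap <= RInt (fun y => increment y * Ka a y) ep (2 * PI - ep).
Proof.
  intros Hep. pose proof PI_gt_3. pose proof local_gap_nonneg as Hgap.
  assert (Hmx : mu * x <= x / 4) by nra.
  assert (Hp : odd_multiple_PI 0 = PI) by (unfold odd_multiple_PI; simpl; ring).
  rewrite RInt_fold; [|apply continuous_increment|now apply continuous_Ka|lra|].
  2: { intros y. rewrite <- Hp. apply odd_reflect_odd_multiple; [apply increment_periodic|].
       apply increment_odd. }
  apply Rle_trans with ((2 * (mu * x) - mu * x) * (local_gap * (2 / 3 * Ka a (2 * (mu * x))))).
  - pose proof (mult_Ka_decreasing a (2 * (mu * x)) (PI / 2) ltac:(lra)).
    unfold velocity_gain. nra.
  - apply RInt_ge_on_subinterval; try lra.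
    + intros y Hy. apply continuous_folded;
        [apply continuous_increment|now apply continuous_Ka|lra].
    + intros y Hy. rewrite <- Hp. apply folded_nonneg; try lra.
      * apply increment_periodic.
      * apply increment_nonneg.
      * now apply Ka_decreasing.
      * rewrite Hp. simpl. lra.
    + intros y Hy. pose proof (Ka_pos a a_pos (2 * (mu * x)) ltac:(lra)).
      pose proof (Ka_decreasing a a_pos y (2 * (mu * x)) ltac:(lra)).
      pose proof (Ka_fold_gap a y a_pos ltac:(lra)). unfold folded.
      apply Rmult_le_compat; try lra. now apply increment_ge_local_gap.
Qed.

Lemma RInt_increment_short_ge M al be : (forall y, Rabs (profile c y) <= M) -> PI <= al <= be ->
  - (2 * M * Ka a PI * (be - al)) <= RInt (fun y => increment y * Ka a y) al be.
Proof.
  intros HM Hal. pose proof PI_gt_3.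
  replace (- _) with ((be - al) * (- (2 * M) * Ka a PI)) by ring. apply RInt_ge_const; [lra| |].
  - apply ex_RInt_on_pos; [|lra|lra]. apply continuous_mult_Ka; auto. apply continuous_increment.
  - intros y Hy. pose proof (HM (x + y)) as Hplus. pose proof (HM (x - y)) as Hminus.
    apply Rabs_le_between in Hplus, Hminus.
    pose proof (Ka_pos a a_pos y ltac:(lra)). pose proof (Ka_decreasing a a_pos PI y ltac:(lra)).
    apply Rle_trans with (- (2 * M) * Ka a y); [nra|]. unfold increment.
    apply Rmult_le_compat_r; lra.
Qed.

Lemma RInt_increment_ge M ep n : (forall y, Rabs (profile c y) <= M) -> 0 < ep < mu * x ->
  velocity_gain a * local_gap - 2 * M * Ka a PI * ep <=
  RInt (fun y => increment y * Ka a y) ep ((INR n + 1) * (2 * PI)).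
Proof.
  intros HM Hep. pose proof PI_gt_3. pose proof (pos_INR n). assert (mu * x <= x / 4) by nra.
  assert (Hc : continuous_on_pos (fun y => increment y * Ka a y)).
  { apply continuous_mult_Ka; auto. apply continuous_increment. }
  assert (0 < (INR n + 1) * (2 * PI)) by (apply Rmult_lt_0_compat; lra).
  rewrite <- (RInt_Chasles_on_pos _ ep (2 * PI - ep) _ Hc) by lra.
  rewrite <- (RInt_Chasles_on_pos _ (2 * PI - ep) (2 * PI) _ Hc) by lra.
  pose proof (RInt_first_period_ge ep Hep).
  pose proof (RInt_increment_short_ge M (2 * PI - ep) (2 * PI) HM ltac:(lra)).
  pose proof (RInt_periods_nonneg increment (Ka a) continuous_increment increment_periodic
    increment_odd increment_nonneg (continuous_Ka a) (Ka_decreasing a a_pos) n).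
  lra.
Qed.

Lemma velocity_upper_approx A M ep : decay 3 A c -> (forall y, Rabs (profile c y) <= M) ->
  0 < ep < mu * x -> velocity a c x <=
    - (velocity_gain a * local_gap) + (2 * M * Ka a PI + 4 * A * (1 + a ^ 2 / 2)) * ep.
Proof.
  intros HA HM Hep. pose proof PI_gt_3. assert (HA0 := decay_nonneg _ _ _ HA).
  assert (mu * x <= x / 4) by nra.
  pose proof (proj2 (step_count_spec ep 1 ltac:(lra) ltac:(lra))) as Hn.
  set (n := step_count ep 1) in *. set (b := (INR n + 1) * (2 * PI)).
  assert (Hb : 1 <= ep * b /\ 1 <= b).
  { pose proof (pos_INR n). unfold b. split; nra. }
  assert (Hinv : a ^ 2 / 2 / b ^ 2 <= a ^ 2 / 2 * ep).
  { unfold Rdiv at 1. apply Rmult_le_compat_l; [nra|].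
    apply Rmult_le_reg_r with (b ^ 2); [nra|]. rewrite Rinv_l by nra. nra. }
  pose proof (RInt_increment_ge M ep n HM Hep) as Hge. fold b in Hge.
  assert (Hepb : ep <= b) by (destruct (Rle_dec ep 1); [lra|unfold b; pose proof (pos_INR n); nra]).
  pose proof (velocity_close c c_rapid a a_pos A x ep b HA ltac:(lra)) as Hclose.
  replace (RInt (fun y => (profile c (x - y) - profile c (x + y)) * Ka a y) ep b) with
    (- RInt (fun y => increment y * Ka a y) ep b) in Hclose.
  2: { symmetry. apply is_RInt_unique.
       apply is_RInt_ext with (fun y => -1 * (increment y * Ka a y)).
       - intros y _. unfold increment. lra.
       - replace (- RInt _ ep b) with (-1 * RInt (fun y => increment y * Ka a y) ep b) by ring.
         apply is_RInt_Rscal, is_RInt_on_pos; [|lra|lra].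
         apply continuous_mult_Ka; auto. apply continuous_increment. }
  apply Rabs_le_between in Hclose.
  assert (4 * A * (ep + a ^ 2 / 2 / b ^ 2) <= 4 * A * (ep + a ^ 2 / 2 * ep))
    by (apply Rmult_le_compat_l; lra).
  lra.
Qed.

Lemma velocity_upper :
  velocity a c x <= - (velocity_gain a * (profile c x - profile c ((1 - mu) * x))).
Proof.
  destruct (c_rapid 3%nat) as [A HA]. destruct (profile_bounded c c_rapid) as [M HM].
  set (C := 2 * M * Ka a PI + 4 * A * (1 + a ^ 2 / 2)).
  assert (Hmx : 0 < mu * x) by nra. apply le_epsilon. intros eta Heta.
  pose proof (Rabs_pos C) as HC.
  set (ep := Rmin (mu * x / 2) (eta / (Rabs C + 1))).
  assert (Hep : 0 < ep) by (apply Rmin_pos; [lra|apply Rdiv_lt_0_compat; lra]).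
  assert (Hep_x : ep <= mu * x / 2) by apply Rmin_l.
  assert (Hep_eta : ep <= eta / (Rabs C + 1)) by apply Rmin_r.
  pose proof (velocity_upper_approx A M ep HA HM ltac:(lra)) as Happrox. fold C in Happrox.
  assert (HCep : (Rabs C + 1) * ep <= eta).
  { replace eta with ((Rabs C + 1) * (eta / (Rabs C + 1))) by (field; lra).
    apply Rmult_le_compat_l; lra. }
  pose proof (Rle_abs C). unfold local_gap in Happrox. nra.
Qed.
End VelocityBound.

Lemma continuous_on_pos_div_pow (f : R -> R) n :
  (forall s, continuous f s) -> continuous_on_pos (fun s => f s / s ^ n).
Proof.
  intros Hf. apply continuous_on_pos_mult; [now apply continuous_on_pos_of_continuous|].
  intros s Hs. apply continuous_of_ex_derive. auto_derive. apply pow_nonzero. lra.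
Qed.

Lemma continuous_comp_pow2 (f : R -> R) e s :
  (forall x, continuous f x) -> continuous (fun s => f (e * s ^ 2)) s.
Proof.
  intros Hf. apply (continuous_comp (fun s => e * s ^ 2) f); [|apply Hf].
  apply continuous_of_ex_derive. auto_derive; auto.
Qed.

Lemma RInt_sq_ge (f : R -> R) a b : a < b -> (forall x, a <= x <= b -> continuous f x) ->
  RInt f a b ^ 2 / (b - a) <= RInt (fun x => f x ^ 2) a b.
Proof.
  intros Hab Hf. set (z := RInt f a b / (b - a)).
  assert (Hex : forall h : R -> R, (forall x, a <= x <= b -> continuous h x) ->
    is_RInt h a b (RInt h a b)).
  { intros h Hh. apply is_RInt_of_ex, ex_RInt_continuous_on. intros x Hx.
    rewrite Rmin_left, Rmax_right in Hx by lra. auto. }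
  assert (Hsq : is_RInt (fun x => f x ^ 2) a b (RInt (fun x => f x ^ 2) a b)).
  { apply Hex. intros x Hx. apply continuous_Rmult; auto.
    apply continuous_Rmult; auto. apply continuous_const. }
  assert (Hlin : is_RInt (fun x => 2 * z * f x - z ^ 2) a b (2 * z * RInt f a b - (b - a) * z ^ 2)).
  { apply is_RInt_Rminus; [now apply is_RInt_Rscal, Hex|apply (is_RInt_const a b (z ^ 2))]. }
  apply Rle_trans with (2 * z * RInt f a b - (b - a) * z ^ 2).
  - right. unfold z. field. lra.
  - apply (is_RInt_le _ _ a b _ _ ltac:(lra) Hlin Hsq). intros x _.
    pose proof (pow2_ge_0 (f x - z)). lra.
Qed.

Section SingularMass.
Variables de s0 : R.
Hypothesis de_range : 0 < de < s0.

Definition singular_mass (b : nat -> R) : R := RInt (fun s => profile b (s ^ 2) / s ^ 2) de s0.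
Definition singular_weight (k : nat) : R :=
  RInt (fun s => (cos (INR k * s ^ 2) - 1) / s ^ 2) de s0.

Lemma is_RInt_singular_weight k :
  is_RInt (fun s => (cos (INR k * s ^ 2) - 1) / s ^ 2) de s0 (singular_weight k).
Proof.
  apply is_RInt_on_pos; [|lra|lra].
  apply (continuous_on_pos_div_pow (fun s => cos (INR k * s ^ 2) - 1) 2).
  intros s. apply continuous_of_ex_derive. auto_derive; auto.
Qed.

Lemma singular_weight_integrand_le k s : de <= s <= s0 ->
  Rabs ((cos (INR k * s ^ 2) - 1) / s ^ 2) <= 2 / de ^ 2.
Proof.
  intros Hs. unfold Rdiv. rewrite Rabs_mult.
  assert (0 < / s ^ 2) by (apply Rinv_0_lt_compat; nra). rewrite (Rabs_pos_eq (/ s ^ 2)) by lra.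
  apply Rmult_le_compat; [apply Rabs_pos|lra|apply Rabs_cos_minus_1_le|].
  apply Rinv_le_contravar; nra.
Qed.

Lemma singular_weight_le k : Rabs (singular_weight k) <= (s0 - de) * (2 / de ^ 2).
Proof.
  eapply is_RInt_Rabs_le; [lra|apply is_RInt_singular_weight|].
  intros s Hs. now apply singular_weight_integrand_le.
Qed.

Lemma singular_mass_series b : rapid b ->
  singular_mass b = Series (fun k => b k * singular_weight k).
Proof.
  intros Hb. destruct (Hb 2%nat) as [A HA]. apply is_RInt_unique.
  apply is_RInt_ext with (fun s => Series (fun k => b k * ((cos (INR k * s ^ 2) - 1) / s ^ 2))).
  { intros s _. rewrite <- (is_series_unique _ _ (profile_series b (s ^ 2) Hb)).
    unfold Rdiv at 2. rewrite <- Series_scal_r. apply Series_ext. intros; unfold Rdiv; ring. }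
  apply is_RInt_Series_decay with A (2 / de ^ 2);
    [lra|exact HA|exact singular_weight_integrand_le|exact is_RInt_singular_weight].
Qed.

Lemma is_derive_singular_mass Tm (c c' : R -> nat -> R) t : unif_rapid Tm c -> unif_rapid Tm c' ->
  (forall t k, 0 < t < Tm -> is_derive (fun s => c s k) t (c' t k)) -> 0 < t < Tm ->
  is_derive (fun s => singular_mass (c s)) t (singular_mass (c' t)).
Proof.
  intros Hc Hc' Hd Ht. rewrite singular_mass_series by (apply unif_rapid_at with Tm; auto; lra).
  apply is_derive_ext_loc with (fun s => Series (fun k => c s k * singular_weight k)).
  - apply (filter_imp (fun s => 0 < s < Tm)); [|now apply locally_interior].
    intros s Hs. symmetry. apply singular_mass_series, unif_rapid_at with Tm; auto. lra.
  - eapply is_derive_Series_modes; eauto using singular_weight_le.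
Qed.

Section Monotone.
Variables (a g : R) (c : nat -> R) (M lam : R).
Hypothesis a_pos : 0 < a.
Hypothesis g_pos : 0 < g.
Hypothesis c_rapid : rapid c.
Hypothesis c_0 : c O = 0.
Hypothesis slope_le : forall x, Rabs (slope c x) <= M.
Hypothesis slope_ge_0 : forall x, 0 <= x <= PI -> 0 <= slope c x.
Hypothesis s0_sq : s0 ^ 2 < PI.
Hypothesis lam_range : 0 < lam < 1.
Hypothesis lam_sq : 1 - lam ^ 2 <= / 4.
Hypothesis lam_s0 : (1 - lam ^ 2) * PI <= PI - s0 ^ 2.

Let profile_incr := profile_incr_of_slope_nonneg c c_rapid slope_ge_0.
Let rate (x : R) : R := profile (transport g (symbol a) c c) x.
Let kappa : R := g * velocity_gain a.

Definition gap (s : R) : R := profile c (s ^ 2) - profile c (lam ^ 2 * s ^ 2).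
Definition gap' (s : R) : R :=
  2 * s * slope c (s ^ 2) - 2 * lam ^ 2 * s * slope c (lam ^ 2 * s ^ 2).
Definition gap_flux (s : R) : R := gap s ^ 2 / s ^ 3.
Definition singular_gap : R := RInt (fun s => gap s / s ^ 2) de s0.

Lemma kappa_pos : 0 < kappa.
Proof. apply Rmult_lt_0_compat; auto. now apply velocity_gain_pos. Qed.

Lemma profile_range x : 0 <= x <= PI -> 0 <= profile c x <= M * x.
Proof.
  intros Hx. split.
  - rewrite <- (profile_0 c). apply profile_incr; lra.
  - assert (Hinc : Rabs (profile c x - profile c 0) <= M * x - M * 0).
    { apply (increment_le_of_derive_le (profile c) (slope c) (fun y => M * y) (fun _ => M));
        [lra| | |].
      - intros; now apply is_derive_profile.
      - intros; auto_derive; auto; ring.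
      - auto. }
    rewrite profile_0 in Hinc. apply Rabs_le_between in Hinc. lra.
Qed.

Lemma sq_range s : 0 < s <= s0 -> 0 < s ^ 2 <= s0 ^ 2 /\ 0 < lam ^ 2 * s ^ 2 <= s ^ 2.
Proof.
  intros Hs. assert (0 < s ^ 2) by (apply pow_lt; lra).
  assert (s ^ 2 <= s0 ^ 2) by (apply pow_incr; lra). assert (0 < lam ^ 2 < 1) by nra. nra.
Qed.

Lemma is_derive_gap s : is_derive gap s (gap' s).
Proof.
  assert (Hcomp : forall e, is_derive (fun s => profile c (e * s ^ 2)) s
    (2 * e * s * slope c (e * s ^ 2))).
  { intros e. apply (is_derive_comp (profile c) (fun s => e * s ^ 2));
      [now apply is_derive_profile|].
    auto_derive; auto. ring. }
  apply is_derive_Rminus; [|apply Hcomp].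
  apply is_derive_ext with (fun s => profile c (1 * s ^ 2)); [intros; now rewrite Rmult_1_l|].
  specialize (Hcomp 1). now rewrite Rmult_1_l, Rmult_1_r in Hcomp.
Qed.

Lemma gap_range s : 0 < s <= s0 -> 0 <= gap s <= M * s ^ 2.
Proof.
  intros Hs. destruct (sq_range s Hs) as [Hsq Hlam]. unfold gap.
  pose proof (profile_incr (lam ^ 2 * s ^ 2) (s ^ 2) ltac:(lra) ltac:(lra)).
  pose proof (profile_range (s ^ 2) ltac:(lra)).
  pose proof (profile_range (lam ^ 2 * s ^ 2) ltac:(lra)).
  lra.
Qed.

Lemma rate_ge s : 0 < s <= s0 -> kappa * gap s * slope c (s ^ 2) <= rate (s ^ 2).
Proof.
  intros Hs. destruct (sq_range s Hs) as [Hsq Hlam]. pose proof PI_gt_3.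
  pose proof (velocity_upper a c (s ^ 2) (1 - lam ^ 2) a_pos c_rapid profile_incr
    ltac:(lra) ltac:(nra) ltac:(nra)) as Hvel.
  replace ((1 - (1 - lam ^ 2)) * s ^ 2) with (lam ^ 2 * s ^ 2) in Hvel by ring.
  fold (gap s) in Hvel.
  unfold rate. rewrite profile_transport_velocity by auto.
  pose proof (slope_ge_0 (s ^ 2) ltac:(lra)) as Hslope.
  assert (0 <= g * slope c (s ^ 2)) by (apply Rmult_le_pos; lra). unfold kappa. nra.
Qed.

Lemma rate_nonneg s : 0 < s <= s0 -> 0 <= rate (s ^ 2).
Proof.
  intros Hs. eapply Rle_trans; [|now apply rate_ge]. pose proof kappa_pos.
  destruct (sq_range s Hs). pose proof (gap_range s Hs). pose proof (slope_ge_0 (s ^ 2) ltac:(lra)).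
  apply Rmult_le_pos; [|auto]. apply Rmult_le_pos; lra.
Qed.

Lemma continuous_singular_integrand b : rapid b ->
  continuous_on_pos (fun s => profile b (s ^ 2) / s ^ 2).
Proof.
  intros Hb. apply (continuous_on_pos_div_pow (fun s => profile b (s ^ 2)) 2). intros s.
  apply continuous_ext with (fun s => profile b (1 * s ^ 2)); [intros; now rewrite Rmult_1_l|].
  apply continuous_comp_pow2. now apply continuous_profile.
Qed.

Lemma continuous_gap_integrand : continuous_on_pos (fun s => gap s / s ^ 2).
Proof.
  apply (continuous_on_pos_div_pow gap 2). intros s. eapply continuous_of_is_derive, is_derive_gap.
Qed.

Lemma singular_mass_rate_nonneg : 0 <= singular_mass (transport g (symbol a) c c).
Proof.
  apply RInt_nonneg; [lra| |].
  - apply ex_RInt_on_pos; [|lra|lra]. apply continuous_singular_integrand.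
    apply rapid_transport; auto. now apply symbol_le_2.
  - intros s Hs. apply Rmult_le_pos; [apply rate_nonneg; lra|].
    left. apply Rinv_0_lt_compat, pow_lt. lra.
Qed.

Definition gap_flux' (s : R) : R := 2 * gap s * gap' s / s ^ 3 - 3 * gap s ^ 2 / s ^ 4.

Lemma is_derive_gap_flux s : 0 < s -> is_derive gap_flux s (gap_flux' s).
Proof.
  intros Hs. unfold gap_flux, gap_flux', Rdiv.
  replace (2 * gap s * gap' s * / s ^ 3 - 3 * gap s ^ 2 * / s ^ 4) with
    ((INR 2 * gap' s * gap s ^ 1) * / s ^ 3 + gap s ^ 2 * (- (3 * s ^ 2) / (s ^ 3) ^ 2))
    by (simpl; field; lra).
  apply (is_derive_Rmult (fun s => gap s ^ 2) (fun s => / s ^ 3)).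
  - apply is_derive_pow, is_derive_gap.
  - apply is_derive_inv; [auto_derive; auto; ring|apply pow_nonzero; lra].
Qed.

Lemma continuous_gap_flux' : continuous_on_pos gap_flux'.
Proof.
  assert (Hgap : forall s, continuous gap s)
    by (intros; eapply continuous_of_is_derive, is_derive_gap).
  assert (Hgap' : forall s, continuous gap' s).
  { intros s. apply continuous_Rminus; apply continuous_Rmult;
      try (apply continuous_of_ex_derive; auto_derive; auto; fail).
    - apply continuous_ext with (fun s => slope c (1 * s ^ 2)); [intros; now rewrite Rmult_1_l|].
      apply continuous_comp_pow2. now apply continuous_slope.
    - apply continuous_comp_pow2. now apply continuous_slope. }
  intros s Hs. apply continuous_Rminus.
  - apply (continuous_on_pos_div_pow (fun s => 2 * gap s * gap' s) 3); [|exact Hs]. intros z.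
    apply continuous_Rmult; [now apply continuous_Rscal|apply Hgap'].
  - apply (continuous_on_pos_div_pow (fun s => 3 * gap s ^ 2) 4); [|exact Hs]. intros z.
    apply continuous_Rscal. apply continuous_Rmult; auto.
    apply continuous_Rmult; auto. apply continuous_const.
Qed.

(* [slope c (s ^ 2)] is at least [gap' s / (2 s)], which makes the right-hand side of [rate_ge]
   a square plus an exact derivative. *)
Lemma rate_ge_square_plus_flux s : 0 < s <= s0 ->
  kappa * (3 / 4 * (gap s / s ^ 2) ^ 2 + / 4 * gap_flux' s) <= rate (s ^ 2) / s ^ 2.
Proof.
  intros Hs. destruct (sq_range s Hs) as [Hsq Hlam]. pose proof (gap_range s Hs) as Hgap.
  pose proof kappa_pos as Hk.
  assert (Hgap' : gap' s <= 2 * s * slope c (s ^ 2)).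
  { unfold gap'. assert (0 <= 2 * lam ^ 2 * s * slope c (lam ^ 2 * s ^ 2)); [|lra].
    apply Rmult_le_pos; [nra|]. apply slope_ge_0. lra. }
  apply Rle_trans with (kappa * gap s * slope c (s ^ 2) / s ^ 2).
  - replace (kappa * (3 / 4 * (gap s / s ^ 2) ^ 2 + / 4 * gap_flux' s))
      with (kappa * gap s / (2 * s ^ 3) * gap' s) by (unfold gap_flux'; field; lra).
    replace (kappa * gap s * slope c (s ^ 2) / s ^ 2)
      with (kappa * gap s / (2 * s ^ 3) * (2 * s * slope c (s ^ 2))) by (field; lra).
    apply Rmult_le_compat_l; [|exact Hgap'].
    apply Rmult_le_pos; [apply Rmult_le_pos; lra|].
    assert (0 < s ^ 3) by (apply pow_lt; lra). left. apply Rinv_0_lt_compat. lra.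
  - apply Rmult_le_compat_r; [left; now apply Rinv_0_lt_compat|now apply rate_ge].
Qed.

Lemma gap_flux_ends : - (M ^ 2 * de) <= gap_flux s0 - gap_flux de.
Proof.
  assert (Hend : 0 <= gap_flux s0).
  { apply Rmult_le_pos; [apply pow2_ge_0|]. left. apply Rinv_0_lt_compat, pow_lt. lra. }
  assert (Hstart : gap_flux de <= M ^ 2 * de).
  { assert (Hde3 : 0 < de ^ 3) by (apply pow_lt; lra).
    unfold gap_flux. apply Rmult_le_reg_r with (de ^ 3); [exact Hde3|].
    replace (gap de ^ 2 / de ^ 3 * de ^ 3) with (gap de ^ 2) by (field; lra).
    replace (M ^ 2 * de * de ^ 3) with ((M * de ^ 2) ^ 2) by ring.
    apply pow_incr, gap_range. lra. }
  lra.
Qed.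

Lemma singular_mass_rate_ge :
  kappa * (3 / 4 * (singular_gap ^ 2 / s0) - / 4 * (M ^ 2 * de))
  <= singular_mass (transport g (symbol a) c c).
Proof.
  pose proof kappa_pos as Hk. pose proof continuous_gap_integrand as Hcont.
  assert (Hsq : singular_gap ^ 2 / s0 <= RInt (fun s => (gap s / s ^ 2) ^ 2) de s0).
  { eapply Rle_trans; [|apply RInt_sq_ge; [lra|intros; apply Hcont; lra]].
    apply Rmult_le_compat_l; [apply pow2_ge_0|]. apply Rinv_le_contravar; lra. }
  assert (Hflux : is_RInt gap_flux' de s0 (gap_flux s0 - gap_flux de)).
  { apply (is_RInt_derive gap_flux); intros s Hs; rewrite Rmin_left, Rmax_right in Hs by lra.
    - apply is_derive_gap_flux. lra.
    - apply continuous_gap_flux'. lra. }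
  assert (Hlower : is_RInt
    (fun s => kappa * (3 / 4 * (gap s / s ^ 2) ^ 2 + / 4 * gap_flux' s)) de s0
    (kappa * (3 / 4 * RInt (fun s => (gap s / s ^ 2) ^ 2) de s0
              + / 4 * (gap_flux s0 - gap_flux de)))).
  { apply is_RInt_Rscal, is_RInt_Rplus; apply is_RInt_Rscal; [|exact Hflux].
    apply (is_RInt_on_pos (fun s => (gap s / s ^ 2) ^ 2)); [|lra|lra].
    apply continuous_on_pos_mult; [exact Hcont|]. apply continuous_on_pos_mult; [exact Hcont|].
    intros s _. apply continuous_const. }
  pose proof gap_flux_ends as Hends.
  eapply Rle_trans;
    [|apply (is_RInt_le _ (fun s => rate (s ^ 2) / s ^ 2) de s0 _ _ ltac:(lra) Hlower)].
  - apply Rmult_le_compat_l; lra.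
  - apply is_RInt_on_pos; [|lra|lra]. apply continuous_singular_integrand.
    apply rapid_transport; auto. now apply symbol_le_2.
  - intros s Hs. apply rate_ge_square_plus_flux. lra.
Qed.

Lemma singular_integrand_range s : 0 < s <= s0 -> 0 <= profile c (s ^ 2) / s ^ 2 <= M.
Proof.
  intros Hs. destruct (sq_range s Hs) as [Hsq _]. pose proof (profile_range (s ^ 2) ltac:(lra)).
  assert (0 < / s ^ 2) by (apply Rinv_0_lt_compat; lra). split; [apply Rmult_le_pos; lra|].
  apply Rmult_le_reg_r with (s ^ 2); [lra|].
  replace (profile c (s ^ 2) / s ^ 2 * s ^ 2) with (profile c (s ^ 2)) by (field; lra). lra.
Qed.

Lemma singular_gap_ge : (1 - lam) * singular_mass c - M * de <= singular_gap.
Proof.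
  set (F s := profile c (s ^ 2) / s ^ 2).
  assert (HF : continuous_on_pos F) by now apply continuous_singular_integrand.
  assert (Hldes : 0 < lam * de < lam * s0) by nra.
  assert (Hshrink : lam * de < de /\ lam * s0 < s0) by nra.
  assert (Hscaled : is_RInt (fun s => lam * (lam * F (lam * s))) de s0
    (lam * RInt F (lam * de) (lam * s0))).
  { apply is_RInt_Rscal. apply is_RInt_ext with (fun s => scal lam (F (lam * s + 0))).
    - intros s _. now rewrite Rplus_0_r.
    - apply (is_RInt_comp_lin F). rewrite !Rplus_0_r. apply is_RInt_on_pos; auto; lra. }
  assert (Hgap : singular_gap = singular_mass c - lam * RInt F (lam * de) (lam * s0)).
  { apply is_RInt_unique. eapply is_RInt_ext;
      [|apply is_RInt_Rminus; [apply (is_RInt_on_pos F); auto; lra|exact Hscaled]].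
    intros s Hs. rewrite Rmin_left in Hs by lra. unfold F, gap.
    apply Rminus_diag_uniq. rewrite Rpow_mult_distr. field. lra. }
  assert (Hmass : lam * RInt F (lam * de) (lam * s0)
    <= lam * (singular_mass c + (1 - lam) * (M * de))).
  { apply Rmult_le_compat_l; [lra|]. change (singular_mass c) with (RInt F de s0).
    pose proof (RInt_Chasles_on_pos F (lam * de) de (lam * s0) HF ltac:(lra) ltac:(lra) ltac:(lra))
      as Hleft.
    pose proof (RInt_Chasles_on_pos F de (lam * s0) s0 HF ltac:(lra) ltac:(lra) ltac:(lra))
      as Hright.
    assert (0 <= RInt F (lam * s0) s0).
    { apply RInt_nonneg; [lra|apply ex_RInt_on_pos; auto; lra|].
      intros s Hs. apply singular_integrand_range. lra. }
    assert (Hshort : Rabs (RInt F (lam * de) de) <= (de - lam * de) * M).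
    { apply (is_RInt_Rabs_le F); [lra|apply is_RInt_on_pos; auto; lra|].
      intros s Hs. pose proof (singular_integrand_range s ltac:(lra)) as Hrange.
      fold (F s) in Hrange.
      rewrite Rabs_pos_eq; lra. }
    apply Rabs_le_between in Hshort. lra. }
  assert (0 <= M) by (eapply Rle_trans; [apply Rabs_pos|apply (slope_le 0)]).
  assert (0 <= M * de) by (apply Rmult_le_pos; lra).
  assert (lam * ((1 - lam) * (M * de)) <= M * de); [|lra].
  rewrite <- Rmult_assoc. assert (lam * (1 - lam) <= 1) by nra. nra.
Qed.

Definition riccati_rate : R := 3 * kappa * (1 - lam) ^ 2 / (32 * s0).

Lemma riccati_rate_pos : 0 < riccati_rate.
Proof.
  pose proof kappa_pos. apply Rdiv_lt_0_compat; [|lra].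
  apply Rmult_lt_0_compat; [lra|apply pow_lt; lra].
Qed.

Lemma singular_mass_riccati :
  M * de <= (1 - lam) * singular_mass c / 2 ->
  M ^ 2 * de <= 3 * (1 - lam) ^ 2 * singular_mass c ^ 2 / (8 * s0) ->
  riccati_rate * singular_mass c ^ 2 <= singular_mass (transport g (symbol a) c c).
Proof.
  intros Hde1 Hde2. eapply Rle_trans; [|apply singular_mass_rate_ge].
  pose proof singular_gap_ge as Hgap. set (J := singular_mass c) in *. pose proof kappa_pos.
  assert (HM0 : 0 <= M) by (eapply Rle_trans; [apply Rabs_pos|apply (slope_le 0)]).
  assert (Hsq : ((1 - lam) * J / 2) ^ 2 <= singular_gap ^ 2).
  { apply pow_incr. split; [|lra]. apply Rle_trans with (M * de); [apply Rmult_le_pos; lra|lra]. }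
  assert (Hsq' : ((1 - lam) * J / 2) ^ 2 / s0 <= singular_gap ^ 2 / s0)
    by (apply Rmult_le_compat_r; [left; apply Rinv_0_lt_compat|]; lra).
  replace (riccati_rate * J ^ 2) with (kappa * (3 / 4 * (((1 - lam) * J / 2) ^ 2 / s0)
    - / 4 * (3 * (1 - lam) ^ 2 * J ^ 2 / (8 * s0)))) by (unfold riccati_rate; field; lra).
  apply Rmult_le_compat_l; lra.
Qed.
End Monotone.
End SingularMass.

Lemma riccati_blowup (J J' : R -> R) t0 T ka j0 : 0 < ka -> 0 < j0 -> t0 <= T -> j0 <= J t0 ->
  (forall t, t0 <= t <= T -> is_derive J t (J' t)) -> (forall t, t0 <= t <= T -> 0 <= J' t) ->
  (forall t, t0 <= t <= T -> j0 <= J t -> ka * J t ^ 2 <= J' t) -> T < t0 + / (ka * j0).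
Proof.
  intros Hka Hj0 HT HJt0 HJ HJ' Hriccati.
  assert (Hfloor : forall t, t0 <= t <= T -> j0 <= J t).
  { intros t Ht. eapply Rle_trans; [exact HJt0|].
    apply (le_of_nonneg_derive J J'); [lra| |]; intros; [apply HJ|apply HJ']; lra. }
  assert (Hdecr : - / J t0 - ka * t0 <= - / J T - ka * T).
  { apply (le_of_nonneg_derive (fun t => - / J t - ka * t) (fun t => J' t / J t ^ 2 - ka));
      [lra| |].
    - intros t Ht. specialize (Hfloor t Ht). apply is_derive_Rminus; [|auto_derive; auto; ring].
      replace (J' t / J t ^ 2) with (- (- J' t / J t ^ 2)) by (field; lra).
      apply is_derive_Ropp, is_derive_inv; [now apply HJ|lra].
    - intros t Ht. specialize (Hriccati t Ht (Hfloor t Ht)). specialize (Hfloor t Ht).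
      assert (0 < J t ^ 2) by (apply pow_lt; lra). assert (ka <= J' t / J t ^ 2); [|lra].
      apply Rmult_le_reg_r with (J t ^ 2); [auto|].
      replace (J' t / J t ^ 2 * J t ^ 2) with (J' t) by (field; lra). exact Hriccati. }
  assert (0 < / J T) by (apply Rinv_0_lt_compat; specialize (Hfloor T ltac:(lra)); lra).
  assert (/ J t0 <= / j0) by (apply Rinv_le_contravar; lra).
  apply Rmult_lt_reg_l with ka; [exact Hka|].
  replace (ka * (t0 + / (ka * j0))) with (ka * t0 + / j0) by (field; lra). lra.
Qed.

Definition dilation (s0 : R) : R := 1 - Rmin ((PI - s0 ^ 2) / PI) (/ 4) / 2.

Lemma dilation_spec s0 : s0 ^ 2 < PI ->
  0 < dilation s0 < 1 /\ 1 - dilation s0 ^ 2 <= / 4 /\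
  (1 - dilation s0 ^ 2) * PI <= PI - s0 ^ 2.
Proof.
  intros Hs0. unfold dilation. set (mu := Rmin ((PI - s0 ^ 2) / PI) (/ 4)). pose proof PI_gt_3.
  assert (Hpos : 0 < mu) by (apply Rmin_pos; [apply Rdiv_lt_0_compat; lra|lra]).
  assert (Hquarter : mu <= / 4) by apply Rmin_r.
  assert (Hpi : mu * PI <= PI - s0 ^ 2).
  { replace (PI - s0 ^ 2) with ((PI - s0 ^ 2) / PI * PI) by (field; lra).
    apply Rmult_le_compat_r; [lra|apply Rmin_l]. }
  assert (1 - (1 - mu / 2) ^ 2 <= mu) by nra.
  repeat split; nra.
Qed.

Lemma exists_small_multiples M e1 e2 d : 0 <= M -> 0 < e1 -> 0 < e2 -> 0 < d ->
  exists de, 0 < de <= d /\ M * de <= e1 /\ M ^ 2 * de <= e2.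
Proof.
  intros HM He1 He2 Hd.
  assert (Hscale : forall N e de, 0 <= N -> 0 < e -> 0 < de -> de <= e / (N + 1) -> N * de <= e).
  { intros N e de HN He Hde Hle. replace e with ((N + 1) * (e / (N + 1))) by (field; lra).
    apply Rmult_le_compat; lra. }
  assert (HM2 : 0 <= M ^ 2) by apply pow2_ge_0.
  set (m := Rmin (e1 / (M + 1)) (e2 / (M ^ 2 + 1))).
  assert (Hm : 0 < m) by (apply Rmin_pos; apply Rdiv_lt_0_compat; lra).
  pose proof (Rmin_l d m). pose proof (Rmin_r d m).
  assert (m <= e1 / (M + 1)) by apply Rmin_l. assert (m <= e2 / (M ^ 2 + 1)) by apply Rmin_r.
  assert (0 < Rmin d m) by now apply Rmin_pos.
  exists (Rmin d m). repeat split; auto; apply Hscale; lra.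
Qed.

Lemma singular_mass_ge de s1 s0 c p : 0 < de <= s1 -> s1 <= s0 -> s0 ^ 2 <= PI -> rapid c ->
  (forall x, 0 <= x <= PI -> 0 <= slope c x) -> 0 <= p <= profile c (s1 ^ 2) ->
  (s0 - s1) * (p / s0 ^ 2) <= singular_mass de s0 c.
Proof.
  intros Hde Hs10 Hs0 Hc Hslope Hp.
  assert (Hsq : forall s, de <= s <= s0 -> 0 < s ^ 2 <= s0 ^ 2)
    by (intros; split; [apply pow_lt; lra|apply pow_incr; lra]).
  apply RInt_ge_on_subinterval; try lra.
  - intros s Hs. apply continuous_singular_integrand; auto. lra.
  - intros s Hs. apply Rmult_le_pos; [now apply profile_nonneg_of_slope_nonneg|].
    left. apply Rinv_0_lt_compat, Hsq, Hs.
  - intros s Hs. destruct (Hsq s ltac:(lra)).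
    assert (s1 ^ 2 <= s ^ 2) by (apply pow_incr; lra). assert (0 <= s1 ^ 2) by apply pow2_ge_0.
    pose proof (profile_incr_of_slope_nonneg c Hc Hslope (s1 ^ 2) (s ^ 2) ltac:(lra) ltac:(lra)).
    apply Rmult_le_compat; try lra; [left; apply Rinv_0_lt_compat; lra|].
    apply Rinv_le_contravar; lra.
Qed.

Section Lifespan.
Variables (a g Tm : R) (c : R -> nat -> R).
Hypothesis a_pos : 0 < a.
Hypothesis g_pos : 0 < g.
Hypothesis c_sol : mode_solution g (symbol a) Tm c.
Hypothesis init_slope : forall x, 0 <= x <= PI -> 0 <= slope (c 0) x.

Variables (t0 s1 s0 p : R).
Hypothesis s_range : 0 < s1 < s0.
Hypothesis s0_sq : s0 ^ 2 < PI.
Hypothesis t0_range : 0 < t0 < Tm.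
Hypothesis p_range : 0 < p <= profile (c t0) (s1 ^ 2).

Let lam : R := dilation s0.
Let ka : R := riccati_rate s0 a g lam.
Let j0 : R := (s0 - s1) * (p / s0 ^ 2).

Lemma initial_mass_pos : 0 < j0.
Proof. apply Rmult_lt_0_compat; [lra|apply Rdiv_lt_0_compat; [lra|apply pow_lt; lra]]. Qed.

Lemma riccati_time_lt T M de : t0 <= T < Tm ->
  (forall t x, t <= T -> Rabs (slope (c t) x) <= M) -> 0 < de <= s1 ->
  M * de <= (1 - lam) * j0 / 2 -> M ^ 2 * de <= 3 * (1 - lam) ^ 2 * j0 ^ 2 / (8 * s0) ->
  T < t0 + / (ka * j0).
Proof.
  intros HT HM Hde Hde1 Hde2. pose proof initial_mass_pos as Hj0.
  destruct (dilation_spec s0 s0_sq) as [Hlam [Hlam_sq Hlam_s0]]. fold lam in Hlam, Hlam_sq, Hlam_s0.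
  assert (Hde0 : 0 < de < s0) by lra. assert (Hunif := modes_unif_rapid _ _ _ _ c_sol).
  assert (Hrapid : forall t, t < Tm -> rapid (c t)) by (apply (modes_rapid _ _ _ _ c_sol)).
  assert (Hslope : forall t, 0 <= t < Tm -> forall x, 0 <= x <= PI -> 0 <= slope (c t) x).
  { intros t Ht. now apply (slope_nonneg a g Tm c). }
  apply (riccati_blowup (fun t => singular_mass de s0 (c t))
    (fun t => singular_mass de s0 (transport g (symbol a) (c t) (c t)))); auto; [|lra| | | |].
  - now apply (riccati_rate_pos de s0 Hde0).
  - apply singular_mass_ge; try lra; [apply Hrapid|apply Hslope]; lra.
  - intros t Ht. apply (is_derive_singular_mass de s0 Hde0 Tm c
      (fun t => transport g (symbol a) (c t) (c t))); [exact Hunif| | |lra].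
    + apply unif_rapid_transport; auto. now apply symbol_le_2.
    + apply (modes_ode _ _ _ _ c_sol).
  - intros t Ht. apply (singular_mass_rate_nonneg de s0 Hde0 a g (c t) M lam); auto.
    + apply Hrapid; lra.
    + apply (modes_zero _ _ _ _ c_sol); lra.
    + intros x. apply HM. lra.
    + apply Hslope; lra.
  - intros t Ht Hfloor. apply (singular_mass_riccati de s0 Hde0 a g (c t) M lam); auto.
    + apply Hrapid; lra.
    + apply (modes_zero _ _ _ _ c_sol); lra.
    + intros x. apply HM. lra.
    + apply Hslope; lra.
    + eapply Rle_trans; [exact Hde1|]. apply Rmult_le_compat_r; [lra|].
      apply Rmult_le_compat_l; lra.
    + eapply Rle_trans; [exact Hde2|].
      apply Rmult_le_compat_r; [left; apply Rinv_0_lt_compat; lra|].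
      apply Rmult_le_compat_l; [|apply pow_incr; lra]. apply Rmult_le_pos; [lra|apply pow2_ge_0].
Qed.

Lemma lifespan_le : Tm <= t0 + / (ka * j0).
Proof.
  apply Rnot_lt_le. intros Hlong. pose proof initial_mass_pos as Hj0.
  destruct (dilation_spec s0 s0_sq) as [Hlam _]. fold lam in Hlam.
  assert (Hka : 0 < ka) by now apply (riccati_rate_pos s1 s0 s_range a g lam).
  assert (Hkj : 0 < / (ka * j0)) by (apply Rinv_0_lt_compat; now apply Rmult_lt_0_compat).
  set (T := (t0 + / (ka * j0) + Tm) / 2). assert (HT : t0 <= T < Tm) by (unfold T; lra).
  destruct (slope_unif_bounded a g Tm c c_sol T ltac:(lra)) as [M HM].
  destruct (exists_small_multiples M ((1 - lam) * j0 / 2)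
    (3 * (1 - lam) ^ 2 * j0 ^ 2 / (8 * s0)) s1)
    as [de [Hde [Hde1 Hde2]]].
  - eapply Rle_trans; [apply Rabs_pos|apply (HM t0 0); lra].
  - apply Rdiv_lt_0_compat; [apply Rmult_lt_0_compat|]; lra.
  - apply Rdiv_lt_0_compat; [|lra]. apply Rmult_lt_0_compat; [|now apply pow_lt].
    apply Rmult_lt_0_compat; [lra|apply pow_lt; lra].
  - lra.
  - pose proof (riccati_time_lt T M de HT HM Hde Hde1 Hde2). unfold T in *. lra.
Qed.
End Lifespan.

(** * Continuation criterion *)

Section Parseval.
Variable phi : R.
Hypothesis phi_node : sin (2 * phi) = 0.

Lemma sin_sum_phase_ends k j : sin (INR k * PI + INR j * PI + 2 * phi) = 0.
Proof. rewrite sin_plus, phi_node, sin_plus, !sin_INR_mult_PI. ring. Qed.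

Lemma is_RInt_cos_sq k : (1 <= k)%nat ->
  is_RInt (fun x => cos (INR k * x + phi) * cos (INR k * x + phi)) 0 PI (PI / 2).
Proof.
  intros Hk. assert (Hk1 : 1 <= INR k) by (change 1 with (INR 1); now apply le_INR).
  set (P x := x / 2 + sin (INR k * x + INR k * x + 2 * phi) / (4 * INR k)).
  replace (PI / 2) with (P PI - P 0).
  - apply (is_RInt_derive P); intros x _.
    + unfold P. auto_derive; auto.
      replace (INR k * x + INR k * x + 2 * phi) with ((INR k * x + phi) + (INR k * x + phi))
        by ring.
      rewrite cos_plus. pose proof (sin2_cos2 (INR k * x + phi)) as Hpyth. unfold Rsqr in Hpyth.
      replace (sin (INR k * x + phi) * sin (INR k * x + phi)) with
        (1 - cos (INR k * x + phi) * cos (INR k * x + phi)) by lra.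
      field. lra.
    + apply continuous_Rmult; apply continuous_cos_phase.
  - unfold P. rewrite sin_sum_phase_ends, !Rmult_0_r, !Rplus_0_l, phi_node. field. lra.
Qed.

Lemma is_RInt_cos_cos k j : (1 <= k)%nat -> k <> j ->
  is_RInt (fun x => cos (INR k * x + phi) * cos (INR j * x + phi)) 0 PI 0.
Proof.
  intros Hk Hkj. assert (Hk1 : 1 <= INR k) by (change 1 with (INR 1); now apply le_INR).
  pose proof (pos_INR j) as Hj.
  assert (Hdiff : INR k - INR j <> 0) by (intros E; apply Hkj, INR_eq; lra).
  set (P x := sin (INR k * x - INR j * x) / (2 * (INR k - INR j))
              + sin (INR k * x + INR j * x + 2 * phi) / (2 * (INR k + INR j))).
  replace 0 with (P PI - P 0) at 2.
  - apply (is_RInt_derive P); intros x _.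
    + unfold P. auto_derive; auto.
      replace (INR k * x + - (INR j * x)) with ((INR k * x + phi) - (INR j * x + phi)) by ring.
      replace (INR k * x + INR j * x + 2 * phi) with ((INR k * x + phi) + (INR j * x + phi))
        by ring.
      rewrite cos_plus, cos_minus. field. lra.
    + apply continuous_Rmult; apply continuous_cos_phase.
  - unfold P. rewrite sin_sum_phase_ends, sin_minus, !sin_INR_mult_PI, !Rmult_0_r, !Rplus_0_l.
    rewrite phi_node, (Rminus_0_r 0), sin_0. field. lra.
Qed.

Variables a b : nat -> R.
Hypothesis a_rapid : rapid a.
Hypothesis b_rapid : rapid b.
Hypothesis a_0 : a O = 0.

Lemma is_RInt_cos_series_mode j :
  is_RInt (fun x => cos_series phi a x * cos (INR j * x + phi)) 0 PI (PI / 2 * a j).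
Proof.
  destruct (a_rapid 2%nat) as [A HA]. pose proof PI_gt_3.
  set (e k x := cos (INR k * x + phi) * cos (INR j * x + phi)).
  assert (He : forall k, is_RInt (e k) 0 PI (RInt (e k) 0 PI)).
  { intros k. apply is_RInt_of_continuous. intros y.
    apply continuous_Rmult; apply continuous_cos_phase. }
  replace (PI / 2 * a j) with (Series (fun k => a k * RInt (e k) 0 PI)).
  - eapply is_RInt_ext; [|apply (is_RInt_Series_decay a e _ A 1 0 PI); auto; [lra|]].
    + intros x _. unfold e, cos_series. rewrite <- Series_scal_r. apply Series_ext. intros; ring.
    + intros k x _. unfold e. rewrite Rabs_mult. pose proof (Rabs_cos_le (INR k * x + phi)).
      pose proof (Rabs_cos_le (INR j * x + phi)). pose proof (Rabs_pos (cos (INR k * x + phi))).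
      pose proof (Rabs_pos (cos (INR j * x + phi))). nra.
  - apply is_series_unique. rewrite <- (psum_indicator j (PI / 2 * a j) (S j)) by lia.
    assert (Hterm : forall k, (if Nat.eq_dec k j then PI / 2 * a j else 0) = a k * RInt (e k) 0 PI).
    { intros k. unfold e. destruct k as [|k].
      - rewrite a_0, Rmult_0_l. destruct (Nat.eq_dec 0 j) as [<-|]; [rewrite a_0; ring|reflexivity].
      - destruct (Nat.eq_dec (S k) j) as [<-|Hne].
        + rewrite (is_RInt_unique _ _ _ _ (is_RInt_cos_sq (S k) ltac:(lia))). ring.
        + rewrite (is_RInt_unique _ _ _ _ (is_RInt_cos_cos (S k) j ltac:(lia) Hne)). ring. }
    eapply is_series_ext; [exact Hterm|]. apply is_series_finite.
    intros k Hk. destruct (Nat.eq_dec k j); [lia|reflexivity].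
Qed.

Lemma is_RInt_parseval :
  is_RInt (fun x => cos_series phi a x * cos_series phi b x) 0 PI
    (PI / 2 * Series (fun k => a k * b k)).
Proof.
  destruct (a_rapid 2%nat) as [A HA]. destruct (b_rapid 2%nat) as [B HB]. pose proof PI_gt_3.
  rewrite <- Series_scal_l.
  rewrite (Series_ext _ (fun j => b j * (PI / 2 * a j))) by (intros; ring).
  eapply is_RInt_ext; [|apply (is_RInt_Series_decay b
    (fun j x => cos_series phi a x * cos (INR j * x + phi)) _ B (2 * A) 0 PI); auto; [lra| |]].
  - intros x _. cbv beta. unfold cos_series at 3. rewrite <- Series_scal_l.
    apply Series_ext. intros; ring.
  - intros j x _. rewrite Rabs_mult. pose proof (cos_series_le phi a A x HA).
    pose proof (Rabs_cos_le (INR j * x + phi)). pose proof (Rabs_pos (cos (INR j * x + phi))).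
    pose proof (Rabs_pos (cos_series phi a x)). nra.
  - exact is_RInt_cos_series_mode.
Qed.
End Parseval.

Definition h2_energy (c : nat -> R) : R := Series (fun k => lap c k ^ 2).

Lemma decay_mult_le_weight A B a b k : decay 2 A a -> decay 0 B b ->
  Rabs (a k * b k) <= A * B * weight k.
Proof.
  intros Ha Hb. rewrite Rabs_mult. replace (A * B * weight k) with (A * weight k * B) by ring.
  apply Rmult_le_compat; try apply Rabs_pos;
    [now apply (decay_2_weight A a)|now apply (decay_Rabs_le 0)].
Qed.

Lemma lap_sq_le_weight A c k : decay 4 A c -> lap c k ^ 2 <= A ^ 2 * weight k.
Proof.
  intros Hc. replace (A ^ 2) with (A * A) by ring. rewrite <- Rsqr_pow2.
  eapply Rle_trans; [apply Rle_abs|]. apply decay_mult_le_weight; [now apply decay_lap|].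
  apply (decay_le 2 0 A A); [lia|lra|now apply decay_lap].
Qed.

Lemma ex_series_lap_sq c : rapid c -> ex_series (fun k => lap c k ^ 2).
Proof.
  intros Hc. destruct (Hc 4%nat) as [A HA].
  apply ex_series_dominated with (fun k => A ^ 2 * weight k); [apply ex_series_weight|].
  intros k. rewrite Rabs_pos_eq by apply pow2_ge_0. now apply lap_sq_le_weight.
Qed.

Lemma h2_energy_nonneg c : rapid c -> 0 <= h2_energy c.
Proof. intros Hc. apply Series_nonneg; [now apply ex_series_lap_sq|intros; apply pow2_ge_0]. Qed.

Lemma h2_energy_le A c : decay 4 A c -> h2_energy c <= 2 * A ^ 2.
Proof.
  intros HA. rewrite <- Series_weight. apply Series_le; [|apply ex_series_weight].
  intros k. split; [apply pow2_ge_0|now apply lap_sq_le_weight].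
Qed.

Section LogBound.
Variables (a : R) (c : nat -> R) (Th : R).
Hypothesis a_pos : 0 < a.
Hypothesis c_rapid : rapid c.
Hypothesis slope_le : forall x, Rabs (slope c x) <= Th.

Lemma RInt_slope_reflect_Ka_le x nu : 1 <= nu ->
  Rabs (RInt (fun y => (slope c (x - y) - slope c (x + y)) * Ka a y) (/ nu) nu) <= 4 * Th * ln nu.
Proof.
  intros Hnu. pose proof (Rinv_self_le nu Hnu) as Hinv.
  assert (HTh : 0 <= Th) by (eapply Rle_trans; [apply Rabs_pos|apply (slope_le 0)]).
  replace (4 * Th * ln nu) with (2 * Th * ln nu - 2 * Th * ln (/ nu))
    by (rewrite ln_Rinv by lra; ring).
  apply (RInt_on_pos_le _ (fun y => 2 * Th * ln y) (fun y => 2 * Th * / y)); [|exact Hinv| |].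
  - apply continuous_mult_Ka; auto. intros y.
    apply continuous_Rminus; [apply continuous_shift_reflect|apply continuous_shift];
      now apply continuous_slope.
  - intros y Hy. auto_derive; auto. ring.
  - intros y Hy. rewrite Rabs_mult, (Rabs_pos_eq (Ka a y)) by (left; apply Ka_pos; lra).
    apply Rmult_le_compat; [apply Rabs_pos|left; apply Ka_pos; lra| |apply Ka_le_inv; lra].
    eapply Rle_trans; [apply Rabs_triang|]. rewrite Rabs_Ropp.
    pose proof (slope_le (x - y)). pose proof (slope_le (x + y)). lra.
Qed.

Let Ca : R := 4 + a ^ 2.

Lemma sine_Ka_int_symbol_error nu k : 1 <= nu ->
  Rabs (2 * sine_Ka_int a k (/ nu) nu - symbol a k) * INR k
    <= 2 * Ca * (INR k ^ 2 * / (nu + INR k)).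
Proof.
  intros Hnu. pose proof (Rinv_self_le nu Hnu) as Hinv.
  pose proof (symbol_close a a_pos k (/ nu) nu Hinv) as Hclose.
  assert (Hd4 : Rabs (2 * sine_Ka_int a k (/ nu) nu - symbol a k) <= 4).
  { eapply Rle_trans; [apply Rabs_triang|]. rewrite Rabs_Ropp, Rabs_mult, (Rabs_pos_eq 2) by lra.
    pose proof (sine_Ka_int_le_1 a a_pos k (/ nu) nu Hinv).
    pose proof (symbol_le_2 a a_pos k). lra. }
  set (d := Rabs (2 * sine_Ka_int a k (/ nu) nu - symbol a k)) in *.
  assert (Hd0 : 0 <= d) by apply Rabs_pos. assert (Ha2 : 0 < a ^ 2) by now apply pow_lt.
  destruct k as [|k]; [simpl; lra|].
  assert (Hk : 1 <= INR (S k)) by (rewrite S_INR; pose proof (pos_INR k); lra).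
  set (x := INR (S k)) in *. assert (HCa : Ca = 4 + a ^ 2) by reflexivity.
  assert (Hd : d * (nu + x) <= 2 * Ca * x).
  { destruct (Rle_dec x nu); [|nra].
    assert (d * nu <= Ca * x); [|nra].
    apply Rle_trans with (2 * (x * / nu + a ^ 2 / 2 / nu ^ 2) * nu);
      [apply Rmult_le_compat_r; lra|].
    replace (2 * (x * / nu + a ^ 2 / 2 / nu ^ 2) * nu) with (2 * x + a ^ 2 * / nu) by (field; lra).
    assert (/ nu <= 1) by (rewrite <- Rinv_1; apply Rinv_le_contravar; lra). nra. }
  apply Rmult_le_reg_r with (nu + x); [lra|].
  replace (2 * Ca * (x ^ 2 * / (nu + x)) * (nu + x)) with (2 * Ca * x * x) by (field; lra). nra.
Qed.

Let near_majorant (nu : R) (k : nat) : R :=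
  Ca * (/ nu * lap c k ^ 2 + 2 * nu * / ((nu + INR k) * (nu + INR k + 1))).

Lemma near_term_le nu k x : 1 <= nu ->
  Rabs (INR k * c k * cos (INR k * x) * (2 * sine_Ka_int a k (/ nu) nu - symbol a k))
  <= near_majorant nu k.
Proof.
  intros Hnu. pose proof (sine_Ka_int_symbol_error nu k Hnu) as Herror.
  pose proof (pos_INR k) as Hk.
  rewrite !Rabs_mult, (Rabs_pos_eq (INR k)) by auto.
  set (d := Rabs (2 * sine_Ka_int a k (/ nu) nu - symbol a k)) in *.
  assert (0 <= d) by apply Rabs_pos. pose proof (Rabs_pos (c k)) as Hc.
  set (y := INR k * (INR k * Rabs (c k))). set (w := / (nu + INR k)).
  assert (Hy : lap c k ^ 2 = y ^ 2).
  { unfold lap, y. rewrite <- (pow2_abs (INR k * _)), !Rabs_mult, (Rabs_pos_eq (INR k)) by auto.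
    ring. }
  assert (Hw : w ^ 2 <= 2 * / ((nu + INR k) * (nu + INR k + 1))).
  { unfold w. replace ((/ (nu + INR k)) ^ 2) with (2 * / (2 * (nu + INR k) ^ 2)) by (field; lra).
    apply Rmult_le_compat_l; [lra|]. apply Rinv_le_contravar; [apply Rmult_lt_0_compat|]; nra. }
  assert (Hamgm : 2 * (y * w) <= / nu * y ^ 2 + nu * w ^ 2).
  { assert (Hsq : 0 <= nu * (/ nu * y - w) ^ 2) by (apply Rmult_le_pos; [lra|apply pow2_ge_0]).
    replace (nu * (/ nu * y - w) ^ 2) with (/ nu * y ^ 2 - 2 * (y * w) + nu * w ^ 2) in Hsq
      by (field; lra). lra. }
  apply Rle_trans with (Rabs (c k) * (d * INR k)).
  { pose proof (Rabs_cos_le (INR k * x)).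
    replace (INR k * Rabs (c k) * Rabs (cos (INR k * x)) * d) with
      (Rabs (c k) * (d * INR k) * Rabs (cos (INR k * x))) by ring.
    rewrite <- (Rmult_1_r (Rabs (c k) * (d * INR k))) at 2. apply Rmult_le_compat_l; auto.
    apply Rmult_le_pos; [auto|now apply Rmult_le_pos]. }
  apply Rle_trans with (Rabs (c k) * (2 * Ca * (INR k ^ 2 * w))); [now apply Rmult_le_compat_l|].
  replace (Rabs (c k) * (2 * Ca * (INR k ^ 2 * w))) with (Ca * (2 * (y * w))) by (unfold y; ring).
  unfold near_majorant. rewrite Hy. apply Rmult_le_compat_l; [unfold Ca; nra|].
  assert (nu * w ^ 2 <= nu * (2 * / ((nu + INR k) * (nu + INR k + 1))))
    by (apply Rmult_le_compat_l; lra).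
  lra.
Qed.

Lemma is_series_near_majorant nu : 0 < nu ->
  is_series (near_majorant nu) (Ca * (/ nu * h2_energy c + 2 * nu * / nu)).
Proof.
  intros Hnu. apply (is_series_scal_l Ca (fun k => _ + _) (_ + _)).
  apply (is_series_plus (fun k => / nu * lap c k ^ 2)).
  - apply (is_series_scal_l (/ nu) (fun k => lap c k ^ 2) (h2_energy c)).
    now apply Series_correct, ex_series_lap_sq.
  - apply (is_series_scal_l (2 * nu) _ (/ nu)). now apply is_series_telescope.
Qed.

(* Split the singular integral at distance [1 / (1 + h2_energy c)]: beyond it only the sup norm
   of the slope enters, with a logarithmic constant; below it the energy suffices. *)
Lemma velocity_x_log_le x : Rabs (velocity_x a c x) <= 4 * Th * ln (1 + h2_energy c) + 3 * Ca.
Proof.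
  pose proof (h2_energy_nonneg c c_rapid) as HE. set (nu := 1 + h2_energy c).
  assert (Hnu : 1 <= nu) by (unfold nu; lra). pose proof (Rinv_self_le nu Hnu) as Hinv.
  set (A k := INR k * c k * cos (INR k * x)). destruct (c_rapid 4%nat) as [M HM].
  assert (HA : decay 3 M A).
  { apply decay_mult_le_1; [intros; apply Rabs_cos_le|now apply decay_INR_mult]. }
  set (far k := 2 * sine_Ka_int a k (/ nu) nu).
  assert (Hfar : Rabs (Series (fun k => A k * far k)) <= 4 * Th * ln nu).
  { unfold far.
    rewrite <- (is_RInt_unique _ _ _ _ (is_RInt_sin_series_Ka a a_pos A M HA (/ nu) nu Hinv)).
    rewrite (RInt_ext _ (fun y => (slope c (x - y) - slope c (x + y)) * Ka a y))
      by (intros; now rewrite slope_reflect_minus).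
    now apply RInt_slope_reflect_Ka_le. }
  assert (Hnear : Rabs (Series (fun k => A k * far k) - Series (fun k => A k * symbol a k))
    <= 3 * Ca).
  { pose proof (is_series_near_majorant nu ltac:(lra)) as Hmajorant.
    rewrite <- Series_minus; [| |apply (ex_series_mult_2 A M HA), symbol_le_2; auto].
    2: { apply (ex_series_mult_2 A M HA). intros k. unfold far.
         rewrite Rabs_mult, Rabs_pos_eq by lra.
         pose proof (sine_Ka_int_le_1 a a_pos k _ _ Hinv). lra. }
    apply Rle_trans with (Ca * (/ nu * h2_energy c + 2 * nu * / nu)).
    - rewrite <- (is_series_unique _ _ Hmajorant).
      apply Rabs_Series_le; [now eexists; exact Hmajorant|].
      intros k. rewrite <- Rmult_minus_distr_l. now apply near_term_le.
    - assert (/ nu * h2_energy c <= 1).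
      { apply Rmult_le_reg_l with nu; [lra|]. rewrite <- Rmult_assoc, Rinv_r by lra.
        unfold nu. lra. }
      replace (2 * nu * / nu) with 2 by (field; lra). assert (0 < Ca) by (unfold Ca; nra). nra. }
  replace (velocity_x a c x) with (Series (fun k => A k * symbol a k)).
  - apply Rabs_le_between in Hfar, Hnear. apply Rabs_le. fold nu. lra.
  - apply Series_ext. intros k. unfold A. rewrite Rplus_0_r. ring.
Qed.
End LogBound.

Definition velocity_xx (a : R) (c : nat -> R) (x : R) : R :=
  - sin_series (lap (fun k => symbol a k * c k)) x.
Definition curvature_x (c : nat -> R) (x : R) : R := sin_series (fun k => INR k * lap c k) x.
Definition h2_energy_rate (a g : R) (c : nat -> R) : R :=
  2 * Series (fun k => lap c k * lap (transport g (symbol a) c c) k).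

Lemma is_derive_curvature c x : rapid c -> is_derive (curvature c) x (curvature_x c x).
Proof.
  intros Hc. unfold curvature_x. rewrite <- (Ropp_involutive (sin_series _ x)).
  now apply is_derive_Ropp, is_derive_cos_series_sin, rapid_lap.
Qed.

Lemma continuous_curvature c x : rapid c -> continuous (curvature c) x.
Proof. intros Hc. eapply continuous_of_is_derive. now apply is_derive_curvature. Qed.

Lemma is_RInt_curvature_mult c d : rapid c -> rapid d ->
  is_RInt (fun x => curvature c x * curvature d x) 0 PI
    (PI / 2 * Series (fun k => lap c k * lap d k)).
Proof.
  intros Hc Hd. eapply is_RInt_ext; [|apply (is_RInt_parseval 0)].
  - intros x _. unfold curvature. simpl. ring.
  - now rewrite Rmult_0_r, sin_0.
  - now apply rapid_lap.
  - now apply rapid_lap.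
  - apply Rmult_0_l.
Qed.

Lemma is_RInt_curvature_sq c : rapid c ->
  is_RInt (fun x => curvature c x ^ 2) 0 PI (PI / 2 * h2_energy c).
Proof.
  intros Hc. unfold h2_energy.
  rewrite (Series_ext _ (fun k => lap c k * lap c k)) by (intros; ring).
  eapply is_RInt_ext; [|now apply is_RInt_curvature_mult]. intros x _. simpl. ring.
Qed.

Section EnergyInequality.
Variables (a g : R) (c : nat -> R) (Th L : R).
Hypothesis a_pos : 0 < a.
Hypothesis g_pos : 0 < g.
Hypothesis c_rapid : rapid c.
Hypothesis c_0 : c O = 0.
Hypothesis slope_le : forall x, Rabs (slope c x) <= Th.
Hypothesis velocity_x_le : forall x, Rabs (velocity_x a c x) <= L.

Let symbol_c_rapid : rapid (fun k => symbol a k * c k) := rapid_symbol_mult c c_rapid a a_pos.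

Lemma is_derive_velocity_x x : is_derive (velocity_x a c) x (velocity_xx a c x).
Proof. apply is_derive_cos_series_sin. now apply rapid_INR_mult. Qed.

Lemma curvature_transport_velocity x : curvature (transport g (symbol a) c c) x =
  - (g * (velocity_xx a c x * slope c x + 2 * velocity_x a c x * curvature c x
          + velocity a c x * curvature_x c x)).
Proof.
  pose proof (rapid_transport g _ g_pos (symbol_le_2 a a_pos) c c_rapid) as Hrapid.
  rewrite <- (is_derive_unique _ _ _ (is_derive_slope _ Hrapid x)). apply is_derive_unique.
  apply is_derive_ext with
    (fun y => - (g * (velocity_x a c y * slope c y + velocity a c y * curvature c y))).
  { intros y. rewrite slope_transport_velocity by auto. lra. }
  replace (velocity_xx a c x * slope c x + 2 * velocity_x a c x * curvature c x
           + velocity a c x * curvature_x c x) with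
    ((velocity_xx a c x * slope c x + velocity_x a c x * curvature c x)
     + (velocity_x a c x * curvature c x + velocity a c x * curvature_x c x)) by ring.
  apply is_derive_Ropp.
  apply (is_derive_scal (fun y => velocity_x a c y * slope c y + velocity a c y * curvature c y)).
  apply is_derive_Rplus; apply is_derive_Rmult.
  - apply is_derive_velocity_x.
  - now apply is_derive_slope.
  - now apply is_derive_velocity.
  - now apply is_derive_curvature.
Qed.

Lemma is_RInt_velocity_xx_sq : is_RInt (fun x => velocity_xx a c x ^ 2) 0 PI
  (PI / 2 * h2_energy (fun k => symbol a k * c k)).
Proof.
  unfold h2_energy. set (b := lap (fun k => symbol a k * c k)).
  rewrite (Series_ext _ (fun k => b k * b k)) by (intros; ring).
  eapply is_RInt_ext; [|apply (is_RInt_parseval (- (PI / 2)))].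
  - intros x _. unfold velocity_xx. fold b. rewrite sin_series_cos. simpl. ring.
  - replace (2 * - (PI / 2)) with (- PI) by field. rewrite sin_neg, sin_PI. ring.
  - now apply rapid_lap.
  - now apply rapid_lap.
  - apply Rmult_0_l.
Qed.

Lemma h2_energy_symbol_le : h2_energy (fun k => symbol a k * c k) <= 4 * h2_energy c.
Proof.
  unfold h2_energy. rewrite <- Series_scal_l.
  apply Series_le; [|now apply ex_series_Rscal, ex_series_lap_sq].
  intros k. split; [apply pow2_ge_0|].
  replace (lap (fun k => symbol a k * c k) k ^ 2) with (symbol a k ^ 2 * lap c k ^ 2)
    by (unfold lap; ring).
  apply Rmult_le_compat_r; [apply pow2_ge_0|]. rewrite <- pow2_abs.
  pose proof (symbol_le_2 a a_pos k). pose proof (Rabs_pos (symbol a k)). nra.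
Qed.

Let flux' (x : R) : R :=
  velocity_x a c x * curvature c x ^ 2 + velocity a c x * (2 * curvature c x * curvature_x c x).

Lemma is_RInt_curvature_flux : is_RInt flux' 0 PI 0.
Proof.
  replace 0 with (velocity a c PI * curvature c PI ^ 2 - velocity a c 0 * curvature c 0 ^ 2) at 2.
  2: { unfold velocity. rewrite sin_series_0, sin_series_PI. ring. }
  apply (is_RInt_derive (fun x => velocity a c x * curvature c x ^ 2)); intros x _.
  - apply is_derive_Rmult; [now apply is_derive_velocity|].
    replace (2 * curvature c x * curvature_x c x)
      with (INR 2 * curvature_x c x * curvature c x ^ 1) by (simpl; ring).
    now apply is_derive_pow, is_derive_curvature.
  - assert (Hcurv : continuous (curvature c) x) by now apply continuous_curvature.
    apply continuous_Rplus; apply continuous_Rmult.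
    + eapply continuous_of_is_derive, is_derive_velocity_x.
    + apply continuous_Rmult; [exact Hcurv|].
      apply continuous_Rmult; [exact Hcurv|apply continuous_const].
    + eapply continuous_of_is_derive. now apply is_derive_velocity.
    + apply continuous_Rmult; [now apply continuous_Rscal|].
      apply continuous_sin_series. now apply rapid_INR_mult, rapid_lap.
Qed.

Lemma curvature_transport_le x :
  curvature c x * curvature (transport g (symbol a) c c) x + g / 2 * flux' x
  <= g * (Th / 2 * (velocity_xx a c x ^ 2 + curvature c x ^ 2) + 3 / 2 * L * curvature c x ^ 2).
Proof.
  rewrite curvature_transport_velocity. unfold flux'.
  pose proof (slope_le x) as Hslope. pose proof (velocity_x_le x) as Hvel.
  set (vxx := velocity_xx a c x). set (k := curvature c x). set (kx := curvature_x c x).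
  set (th := slope c x) in *. set (vx := velocity_x a c x) in *. set (v := velocity a c x).
  assert (Hvxx : - (vxx * th * k) <= Th / 2 * (vxx ^ 2 + k ^ 2)).
  { assert (Hyoung : Rabs (vxx * k) <= / 2 * (vxx ^ 2 + k ^ 2)).
    { apply Rabs_le. pose proof (pow2_ge_0 (vxx - k)). pose proof (pow2_ge_0 (vxx + k)). lra. }
    assert (Hprod : Rabs (th * (vxx * k)) <= Th * (/ 2 * (vxx ^ 2 + k ^ 2))).
    { rewrite Rabs_mult. apply Rmult_le_compat; auto using Rabs_pos. }
    apply Rabs_le_between in Hprod. lra. }
  assert (Hvx : - (vx * k ^ 2) <= L * k ^ 2).
  { apply Rabs_le_between in Hvel. pose proof (pow2_ge_0 k). nra. }
  replace (k * - (g * (vxx * th + 2 * vx * k + v * kx)) + g / 2 * (vx * k ^ 2 + v * (2 * k * kx)))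
    with (g * (- (vxx * th * k) + 3 / 2 * - (vx * k ^ 2))) by field.
  apply Rmult_le_compat_l; lra.
Qed.

Lemma h2_energy_rate_le : h2_energy_rate a g c <= g * (5 * Th + 3 * L) * h2_energy c.
Proof.
  pose proof (rapid_transport g _ g_pos (symbol_le_2 a a_pos) c c_rapid) as Hrapid.
  pose proof (is_RInt_curvature_sq c c_rapid) as Hcurv. pose proof PI_gt_3.
  assert (Hint : PI / 2 * Series (fun k => lap c k * lap (transport g (symbol a) c c) k) + g / 2 * 0
    <= g * (Th / 2 * (PI / 2 * h2_energy (fun k => symbol a k * c k) + PI / 2 * h2_energy c)
            + 3 / 2 * L * (PI / 2 * h2_energy c))).
  { apply (is_RInt_le
      (fun x => curvature c x * curvature (transport g (symbol a) c c) x + g / 2 * flux' x)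
      (fun x => g * (Th / 2 * (velocity_xx a c x ^ 2 + curvature c x ^ 2)
                     + 3 / 2 * L * curvature c x ^ 2)) 0 PI).
    - lra.
    - apply is_RInt_Rplus; [now apply is_RInt_curvature_mult|].
      apply is_RInt_Rscal, is_RInt_curvature_flux.
    - apply is_RInt_Rscal, is_RInt_Rplus; apply is_RInt_Rscal; [|exact Hcurv].
      apply is_RInt_Rplus; [exact is_RInt_velocity_xx_sq|exact Hcurv].
    - intros x _. apply curvature_transport_le. }
  assert (HTh : 0 <= Th) by (eapply Rle_trans; [apply Rabs_pos|apply (slope_le 0)]).
  assert (Hsym : Th * h2_energy (fun k => symbol a k * c k) <= Th * (4 * h2_energy c))
    by (apply Rmult_le_compat_l; [exact HTh|exact h2_energy_symbol_le]).
  unfold h2_energy_rate. apply Rmult_le_reg_l with (PI / 4); [lra|].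
  replace (PI / 4 * (2 * Series _)) with
    (PI / 2 * Series (fun k => lap c k * lap (transport g (symbol a) c c) k)) by field.
  eapply Rle_trans; [apply Rle_trans with (2 := Hint); lra|].
  replace (PI / 4 * (g * (5 * Th + 3 * L) * h2_energy c)) with
    (g * (PI / 4 * (Th * (4 * h2_energy c) + Th * h2_energy c)
          + 3 / 2 * L * (PI / 2 * h2_energy c)))
    by field.
  apply Rmult_le_compat_l; [lra|]. apply Rplus_le_compat_r.
  replace (Th / 2 * _) with
    (PI / 4 * (Th * h2_energy (fun k => symbol a k * c k) + Th * h2_energy c)) by field.
  apply Rmult_le_compat_l; lra.
Qed.
End EnergyInequality.

Lemma ln_1_plus_nonneg x : 0 <= x -> 0 <= ln (1 + x).
Proof. intros Hx. rewrite <- ln_1. apply ln_le; lra. Qed.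

Lemma double_exponential_gronwall (E E' G G' : R -> R) C t0 t : t0 <= t ->
  (forall s, t0 <= s <= t -> is_derive E s (E' s)) ->
  (forall s, t0 <= s <= t -> is_derive G s (G' s)) -> (forall s, t0 <= s <= t -> 0 <= E s) ->
  (forall s, t0 <= s <= t -> E' s <= C * (1 + G' s) * ((1 + E s) * (1 + ln (1 + E s)))) ->
  E t <= exp (exp (ln (1 + ln (1 + E t0)) + C * ((t + G t) - (t0 + G t0)))).
Proof.
  intros Ht HE HG HE0 Hgrowth. set (Z s := ln (1 + ln (1 + E s))).
  assert (Hmono : C * (t0 + G t0) - Z t0 <= C * (t + G t) - Z t).
  { apply (le_of_nonneg_derive (fun s => C * (s + G s) - Z s)
      (fun s => C * (1 + G' s) - E' s * / (1 + E s) * / (1 + ln (1 + E s)))); [exact Ht| |].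
    - intros s Hs. pose proof (HE0 s Hs) as HEs. pose proof (ln_1_plus_nonneg _ HEs).
      apply is_derive_Rminus.
      + apply (is_derive_scal (fun s => s + G s)).
        apply is_derive_Rplus; [apply (is_derive_id s)|auto].
      + apply (is_derive_comp ln (fun s => 1 + ln (1 + E s))); [apply is_derive_ln; lra|].
        rewrite <- (Rplus_0_l (_ * _)). apply is_derive_Rplus; [apply is_derive_Rconst|].
        apply (is_derive_comp ln (fun s => 1 + E s)); [apply is_derive_ln; lra|].
        rewrite <- (Rplus_0_l (E' s)). apply is_derive_Rplus; [apply is_derive_Rconst|auto].
    - intros s Hs. pose proof (HE0 s Hs) as HEs. pose proof (ln_1_plus_nonneg _ HEs).
      specialize (Hgrowth s Hs). apply -> Rminus_le_0.
      apply Rmult_le_reg_r with ((1 + E s) * (1 + ln (1 + E s))); [apply Rmult_lt_0_compat; lra|].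
      replace (E' s * / (1 + E s) * / (1 + ln (1 + E s)) * ((1 + E s) * (1 + ln (1 + E s))))
        with (E' s) by (field; lra). exact Hgrowth. }
  pose proof (HE0 t ltac:(lra)) as HEt. pose proof (ln_1_plus_nonneg _ HEt).
  assert (Hinner : 1 + ln (1 + E t) <= exp (Z t0 + C * (t + G t - (t0 + G t0)))).
  { rewrite <- (exp_ln (1 + ln (1 + E t))) by lra. apply exp_le. fold (Z t). lra. }
  apply Rle_trans with (1 + E t); [lra|]. rewrite <- (exp_ln (1 + E t)) by lra. apply exp_le.
  unfold Z in Hinner. lra.
Qed.

Section Continuation.
Variables (a g Tm : R) (c : R -> nat -> R).
Hypothesis a_pos : 0 < a.
Hypothesis g_pos : 0 < g.
Hypothesis c_sol : mode_solution g (symbol a) Tm c.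

Let c_rapid : forall t, t < Tm -> rapid (c t) := modes_rapid _ _ _ _ c_sol.

Lemma is_derive_h2_energy t : 0 < t < Tm ->
  is_derive (fun s => h2_energy (c s)) t (h2_energy_rate a g (c t)).
Proof.
  intros Ht. pose proof (modes_unif_rapid _ _ _ _ c_sol) as Hunif.
  assert (Hunif' : unif_rapid Tm (fun t => transport g (symbol a) (c t) (c t)))
    by (apply unif_rapid_transport; auto; now apply symbol_le_2).
  destruct (unif_rapid_near_interior Tm c t 4 Hunif Ht) as [d1 [A [Hd1 HA]]].
  destruct (unif_rapid_near_interior Tm _ t 2 Hunif' Ht) as [d2 [B [Hd2 HB]]].
  unfold h2_energy_rate. rewrite <- Series_scal_l.
  apply (is_derive_Series (fun s k => lap (c s) k ^ 2)
    (fun s k => 2 * (lap (c s) k * lap (transport g (symbol a) (c s) (c s)) k))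
    (fun k => 2 * (A * B) * weight k) t (Rmin d1 d2)).
  - now apply Rmin_pos.
  - apply ex_series_weight.
  - intros s k Hs. replace (2 * _) with
      (INR 2 * lap (transport g (symbol a) (c s) (c s)) k * lap (c s) k ^ 1) by (simpl; ring).
    apply is_derive_pow. do 2 apply (is_derive_scal (fun s => _ : R)).
    apply (modes_ode _ _ _ _ c_sol), HA. eapply Rlt_le_trans; [exact Hs|apply Rmin_l].
  - intros s k Hs. rewrite Rabs_mult, (Rabs_pos_eq 2), !Rmult_assoc by lra.
    apply Rmult_le_compat_l; [lra|]. rewrite <- Rmult_assoc.
    apply decay_mult_le_weight; apply decay_lap; [apply HA|apply HB];
      eapply Rlt_le_trans; try exact Hs; [apply Rmin_l|apply Rmin_r].
  - intros s Hs. apply ex_series_lap_sq, c_rapid, HA.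
    eapply Rlt_le_trans; [exact Hs|apply Rmin_l].
Qed.

Definition growth_constant : R := g * (17 + 9 * (4 + a ^ 2)).

Lemma h2_energy_rate_log_le t : 0 < t < Tm -> h2_energy_rate a g (c t) <=
  growth_constant * (1 + Linf (pdx (density c) t))
  * ((1 + h2_energy (c t)) * (1 + ln (1 + h2_energy (c t)))).
Proof.
  intros Ht. pose proof (c_rapid t ltac:(lra)) as Hrapid.
  pose proof (h2_energy_nonneg _ Hrapid) as HE. set (Th := Linf (pdx (density c) t)).
  assert (Hslope : forall x, Rabs (slope (c t) x) <= Th)
    by (intros; apply (slope_le_Linf a g Tm c c_sol); lra).
  assert (HTh : 0 <= Th) by (eapply Rle_trans; [apply Rabs_pos|apply (Hslope 0)]).
  pose proof (ln_1_plus_nonneg _ HE) as Hln.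
  pose proof (h2_energy_rate_le a g (c t) Th _ a_pos g_pos Hrapid
    (modes_zero _ _ _ _ c_sol t ltac:(lra)) Hslope
    (velocity_x_log_le a (c t) Th a_pos Hrapid Hslope)) as Hrate.
  eapply Rle_trans; [exact Hrate|]. unfold growth_constant.
  set (E := h2_energy (c t)) in *. set (l := ln (1 + E)) in *. set (Ca := 4 + a ^ 2).
  assert (HCa : 0 < Ca) by (unfold Ca; nra). assert (HThl : 0 <= Th * l) by now apply Rmult_le_pos.
  assert (Hcoef : 5 * Th + 3 * (4 * Th * l + 3 * Ca) <= (17 + 9 * Ca) * ((1 + Th) * (1 + l))).
  { assert (0 <= Ca * (Th + l + Th * l)) by (apply Rmult_le_pos; lra). lra. }
  rewrite !Rmult_assoc. apply Rmult_le_compat_l; [lra|].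
  replace ((17 + 9 * Ca) * ((1 + Th) * ((1 + E) * (1 + l)))) with
    ((17 + 9 * Ca) * ((1 + Th) * (1 + l)) * (1 + E)) by ring.
  apply Rmult_le_compat; lra.
Qed.

Lemma h2_energy_bounded K : 0 < Tm ->
  (forall t, 0 <= t < Tm -> RInt (fun s => Linf (pdx (density c) s)) 0 t <= K) ->
  exists B, forall t, 0 <= t < Tm -> h2_energy (c t) <= B.
Proof.
  intros HTm HK. set (F s := Linf (pdx (density c) s)) in *. set (t0 := Tm / 2).
  assert (Ht0 : 0 < t0 < Tm) by (unfold t0; lra).
  assert (HF : forall s t, s < Tm -> t < Tm -> ex_RInt F s t)
    by (intros; now apply (ex_RInt_Linf_pdx a g Tm c c_sol)).
  assert (HF0 : forall s, s < Tm -> 0 <= F s).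
  { intros s Hs. eapply Rle_trans; [apply Rabs_pos|now apply (slope_le_Linf a g Tm c c_sol s 0)]. }
  destruct (modes_unif_rapid _ _ _ _ c_sol t0 (proj2 Ht0) 4%nat) as [A HA].
  set (B := exp (exp (ln (1 + ln (1 + h2_energy (c t0))) + growth_constant * (Tm + K)))).
  exists (Rmax (2 * A ^ 2) B). intros t Ht. destruct (Rle_dec t0 t) as [Hle|Hgt].
  2: { eapply Rle_trans; [|apply Rmax_l]. apply h2_energy_le, HA. lra. }
  eapply Rle_trans; [|apply Rmax_r]. eapply Rle_trans;
    [apply (double_exponential_gronwall (fun s => h2_energy (c s))
      (fun s => h2_energy_rate a g (c s))
      (fun s => RInt F 0 s) F growth_constant t0 t Hle)|].
  - intros s Hs. apply is_derive_h2_energy. lra.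
  - intros s Hs. apply (is_derive_RInt F (fun s => RInt F 0 s) 0 s).
    + apply (filter_imp (fun r => 0 < r < Tm)); [|apply locally_interior; lra].
      intros r Hr. apply is_RInt_of_ex, HF; lra.
    + apply (continuous_Linf_pdx a g Tm c c_sol). lra.
  - intros s Hs. apply h2_energy_nonneg, c_rapid. lra.
  - intros s Hs. apply h2_energy_rate_log_le. lra.
  - apply exp_le, exp_le, Rplus_le_compat_l. apply Rmult_le_compat_l.
    + unfold growth_constant. pose proof (pow2_ge_0 a). nra.
    + specialize (HK t Ht). assert (0 <= RInt F 0 t0); [|lra].
      apply RInt_nonneg; [lra|apply HF; lra|]. intros; apply HF0; lra.
Qed.
End Continuation.

(** * The maximal solution *)

Lemma psum_moment_sq_le_h2_energy c n : rapid c ->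
  psum (fun k => moment 2 c k ^ 2) n <= h2_energy c.
Proof.
  intros Hc. rewrite (psum_ext _ (fun k => lap c k ^ 2)).
  - apply psum_le_Series; [now apply ex_series_lap_sq|intros; apply pow2_ge_0].
  - intros k _. unfold moment, lap. rewrite Rpow_mult_distr, pow2_abs. ring.
Qed.

Lemma maximal_mode_solution g m c0 : 0 < g -> (forall k, Rabs (m k) <= 2) -> c0 O = 0 -> rapid c0 ->
  exists c, (forall k, c 0 k = c0 k) /\ (exists T, 0 < T /\ mode_solution g m T c) /\
    forall B, (forall T, 0 < T -> mode_solution g m T c -> T <= B) ->
    exists Tstar, 0 < Tstar /\ mode_solution g m Tstar c /\
      forall K, exists t, 0 <= t < Tstar /\ K < h2_energy (c t).
Proof.
  intros Hg Hm Hc0 Hrapid. destruct free_ultra_exists as [U HU].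
  set (good := energy_bounded g m c0 U).
  assert (Hsol : forall T, 0 < T -> (forall T', T' < T -> good T') ->
    mode_solution g m T (limit_modes g m c0 U)) by (intros; now apply limit_modes_solution).
  assert (Hdown : forall T, good T -> forall T', T' < T -> good T').
  { intros T HT T' Hlt. apply (energy_bounded_le g m c0 U HU T); [lra|exact HT]. }
  destruct (energy_bounded_short_time g m c0 U Hg Hm Hc0 Hrapid HU) as [T0 [HT0 Hgood0]].
  exists (limit_modes g m c0 U). split; [intros k; apply limit_modes_initial; [exact HU|lra]|].
  split; [exists T0; split; [exact HT0|now apply Hsol, Hdown]|]. intros B HB.
  destruct (completeness good) as [Tstar [Hub Hlub]].
  { exists (Rmax 0 B). intros T HT.
    destruct (Rle_dec T 0); [eapply Rle_trans; [eassumption|apply Rmax_l]|].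
    eapply Rle_trans; [|apply Rmax_r]. apply HB; [lra|]. apply Hsol; [lra|now apply Hdown]. }
  { now exists T0. }
  assert (HTstar : 0 < Tstar) by (specialize (Hub T0 Hgood0); lra).
  assert (Hgood : forall T, T < Tstar -> good T).
  { intros T HT. apply NNPP. intros Hbad. apply (Rlt_not_le _ _ HT), Hlub. intros T' HT'.
    apply Rnot_lt_le. intros Hlt. now apply Hbad, (Hdown T'). }
  pose proof (Hsol Tstar HTstar Hgood) as Hstar.
  exists Tstar. split; [exact HTstar|split; [exact Hstar|]].
  intros K. apply NNPP. intros Hno.
  destruct (energy_bounded_past g m c0 U Hg Hm Hc0 Hrapid HU Tstar K HTstar Hgood) as
    [T [HT HgoodT]].
  - intros t n Ht. eapply Rle_trans; [apply psum_moment_sq_le_h2_energy|].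
    + apply (modes_rapid _ _ _ _ Hstar). lra.
    + apply Rnot_lt_le. intros HK. apply Hno. now exists t.
  - specialize (Hub T HgoodT). lra.
Qed.

Lemma even_periodic_pos_inside (f : R -> R) : periodic2pi f -> (forall x, f (- x) = f x) ->
  (forall x, continuous f x) -> (forall x, 0 <= f x) -> f 0 = 0 -> (exists x, f x <> 0) ->
  exists x, 0 < x < PI /\ 0 < f x.
Proof.
  intros Hp He Hc Hpos Hzero [z Hz]. pose proof PI_gt_3.
  destruct (even_periodic_reduce f z Hp He) as [y [Hy Ezy]]. rewrite Ezy in Hz.
  assert (Hfy : 0 < f y) by (specialize (Hpos y); lra).
  assert (Hy0 : y <> 0) by (intros ->; auto).
  destruct (Rlt_dec y PI); [exists y; lra|]. assert (y = PI) by lra; subst y.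
  destruct (proj1 (filterlim_R_eps _ _) (Hc PI) _ Hfy) as [d Hd].
  pose proof (cond_pos d) as Hd0. pose proof (Rmin_l (d / 2) 1). pose proof (Rmin_r (d / 2) 1).
  assert (0 < Rmin (d / 2) 1) by (apply Rmin_pos; lra).
  exists (PI - Rmin (d / 2) 1). split; [lra|].
  assert (Hclose : Rabs (f (PI - Rmin (d / 2) 1) - f PI) < f PI).
  { apply Hd. change (Rabs (PI - Rmin (d / 2) 1 - PI) < d). rewrite Rabs_left; lra. }
  apply Rabs_def2 in Hclose. lra.
Qed.

Section Density.
Variables (a g Tm : R) (c : R -> nat -> R).
Hypothesis a_pos : 0 < a.
Hypothesis g_pos : 0 < g.
Hypothesis Tm_pos : 0 < Tm.
Hypothesis c_sol : mode_solution g (symbol a) Tm c.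

Let c_rapid : forall t, t < Tm -> rapid (c t) := modes_rapid _ _ _ _ c_sol.

Lemma density_classical_solution rho0 : (forall x, profile (c 0) x = rho0 x) ->
  classical_solution a g rho0 Tm (density c).
Proof.
  intros Hinit. split; [exact Hinit|]. split; [intros t _; apply profile_periodic|].
  split; [exact (pd_density_regular g (symbol a) g_pos (symbol_le_2 a a_pos) Tm c c_sol)|]. split.
  - intros n t x Ht. eapply filterlim_filter_le_1; [apply filter_le_within|].
    apply (continuous_iter_pdx_density g (symbol a) Tm c c_sol n t x). lra.
  - intros t x Ht. exists (velocity a (c t) x).
    split; [apply is_Ha_profile; auto; apply c_rapid; lra|].
    rewrite (pdx_density a g Tm c c_sol) by lra.
    replace (pdt (density c) t x) with (- (g * velocity a (c t) x * slope (c t) x)); [ring|].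
    symmetry. now apply is_derive_unique, (is_derive_density_velocity a g Tm c).
Qed.

Lemma gradient_integral_diverges : (forall K, exists t, 0 <= t < Tm /\ K < h2_energy (c t)) ->
  filterlim (fun t => RInt (fun s => Linf (pdx (density c) s)) 0 t)
    (at_left Tm) (Rbar_locally p_infty).
Proof.
  intros Hunb. assert (Hex := ex_RInt_Linf_pdx a g Tm c c_sol).
  apply filterlim_at_left_p_infty with 0; [exact Tm_pos| |].
  - intros x y Hxy Hy. rewrite <- (RInt_Chasles_R _ 0 x y) by (apply Hex; lra).
    assert (0 <= RInt (fun s => Linf (pdx (density c) s)) x y); [|lra].
    apply RInt_nonneg; [lra|apply Hex; lra|]. intros s Hs.
    eapply Rle_trans; [apply Rabs_pos|apply (slope_le_Linf a g Tm c c_sol s 0); lra].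
  - intros K. apply NNPP. intros Hno.
    destruct (h2_energy_bounded a g Tm c a_pos g_pos c_sol K Tm_pos) as [B HB].
    { intros t Ht. apply Rnot_lt_le. intros HK. apply Hno. now exists t. }
    destruct (Hunb B) as [t [Ht HBt]]. specialize (HB t Ht). lra.
Qed.

Lemma density_pos_later x : 0 < profile (c 0) x ->
  exists t, 0 < t < Tm /\ profile (c 0) x / 2 <= profile (c t) x.
Proof.
  intros Hx.
  pose proof (continuous_iter_pdx_density g (symbol a) Tm c c_sol 0 0 x Tm_pos) as Hcont.
  destruct (proj1 (filterlim_R_eps _ _) Hcont (profile (c 0) x / 2) ltac:(lra)) as [d Hd].
  pose proof (cond_pos d).
  set (t := Rmin (d / 2) (Tm / 2)). assert (Ht : 0 < t) by (apply Rmin_pos; lra).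
  assert (t <= d / 2) by apply Rmin_l. assert (t <= Tm / 2) by apply Rmin_r.
  exists t. split; [lra|]. specialize (Hd (t, x)).
  assert (Hclose : Rabs (profile (c t) x - profile (c 0) x) < profile (c 0) x / 2).
  { apply Hd. split; [|apply ball_center]. change (Rabs (t - 0) < d). rewrite Rabs_pos_eq; lra. }
  apply Rabs_def2 in Hclose. lra.
Qed.
End Density.

Lemma lifespan_bounded a g c x : 0 < a -> 0 < g ->
  (exists T, 0 < T /\ mode_solution g (symbol a) T c) ->
  (forall y, 0 <= y <= PI -> 0 <= slope (c 0) y) -> 0 < x < PI -> 0 < profile (c 0) x ->
  exists B, forall T, 0 < T -> mode_solution g (symbol a) T c -> T <= B.
Proof.
  intros Ha Hg [T0 [HT0 Hsol0]] Hslope Hx Hpos.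
  destruct (density_pos_later a g T0 c HT0 Hsol0 x Hpos) as [t0 [Ht0 Hhalf]].
  assert (Hs1 : sqrt x ^ 2 = x) by (apply pow2_sqrt; lra).
  assert (Hs0 : sqrt ((x + PI) / 2) ^ 2 = (x + PI) / 2) by (apply pow2_sqrt; lra).
  eexists. intros T _ Hsol.
  destruct (Rle_dec T T0) as [Hle|Hgt]; [eapply Rle_trans; [exact Hle|apply Rmax_l]|].
  eapply Rle_trans; [|apply Rmax_r].
  apply (lifespan_le a g T c Ha Hg Hsol Hslope t0 (sqrt x) (sqrt ((x + PI) / 2))
    (profile (c 0) x / 2)); rewrite ?Hs1, ?Hs0; try lra.
  split; [apply sqrt_lt_R0; lra|apply sqrt_lt_1; lra].
Qed.

Theorem theorem1p2 (a g : R) (rho0 : R -> R) :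
  0 < a -> 0 < g ->
  smooth_per rho0 -> bounded_fun rho0 ->
  (forall x, 0 <= rho0 x) ->
  (forall x, rho0 (- x) = rho0 x) ->
  rho0 0 = 0 ->
  (forall x, 0 <= x < PI -> 0 <= Derive rho0 x) ->
  (exists x, rho0 x <> 0) ->
  exists (Tstar : R) (rho : R -> R -> R),
    0 < Tstar /\
    classical_solution a g rho0 Tstar rho /\
    (forall t, 0 <= t < Tstar ->
       smooth_per (rho t) /\ bounded_fun (rho t) /\ (forall x, 0 <= rho t x)) /\
    (forall t, 0 <= t < Tstar -> ex_RInt (fun s => Linf (pdx rho s)) 0 t) /\
    filterlim (fun t => RInt (fun s => Linf (pdx rho s)) 0 t)
      (at_left Tstar) (Rbar_locally p_infty).
Proof.
  intros Ha Hg Hsmooth _ Hpos Heven Hzero Hmono Hnonzero.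
  destruct (even_smooth_is_profile rho0 Hsmooth Heven) as [c0 [Hc00 [Hc0 Hprofile0]]].
  destruct (maximal_mode_solution g (symbol a) c0 Hg (symbol_le_2 a Ha) Hc00 Hc0)
    as [c [Hinit [Hlocal Hmax]]].
  assert (Hprofile : forall x, profile (c 0) x = rho0 x).
  { intros x. rewrite (profile_ext _ _ x Hinit), <- Hprofile0. lra. }
  assert (Hslope : forall x, 0 <= x <= PI -> 0 <= slope (c 0) x).
  { intros x Hx. rewrite (slope_ext _ _ x Hinit).
    destruct (Req_dec x PI) as [->|Hne]; [rewrite slope_PI; lra|].
    rewrite <- (is_derive_unique _ _ _ (is_derive_profile c0 Hc0 x)).
    rewrite (Derive_ext _ rho0); [apply Hmono; lra|].
    intros y. rewrite <- Hprofile0. lra. }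
  destruct (even_periodic_pos_inside rho0 (proj1 Hsmooth) Heven (continuous_smooth rho0 Hsmooth)
    Hpos Hzero Hnonzero) as [x [Hx Hrho0x]].
  rewrite <- Hprofile in Hrho0x.
  destruct (lifespan_bounded a g c x Ha Hg Hlocal Hslope Hx Hrho0x) as [B HB].
  destruct (Hmax B HB) as [Tstar [HTstar [Hsol Hunbounded]]].
  assert (Hrapid := modes_rapid _ _ _ _ Hsol).
  exists Tstar, (density c). split; [exact HTstar|]. split; [now apply density_classical_solution|].
  split; [|split; [|now apply (gradient_integral_diverges a g)]].
  - intros t Ht. split; [apply profile_smooth, Hrapid; lra|].
    split; [apply profile_bounded, Hrapid; lra|].
    apply profile_nonneg_of_slope_nonneg; [apply Hrapid; lra|].
    now apply (slope_nonneg a g Tstar c).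
  - intros t Ht. apply (ex_RInt_Linf_pdx a g Tstar c Hsol); lra.
Qed.
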